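(* Let $y$ be the exact solution of the boundary-value problem and let $\overline{P}$ be the global numerical solution, i.e. the piecewise linear interpolant on the modified Shishkin mesh of the discrete solution $\overline{y}$ of $T\overline{y}=0$. Then there is a constant $C>0$, independent of $N$ and $\varepsilon$, such that $$\max_{x\in[0,1]}\left|y(x)-\overline{P}(x)\right|\leqslant \frac{C\ln^2N}{N^2}.$$
   Context: Boundary-value problem: $\varepsilon^2y''-f(x,y)=0$ for $x\in(0,1)$, $y(0)=y(1)=0$, where $\varepsilon\in(0,1)$ is a small perturbation parameter, $f\in C^{k}([0,1]\times\mathbb{R})$ with $k\geqslant 2$, and $f_y:=\partial f/\partial y\geqslant m>0$ on $[0,1]\times\mathbb{R}$ for a constant $m$. This problem has a unique solution $y$. Modified Shishkin mesh: let $N$ be a positive multiple of $4$, $\lambda:=\min\left\{\frac{2\varepsilon\ln N}{\sqrt{m}},\frac14\right\}$, $p=32(1-4\lambda)$, and let $\psi:[0,1]\to[0,1]$ be given by $\psi(\tau)=4\lambda\tau$ for $\tau\in[0,1/4]$, $\psi(\tau)=p(\tau-1/4)^3+4\lambda\tau$ for $\tau\in[1/4,1/2]$, and $\psi(\tau)=1-\psi(1-\tau)$ for $\tau\in[1/2,1]$. The mesh points are $x_i=\psi(i/N)$, $i=0,\ldots,N$, and $h_i=x_{i+1}-x_i$, $i=0,\ldots,N-1$. Parameters of the scheme: $t\in[0,1]$ is a fixed number, $\gamma$ is a constant (independent of $\varepsilon$ and $N$) with $\gamma\geqslant f_y(x,y)$ for all $(x,y)\in[0,1]\times\mathbb{R}$,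 and $\beta=\sqrt{\gamma}/\varepsilon$. Under this condition the discrete problem $T\overline{y}=0$ below has a unique solution $\overline{y}=(\overline{y}_0,\ldots,\overline{y}_N)^T$. Discrete operator: $T:\mathbb{R}^{N+1}\to\mathbb{R}^{N+1}$, $Tu=(Tu_0,Tu_1,\ldots,Tu_N)^T$ for $u=(u_0,\ldots,u_N)^T$, where $Tu_0=-u_0$, $Tu_N=-u_N$, and for $i=1,\ldots,N-1$, writing $f_j=f(x_j,u_j)$, $$Tu_i=\frac{\gamma}{\frac{\cosh(\beta h_{i-1})-1}{\sinh(\beta h_{i-1})}+\frac{\cosh(\beta h_i)-1}{\sinh(\beta h_i)}}\Big[\tfrac{(1-t)\cosh(\beta h_{i-1})+t}{\sinh(\beta h_{i-1})}(u_{i-1}-u_i)-\tfrac{(1-t)\cosh(\beta h_i)+t}{\sinh(\beta h_i)}(u_i-u_{i+1})$$ $$-\tfrac{(1-t)f_{i-1}+tf_i}{\gamma}\cdot\tfrac{\cosh(\beta h_{i-1})-1}{\sinh(\beta h_{i-1})}-\tfrac{tf_i+(1-t)f_{i+1}}{\gamma}\cdot\tfrac{\cosh(\beta h_i)-1}{\sinh(\beta h_i)}\Big].$$ Global numerical solution: $\overline{P}:[0,1]\to\mathbb{R}$ is defined by $$\overline{P}(x)=\frac{\overline{y}_i-\overline{y}_{i-1}}{x_i-x_{i-1}}(x-x_{i-1})+\overline{y}_{i-1},\qquad x\in[x_{i-1},x_i],\ i=1,\ldots,N.$$ *)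

(* Defs.v *)
From Stdlib Require Import Reals.
From Coquelicot Require Import Coquelicot.
Open Scope R_scope.

Definition unit_interval (x : R) : Prop := 0 <= x <= 1.

(** Functions on [[0,1] x R] are represented by total functions [R -> R -> R];
    their values at abscissae outside [[0,1]] are never used.  In particular
    the [x]-derivative is taken relative to [[0,1]], hence is one-sided at
    [x = 0] and [x = 1]: this is [is_derive] with [locally x] replaced by its
    trace on [[0,1]]. *)
Definition is_partial_x (g gx : R -> R -> R) : Prop :=
  forall x y, unit_interval x ->
    filterdiff (fun s => g s y) (within unit_interval (locally x))
      (fun h => scal h (gx x y)).

Definition is_partial_y (g gy : R -> R -> R) : Prop :=
  forall x y, unit_interval x -> is_derive (fun s => g x s) y (gy x y).

Definition continuous_strip (g : R -> R -> R) : Prop :=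
  continuous_on (fun z : R * R => unit_interval (fst z))
    (fun z => g (fst z) (snd z)).

(** [g] belongs to [C^k([0,1] x R)]. *)
Fixpoint Ck_strip (k : nat) (g : R -> R -> R) : Prop :=
  continuous_strip g /\
  match k with
  | O => True
  | S k' => exists gx gy : R -> R -> R,
      is_partial_x g gx /\ is_partial_y g gy /\
      Ck_strip k' gx /\ Ck_strip k' gy
  end.

(** [Derive] is total in Coquelicot, so the differentiability of [y] and of
    [Derive y] is required explicitly. *)
Definition bvp_solution (f : R -> R -> R) (eps : R) (y : R -> R) : Prop :=
  continuous_on unit_interval y /\
  (forall x, 0 < x < 1 ->
     ex_derive y x /\ ex_derive (Derive y) x /\
     eps ^ 2 * Derive_n y 2 x - f x (y x) = 0) /\
  y 0 = 0 /\ y 1 = 0.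

Definition lambda (m eps : R) (N : nat) : R :=
  Rmin (2 * eps * ln (INR N) / sqrt m) (1 / 4).

Definition psi_left (lam tau : R) : R :=
  if Rle_dec tau (1 / 4) then 4 * lam * tau
  else 32 * (1 - 4 * lam) * (tau - 1 / 4) ^ 3 + 4 * lam * tau.

Definition psi (lam tau : R) : R :=
  if Rle_dec tau (1 / 2) then psi_left lam tau
  else 1 - psi_left lam (1 - tau).

Definition mesh (m eps : R) (N i : nat) : R :=
  psi (lambda m eps N) (INR i / INR N).

Definition step (m eps : R) (N i : nat) : R :=
  mesh m eps N (i + 1) - mesh m eps N i.

(** Vectors [(u_0, ..., u_N)] are represented by sequences [nat -> R], of which
    only the entries of index at most [N] are used. *)
Definition T (f : R -> R -> R) (m gamma t eps : R) (N : nat)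
    (u : nat -> R) (i : nat) : R :=
  let beta := sqrt gamma / eps in
  let F j := f (mesh m eps N j) (u j) in
  let hl := beta * step m eps N (i - 1) in
  let hr := beta * step m eps N i in
  if (Nat.eqb i 0 || Nat.eqb i N)%bool then - u i
  else
    gamma / ((cosh hl - 1) / sinh hl + (cosh hr - 1) / sinh hr) *
    (((1 - t) * cosh hl + t) / sinh hl * (u (i - 1)%nat - u i)
     - ((1 - t) * cosh hr + t) / sinh hr * (u i - u (i + 1)%nat)
     - ((1 - t) * F (i - 1)%nat + t * F i) / gamma * ((cosh hl - 1) / sinh hl)
     - (t * F i + (1 - t) * F (i + 1)%nat) / gamma * ((cosh hr - 1) / sinh hr)).

Definition discrete_solution (f : R -> R -> R) (m gamma t eps : R) (N : nat)
    (u : nat -> R) : Prop :=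
  forall i : nat, (i <= N)%nat -> T f m gamma t eps N u i = 0.

Definition is_global_solution (m eps : R) (N : nat) (u : nat -> R)
    (P : R -> R) : Prop :=
  forall (i : nat) (x : R), (1 <= i <= N)%nat ->
    mesh m eps N (i - 1) <= x <= mesh m eps N i ->
    P x = (u i - u (i - 1)%nat) / (mesh m eps N i - mesh m eps N (i - 1))
            * (x - mesh m eps N (i - 1)) + u (i - 1)%nat.

(* Main.v *)
(** The derivative [y'] and the residual [f (x, y) = eps^2 y''] satisfy linear
    equations with zeroth-order coefficient [f_y >= m], so barrier functions
    bound the derivatives of [y] up to the fourth order in terms of the layer
    function [exp (- sqrt m x / eps) + exp (- sqrt m (1 - x) / eps)], with no
    splitting of [y] into a regular and a layer part.  With [b = beta h], the
    coefficients of the scheme are functions of [tanh (b / 2)] alone.  Near the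
    end points the steps are equal and [O(eps ln N / N)], and the expansion to
    the fourth order gives the truncation error; in the core the layer function
    is [O(N^-2)] and consecutive steps differ by [O(N^-2)], and the truncation
    error is [O(N^-2)] whatever the ratio of the steps to [eps].  Since
    [gamma >= f_y], the scheme is monotone, so the nodal error is bounded by the
    truncation error; the interpolation error of [y] is estimated by the
    same dichotomy. *)

Require Import Defs.
From Stdlib Require Import Reals Lra Lia.
From Coquelicot Require Import Coquelicot.
Open Scope R_scope.

(** * Mean value, Taylor and comparison lemmas *)

(** The operator [T] divides by [th bl + th br], which is of order [h / eps] for steps below [eps]
    and of order 1 for coarser ones. A truncation bound is useful only if it carries this sum as a
    factor: on fine steps the factor must survive every cancellation of the expansion, while on
    coarse steps the sum is bounded below and cruder estimates suffice. Since
    [eps^2 y'' = f (x, y)], two derivatives of the residual give four of [y], which is exactly what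
    class [C^2] of [f] provides. The equation of the residual has [eps^2] times a quadratic in [y']
    as source; its layer part is the square of the layer function, which is not resonant with the
    rate [sqrt m / eps], so no factor [x / eps] appears in front of the exponential. Nothing is
    known beforehand of [y'] at 0 and 1, and [f] has a meaning only on the strip. Hence Taylor
    expansions ask only for continuity at the far end, barriers live on shrunk intervals, and the
    data are extended by projecting the abscissa onto [[0,1]]. *)

Lemma nondecreasing_of_derive (u du : R -> R) (a b : R) :
  a <= b ->
  (forall s, a <= s <= b -> continuous u s) ->
  (forall s, a < s < b -> is_derive u s (du s)) ->
  (forall s, a < s < b -> 0 <= du s) ->
  u a <= u b.
Proof.
  intros Hab Hc Hd Hp.
  (* The intermediate point of [MVT_gen] may be an end point, where nothing is known of [du]; the
     default 0 has the right sign there. *)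
  pose (df := fun s => if Rlt_dec a s then if Rlt_dec s b then du s else 0 else 0).
  destruct (MVT_gen u a b df) as [c [_ Hm]].
  - intros s. rewrite Rmin_left, Rmax_right by lra. intros Hs. unfold df.
    destruct (Rlt_dec a s); [destruct (Rlt_dec s b)|]; try lra. now apply Hd.
  - intros s. rewrite Rmin_left, Rmax_right by lra. intros Hs.
    apply continuity_pt_filterlim, Hc, Hs.
  - assert (0 <= df c).
    { unfold df. destruct (Rlt_dec a c); [destruct (Rlt_dec c b)|]; try lra.
      apply Hp; lra. }
    assert (0 <= df c * (b - a)) by (apply Rmult_le_pos; lra). lra.
Qed.

Lemma increasing_of_derive (u du : R -> R) (a b : R) :
  a < b ->
  (forall s, a <= s <= b -> continuous u s) ->
  (forall s, a < s < b -> is_derive u s (du s)) ->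
  (forall s, a < s < b -> 0 < du s) ->
  u a < u b.
Proof.
  intros Hab Hc Hd Hp.
  (* Default 1 at the end points, since a strict sign is wanted. *)
  pose (df := fun s => if Rlt_dec a s then if Rlt_dec s b then du s else 1 else 1).
  destruct (MVT_gen u a b df) as [c [_ Hm]].
  - intros s. rewrite Rmin_left, Rmax_right by lra. intros Hs. unfold df.
    destruct (Rlt_dec a s); [destruct (Rlt_dec s b)|]; try lra. now apply Hd.
  - intros s. rewrite Rmin_left, Rmax_right by lra. intros Hs.
    apply continuity_pt_filterlim, Hc, Hs.
  - assert (0 < df c).
    { unfold df. destruct (Rlt_dec a c); [destruct (Rlt_dec c b)|]; try lra.
      apply Hp; lra. }
    assert (0 < df c * (b - a)) by (apply Rmult_lt_0_compat; lra). lra.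
Qed.

Lemma is_derive_continuous (u : R -> R) (s l : R) :
  is_derive u s l -> continuous u s.
Proof. intros H. apply (@ex_derive_continuous R_AbsRing R_NormedModule). now exists l. Qed.

Lemma continuous_minus_R (u v : R -> R) (s : R) :
  continuous u s -> continuous v s -> continuous (fun x => u x - v x) s.
Proof. intros. now apply (@continuous_minus R_UniformSpace R_AbsRing R_NormedModule u v s). Qed.

Lemma continuous_plus_R (u v : R -> R) (s : R) :
  continuous u s -> continuous v s -> continuous (fun x => u x + v x) s.
Proof. intros. now apply (@continuous_plus R_UniformSpace R_AbsRing R_NormedModule u v s). Qed.

Lemma is_derive_minus_R (u v : R -> R) (s du dv : R) :
  is_derive u s du -> is_derive v s dv -> is_derive (fun x => u x - v x) s (du - dv).
Proof. intros. now apply (@is_derive_minus R_AbsRing R_NormedModule u v s). Qed.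

Lemma is_derive_plus_R (u v : R -> R) (s du dv : R) :
  is_derive u s du -> is_derive v s dv -> is_derive (fun x => u x + v x) s (du + dv).
Proof. intros. now apply (@is_derive_plus R_AbsRing R_NormedModule u v s). Qed.

Lemma is_derive_affine_comp (u : R -> R) (x c s du : R) :
  is_derive u (x + c * s) du -> is_derive (fun s => u (x + c * s)) s (c * du).
Proof.
  intros H.
  apply (@is_derive_comp R_AbsRing R_NormedModule u (fun s => x + c * s) s du c); [exact H|].
  auto_derive; [easy|ring].
Qed.

(** Both [g - u] and [g + u] are nondecreasing. A function as majorant, instead of a constant, lets
    exponentials be integrated exactly. *)
Lemma mean_value_bound (u du g dg : R -> R) (a b : R) :
  a <= b ->
  (forall s, a <= s <= b -> continuous u s) ->
  (forall s, a <= s <= b -> continuous g s) ->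
  (forall s, a < s < b -> is_derive u s (du s)) ->
  (forall s, a < s < b -> is_derive g s (dg s)) ->
  (forall s, a < s < b -> Rabs (du s) <= dg s) ->
  Rabs (u b - u a) <= g b - g a.
Proof.
  intros Hab Hcu Hcg Hu Hg Hle.
  assert (g a - u a <= g b - u b).
  { apply (nondecreasing_of_derive (fun s => g s - u s) (fun s => dg s - du s)); auto.
    - intros s Hs. now apply continuous_minus_R; auto.
    - intros s Hs. now apply is_derive_minus_R; auto.
    - intros s Hs. generalize (Hle s Hs) (Rle_abs (du s)). lra. }
  assert (g a + u a <= g b + u b).
  { apply (nondecreasing_of_derive (fun s => g s + u s) (fun s => dg s + du s)); auto.
    - intros s Hs. now apply continuous_plus_R; auto.
    - intros s Hs. now apply is_derive_plus_R; auto.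
    - intros s Hs. generalize (Hle s Hs) (Rle_abs (- du s)). rewrite Rabs_Ropp. lra. }
  apply Rabs_le. lra.
Qed.

(** One integration in a Taylor expansion: [p] is the Taylor polynomial and [g] the bound of the
    remainder. *)
Lemma integrate_bound (u du p dp g dg : R -> R) (h : R) :
  0 <= h ->
  (forall s, 0 <= s <= h -> continuous u s) ->
  (forall s, 0 < s < h -> is_derive u s (du s)) ->
  (forall s, is_derive p s (dp s)) ->
  (forall s, is_derive g s (dg s)) ->
  (forall s, 0 < s < h -> Rabs (du s - dp s) <= dg s) ->
  u 0 = p 0 -> g 0 = 0 ->
  Rabs (u h - p h) <= g h.
Proof.
  intros Hh Hc Hu Hp Hg Hle H0 Hg0.
  replace (u h - p h) with ((u h - p h) - (u 0 - p 0)) by lra.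
  replace (g h) with (g h - g 0) by lra.
  apply (mean_value_bound (fun s => u s - p s) (fun s => du s - dp s) g dg); auto.
  - intros s Hs. apply continuous_minus_R; auto.
    eapply is_derive_continuous, Hp.
  - intros s Hs. eapply is_derive_continuous, Hg.
  - intros s Hs. apply is_derive_minus_R; auto.
Qed.

Ltac derive_poly := intros; auto_derive; [easy|field].

(** The bound on [u4] is integrated four times. At [h] only continuity of [u] is asked, because a
    stencil may end at 0 or 1, where the derivatives of the solution are not controlled. *)
Lemma taylor4_right (u u1 u2 u3 u4 : R -> R) (h M : R) :
  0 <= h ->
  (forall s, 0 <= s <= h -> continuous u s) ->
  (forall s, 0 <= s < h -> is_derive u s (u1 s)) ->
  (forall s, 0 <= s < h -> is_derive u1 s (u2 s)) ->
  (forall s, 0 <= s < h -> is_derive u2 s (u3 s)) ->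
  (forall s, 0 <= s < h -> is_derive u3 s (u4 s)) ->
  (forall s, 0 < s < h -> Rabs (u4 s) <= M) ->
  Rabs (u h - (u 0 + h * u1 0 + h ^ 2 / 2 * u2 0 + h ^ 3 / 6 * u3 0)) <= M * h ^ 4 / 24.
Proof.
  intros Hh Hc H1 H2 H3 H4 HM.
  assert (E3 : forall s, 0 < s < h -> Rabs (u3 s - u3 0) <= M * s).
  { intros s Hs.
    apply (integrate_bound u3 u4 (fun _ => u3 0) (fun _ => 0) (fun s => M * s) (fun _ => M));
      try lra; try derive_poly.
    - intros r Hr. apply is_derive_continuous with (u4 r), H4; lra.
    - intros r Hr. apply H4; lra.
    - intros r Hr. rewrite Rminus_0_r. apply HM; lra. }
  assert (E2 : forall s, 0 < s < h -> Rabs (u2 s - (u2 0 + s * u3 0)) <= M * s ^ 2 / 2).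
  { intros s Hs.
    apply (integrate_bound u2 u3 (fun s => u2 0 + s * u3 0) (fun _ => u3 0)
             (fun s => M * s ^ 2 / 2) (fun s => M * s)); try lra; try derive_poly.
    - intros r Hr. apply is_derive_continuous with (u3 r), H3; lra.
    - intros r Hr. apply H3; lra.
    - intros r Hr. apply E3; lra. }
  assert (E1 : forall s, 0 < s < h ->
            Rabs (u1 s - (u1 0 + s * u2 0 + s ^ 2 / 2 * u3 0)) <= M * s ^ 3 / 6).
  { intros s Hs.
    apply (integrate_bound u1 u2 (fun s => u1 0 + s * u2 0 + s ^ 2 / 2 * u3 0)
             (fun s => u2 0 + s * u3 0)
             (fun s => M * s ^ 3 / 6) (fun s => M * s ^ 2 / 2)); try lra; try derive_poly.
    - intros r Hr. apply is_derive_continuous with (u2 r), H2; lra.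
    - intros r Hr. apply H2; lra.
    - intros r Hr. apply E2; lra. }
  apply (integrate_bound u u1 (fun s => u 0 + s * u1 0 + s ^ 2 / 2 * u2 0 + s ^ 3 / 6 * u3 0)
           (fun s => u1 0 + s * u2 0 + s ^ 2 / 2 * u3 0)
           (fun s => M * s ^ 4 / 24) (fun s => M * s ^ 3 / 6)); try lra; try derive_poly; auto.
  intros; apply H1; lra.
Qed.

Lemma taylor2_right (u u1 u2 : R -> R) (h M : R) :
  0 <= h ->
  (forall s, 0 <= s <= h -> continuous u s) ->
  (forall s, 0 <= s < h -> is_derive u s (u1 s)) ->
  (forall s, 0 <= s < h -> is_derive u1 s (u2 s)) ->
  (forall s, 0 < s < h -> Rabs (u2 s) <= M) ->
  Rabs (u h - (u 0 + h * u1 0)) <= M * h ^ 2 / 2.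
Proof.
  intros Hh Hc H1 H2 HM.
  assert (E1 : forall s, 0 < s < h -> Rabs (u1 s - u1 0) <= M * s).
  { intros s Hs.
    apply (integrate_bound u1 u2 (fun _ => u1 0) (fun _ => 0) (fun s => M * s) (fun _ => M));
      try lra; try derive_poly.
    - intros r Hr. apply is_derive_continuous with (u2 r), H2; lra.
    - intros r Hr. apply H2; lra.
    - intros r Hr. rewrite Rminus_0_r. apply HM; lra. }
  apply (integrate_bound u u1 (fun s => u 0 + s * u1 0) (fun s => u1 0)
           (fun s => M * s ^ 2 / 2) (fun s => M * s)); try lra; try derive_poly; auto.
  intros; apply H1; lra.
Qed.

Lemma continuous_affine_comp (u : R -> R) (x c s : R) :
  continuous u (x + c * s) -> continuous (fun s => u (x + c * s)) s.
Proof.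
  intros H. apply (continuous_comp (fun s => x + c * s) u); [|exact H].
  apply is_derive_continuous with c. auto_derive; [easy|ring].
Qed.

(* [sg] is [1] or [-1]: both directions of the expansion at once. *)
Lemma taylor4 (u u1 u2 u3 u4 : R -> R) (a b x h sg M : R) :
  (forall s, continuous u s) ->
  (forall s, a < s < b -> is_derive u s (u1 s)) ->
  (forall s, a < s < b -> is_derive u1 s (u2 s)) ->
  (forall s, a < s < b -> is_derive u2 s (u3 s)) ->
  (forall s, a < s < b -> is_derive u3 s (u4 s)) ->
  sg = 1 \/ sg = -1 ->
  a < x < b -> 0 <= h -> a <= x + sg * h <= b ->
  (forall s, 0 < s < h -> Rabs (u4 (x + sg * s)) <= M) ->
  Rabs (u (x + sg * h) -
        (u x + sg * h * u1 x + h ^ 2 / 2 * u2 x + sg * h ^ 3 / 6 * u3 x)) <= M * h ^ 4 / 24.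
Proof.
  intros Hc H1 H2 H3 H4 Hsg Hx Hh Hxh HM.
  assert (Hin : forall s, 0 <= s < h -> a < x + sg * s < b) by (intros; destruct Hsg; subst; lra).
  assert (Hsq : sg * sg = 1) by (destruct Hsg; subst; lra).
  generalize (taylor4_right (fun s => u (x + sg * s)) (fun s => sg * u1 (x + sg * s))
    (fun s => sg * (sg * u2 (x + sg * s))) (fun s => sg * (sg * (sg * u3 (x + sg * s))))
    (fun s => sg * (sg * (sg * (sg * u4 (x + sg * s))))) h M Hh).
  cbv beta. rewrite Rmult_0_r, Rplus_0_r. intros Ht.
  match goal with |- Rabs ?e <= _ =>
    match type of Ht with context [Rabs (u _ - ?p)] =>
      replace e with (u (x + sg * h) - p) by (destruct Hsg; subst; field) end end.
  apply Ht.
  - intros s Hs. now apply continuous_affine_comp.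
  - intros s Hs. now apply is_derive_affine_comp, H1, Hin.
  - intros s Hs. apply is_derive_scal. now apply is_derive_affine_comp, H2, Hin.
  - intros s Hs. do 2 apply is_derive_scal. now apply is_derive_affine_comp, H3, Hin.
  - intros s Hs. do 3 apply is_derive_scal. now apply is_derive_affine_comp, H4, Hin.
  - intros s Hs. rewrite <- !Rmult_assoc, Hsq, Rmult_1_l, Hsq, Rmult_1_l. now apply HM.
Qed.

Lemma taylor2 (u u1 u2 : R -> R) (a b x h sg M : R) :
  (forall s, continuous u s) ->
  (forall s, a < s < b -> is_derive u s (u1 s)) ->
  (forall s, a < s < b -> is_derive u1 s (u2 s)) ->
  sg = 1 \/ sg = -1 ->
  a < x < b -> 0 <= h -> a <= x + sg * h <= b ->
  (forall s, 0 < s < h -> Rabs (u2 (x + sg * s)) <= M) ->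
  Rabs (u (x + sg * h) - (u x + sg * h * u1 x)) <= M * h ^ 2 / 2.
Proof.
  intros Hc H1 H2 Hsg Hx Hh Hxh HM.
  assert (Hin : forall s, 0 <= s < h -> a < x + sg * s < b) by (intros; destruct Hsg; subst; lra).
  assert (Hsq : sg * sg = 1) by (destruct Hsg; subst; lra).
  generalize (taylor2_right (fun s => u (x + sg * s)) (fun s => sg * u1 (x + sg * s))
    (fun s => sg * (sg * u2 (x + sg * s))) h M Hh).
  cbv beta. rewrite Rmult_0_r, Rplus_0_r. intros Ht.
  match goal with |- Rabs ?e <= _ =>
    match type of Ht with context [Rabs (u _ - ?p)] =>
      replace e with (u (x + sg * h) - p) by (destruct Hsg; subst; field) end end.
  apply Ht.
  - intros s Hs. now apply continuous_affine_comp.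
  - intros s Hs. now apply is_derive_affine_comp, H1, Hin.
  - intros s Hs. apply is_derive_scal. now apply is_derive_affine_comp, H2, Hin.
  - intros s Hs. rewrite <- !Rmult_assoc, Hsq, Rmult_1_l. now apply HM.
Qed.

(** * Maximum principle and barriers *)

(** At a positive maximum [c], necessarily interior, [w1 c = 0] and [w2 c > 0]. The difference
    quotient of [w1] at [c] is then positive nearby, so [w] increases just to the right of [c]. Only
    the value of [w2] at [c] enters, not its continuity. *)
Lemma maximum_principle (w w1 w2 : R -> R) (a b : R) :
  (forall s, a <= s <= b -> continuous w s) ->
  (forall s, a < s < b -> is_derive w s (w1 s)) ->
  (forall s, a < s < b -> is_derive w1 s (w2 s)) ->
  (forall s, a < s < b -> 0 < w s -> 0 < w2 s) ->
  w a <= 0 -> w b <= 0 ->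
  forall x, a <= x <= b -> w x <= 0.
Proof.
  intros Hc H1 H2 Hpos Ha Hb x Hx.
  destruct (continuity_ab_maj w a b) as [c [Hmax Hc']].
  - lra.
  - intros s Hs. apply continuity_pt_filterlim, Hc, Hs.
  - destruct (Rle_lt_dec (w c) 0) as [Hle|Hlt].
    { generalize (Hmax x Hx). lra. }
    exfalso.
    assert (Hcab : a < c < b).
    { split; apply Rnot_le_lt; intros Hn.
      - replace c with a in Hlt by lra. lra.
      - replace c with b in Hlt by lra. lra. }
    assert (Hw1 : w1 c = 0).
    { assert (pr : derivable_pt w c).
      { apply ex_derive_Reals_0. exists (w1 c). now apply H1. }
      rewrite <- (is_derive_unique _ _ _ (H1 c Hcab)), <- (Derive_Reals w c pr).
      apply (deriv_maximum w a b c pr); try lra.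
      intros; apply Hmax; lra. }
    generalize (H2 c Hcab) (Hpos c Hcab Hlt). intros Hd Hp.
    apply is_derive_Reals in Hd.
    destruct (Hd (w2 c / 2)) as [d Hdd]; [lra|].
    pose (e := Rmin d (b - c)).
    assert (He : 0 < e <= d /\ e <= b - c).
    { unfold e. generalize (cond_pos d) (Rmin_l d (b - c)) (Rmin_r d (b - c)).
      intros. repeat split; try lra. now apply Rmin_glb_lt; lra. }
    assert (Hlt2 : w c < w (c + e / 2)).
    { apply (increasing_of_derive w w1); try lra.
      - intros s Hs. apply Hc; lra.
      - intros s Hs. apply H1; lra.
      - intros s Hs. generalize (Hdd (s - c)).
        replace (c + (s - c)) with s by ring. rewrite Hw1, Rminus_0_r.
        intros Hq. assert (Hq' : Rabs (w1 s / (s - c) - w2 c) < w2 c / 2).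
        { apply Hq; [lra|]. rewrite Rabs_pos_eq; lra. }
        apply Rabs_def2 in Hq'.
        replace (w1 s) with (w1 s / (s - c) * (s - c)) by (field; lra).
        apply Rmult_lt_0_compat; lra. }
    generalize (Hmax (c + e / 2)). lra.
Qed.

(** Where [z > B >= 0], one has [e * z2 = q z + r > m B + r >= e * B2], so [z - B] satisfies the
    hypothesis of the maximum principle. *)
Lemma barrier_upper (z z1 z2 B B1 B2 q r : R -> R) (e m a b : R) :
  0 < e -> 0 < m ->
  (forall s, a <= s <= b -> continuous z s) ->
  (forall s, a < s < b -> is_derive z s (z1 s)) ->
  (forall s, a < s < b -> is_derive z1 s (z2 s)) ->
  (forall s, a <= s <= b -> is_derive B s (B1 s)) ->
  (forall s, a < s < b -> is_derive B1 s (B2 s)) ->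
  (forall s, a < s < b -> e * z2 s = q s * z s + r s) ->
  (forall s, a < s < b -> m <= q s) ->
  (forall s, a < s < b -> 0 <= B s) ->
  (forall s, a < s < b -> - r s <= m * B s - e * B2 s) ->
  z a <= B a -> z b <= B b ->
  forall x, a <= x <= b -> z x <= B x.
Proof.
  intros He Hm Hzc H1 H2 HB1 HB2 Heq Hq HBp Hr Ha Hb x Hx.
  assert (z x - B x <= 0); [|lra].
  apply (maximum_principle (fun s => z s - B s) (fun s => z1 s - B1 s)
           (fun s => z2 s - B2 s) a b); try lra.
  - intros s Hs. apply continuous_minus_R; auto.
    eapply is_derive_continuous, HB1, Hs.
  - intros s Hs. apply is_derive_minus_R; [now apply H1|apply HB1; lra].
  - intros s Hs. apply is_derive_minus_R; auto.
  - intros s Hs Hz.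
    assert (m * B s < q s * z s).
    { generalize (HBp s Hs) (Hq s Hs). intros.
      apply Rlt_le_trans with (m * z s); [apply Rmult_lt_compat_l; lra|].
      apply Rmult_le_compat_r; lra. }
    apply Rmult_lt_reg_l with e; [lra|].
    generalize (Heq s Hs) (Hr s Hs). lra.
Qed.

Lemma barrier (z z1 z2 B B1 B2 q r : R -> R) (e m a b : R) :
  0 < e -> 0 < m ->
  (forall s, a <= s <= b -> continuous z s) ->
  (forall s, a < s < b -> is_derive z s (z1 s)) ->
  (forall s, a < s < b -> is_derive z1 s (z2 s)) ->
  (forall s, a <= s <= b -> is_derive B s (B1 s)) ->
  (forall s, a < s < b -> is_derive B1 s (B2 s)) ->
  (forall s, a < s < b -> e * z2 s = q s * z s + r s) ->
  (forall s, a < s < b -> m <= q s) ->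
  (forall s, a < s < b -> 0 <= B s) ->
  (forall s, a < s < b -> Rabs (r s) <= m * B s - e * B2 s) ->
  Rabs (z a) <= B a -> Rabs (z b) <= B b ->
  forall x, a <= x <= b -> Rabs (z x) <= B x.
Proof.
  intros He Hm Hzc H1 H2 HB1 HB2 Heq Hq HBp Hr Ha Hb x Hx.
  apply Rabs_le_between in Ha. apply Rabs_le_between in Hb.
  apply Rabs_le. split.
  - apply Ropp_le_cancel. rewrite Ropp_involutive.
    apply (barrier_upper (fun s => - z s) (fun s => - z1 s) (fun s => - z2 s)
             B B1 B2 q (fun s => - r s) e m a b); auto; try lra.
    + intros s Hs. apply (@continuous_opp R_UniformSpace R_AbsRing R_NormedModule). auto.
    + intros s Hs. apply (@is_derive_opp R_AbsRing R_NormedModule). auto.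
    + intros s Hs. apply (@is_derive_opp R_AbsRing R_NormedModule). auto.
    + intros s Hs. generalize (Heq s Hs). lra.
    + intros s Hs. generalize (Hr s Hs) (Rle_abs (r s)). lra.
  - apply (barrier_upper z z1 z2 B B1 B2 q r e m a b); auto; try lra.
    intros s Hs. generalize (Hr s Hs) (Rle_abs (- r s)). rewrite Rabs_Ropp. lra.
Qed.

(** * The function tanh (b / 2) *)

(* [tanh (b / 2)] *)
Definition th (b : R) : R := 1 - 2 / (exp b + 1).

Lemma exp_gt_1 (b : R) : 0 < b -> 1 < exp b.
Proof. intros H. rewrite <- exp_0. now apply exp_increasing. Qed.

Lemma th_cosh_sinh (b : R) : 0 < b -> (cosh b - 1) / sinh b = th b.
Proof.
  intros Hb. generalize (exp_gt_1 b Hb). intros H1.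
  unfold th, cosh, sinh. rewrite exp_Ropp. field. nra.
Qed.

(* [/ sinh b = (coth (b/2) - tanh (b/2)) / 2] *)
Definition diffusion_weight (t b : R) : R := (th b + / th b) / 2 - t * th b.

(** The quotient is [coth b - t tanh (b / 2)], and [coth b] is half the sum of [tanh (b / 2)] and
    its inverse. *)
Lemma diffusion_weight_cosh_sinh (t b : R) : 0 < b ->
  ((1 - t) * cosh b + t) / sinh b = diffusion_weight t b.
Proof.
  intros Hb. generalize (exp_gt_1 b Hb). intros H1.
  unfold diffusion_weight, th, cosh, sinh. rewrite exp_Ropp. field.
  repeat split; nra.
Qed.

Lemma is_derive_th (b : R) : is_derive th b ((1 - th b ^ 2) / 2).
Proof.
  unfold th. generalize (exp_pos b). intros H.
  auto_derive; [lra|]. field. lra.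
Qed.

Lemma th_0 : th 0 = 0.
Proof. unfold th. rewrite exp_0. field. Qed.

Lemma continuous_th (b : R) : continuous th b.
Proof. eapply is_derive_continuous, is_derive_th. Qed.

Lemma th_bounds (b : R) : 0 < b -> 0 < th b < 1.
Proof.
  intros Hb. generalize (exp_gt_1 b Hb). intros H1. unfold th.
  assert (0 < 2 / (exp b + 1)) by (apply Rdiv_lt_0_compat; lra).
  assert (2 / (exp b + 1) < 1); [|lra].
  apply Rmult_lt_reg_r with (exp b + 1); [lra|]. field_simplify; lra.
Qed.

Lemma th_lower (b : R) : 0 < b -> b / (2 + b) <= th b.
Proof.
  intros Hb. generalize (exp_ineq1_le b). intros H1. unfold th.
  assert (2 / (exp b + 1) <= 2 / (2 + b)).
  { apply Rmult_le_compat_l; [lra|]. apply Rinv_le_contravar; lra. }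
  replace (b / (2 + b)) with (1 - 2 / (2 + b)) by (field; lra). lra.
Qed.

Lemma th_upper (b : R) : 0 < b -> th b <= b / 2.
Proof.
  intros Hb.
  assert (H : 0 / 2 - th 0 <= b / 2 - th b).
  { apply (nondecreasing_of_derive (fun s => s / 2 - th s) (fun s => th s ^ 2 / 2)).
    - lra.
    - intros s _. apply continuous_minus_R; [|apply continuous_th].
      apply is_derive_continuous with (/ 2). auto_derive; [easy|field].
    - intros s _. replace (th s ^ 2 / 2) with (/ 2 - (1 - th s ^ 2) / 2) by field.
      apply is_derive_minus_R; [|apply is_derive_th]. auto_derive; [easy|field].
    - intros s _. generalize (pow2_ge_0 (th s)). lra. }
  rewrite th_0 in H. lra.
Qed.

(** The difference of the two sides of the upper bound has derivative [s ^ 2 / 4 - th s ^ 2],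
    nonnegative by [th_upper]. The cubic order is the source of the second-order consistency of the
    scheme. *)
Lemma th_cubic (b : R) : 0 < b -> 0 <= b - 2 * th b <= b ^ 3 / 12.
Proof.
  intros Hb. split; [generalize (th_upper b Hb); lra|].
  assert (H : 0 ^ 3 / 12 - (0 - 2 * th 0) <= b ^ 3 / 12 - (b - 2 * th b)).
  { apply (nondecreasing_of_derive (fun s => s ^ 3 / 12 - (s - 2 * th s))
      (fun s => s ^ 2 / 4 - (1 - 2 * ((1 - th s ^ 2) / 2)))).
    - lra.
    - intros s _. apply is_derive_continuous with (s ^ 2 / 4 - (1 - 2 * ((1 - th s ^ 2) / 2))).
      apply is_derive_minus_R; [auto_derive; [easy|field]|].
      apply is_derive_minus_R; [auto_derive; [easy|ring]|].
      apply is_derive_scal, is_derive_th.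
    - intros s _. apply is_derive_minus_R; [auto_derive; [easy|field]|].
      apply is_derive_minus_R; [auto_derive; [easy|ring]|].
      apply is_derive_scal, is_derive_th.
    - intros s Hs. assert (Hs' : 0 < s) by lra.
      generalize (th_upper s Hs') (th_bounds s Hs'). intros. nra. }
  rewrite th_0 in H. lra.
Qed.

Lemma th_lipschitz (b c : R) : 0 < b -> 0 < c -> Rabs (th b - th c) <= Rabs (b - c) / 2.
Proof.
  assert (H : forall b c, 0 < b -> b <= c -> Rabs (th c - th b) <= c / 2 - b / 2).
  { intros b' c' Hb Hbc.
    apply (mean_value_bound th (fun s => (1 - th s ^ 2) / 2) (fun s => s / 2) (fun _ => / 2)); auto.
    - intros; apply continuous_th.
    - intros s _. apply is_derive_continuous with (/ 2). auto_derive; [easy|field].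
    - intros; apply is_derive_th.
    - intros s _. auto_derive; [easy|field].
    - intros s Hs. generalize (th_bounds s). intros Ht.
      rewrite Rabs_pos_eq; nra. }
  intros Hb Hc. destruct (Rle_lt_dec b c) as [Hbc|Hbc].
  - rewrite (Rabs_minus_sym (th b)), (Rabs_minus_sym b), (Rabs_pos_eq (c - b)) by lra.
    generalize (H b c Hb Hbc). lra.
  - rewrite (Rabs_pos_eq (b - c)) by lra. generalize (H c b Hc). lra.
Qed.

(** The derivative of [th] is at most [1 - th s <= 2 / (2 + s) <= 2 / l]. For steps much larger than
    [eps] this decay compensates the factor [1 / eps] in the difference of two values of
    [beta h]. *)
Lemma th_lipschitz_decay (l b c : R) : 0 < l -> l <= b -> l <= c ->
  Rabs (th b - th c) <= 2 * Rabs (b - c) / l.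
Proof.
  intros Hl.
  assert (H : forall b c, l <= b -> b <= c -> Rabs (th c - th b) <= 2 / l * c - 2 / l * b).
  { intros b' c' Hb Hbc.
    apply (mean_value_bound th (fun s => (1 - th s ^ 2) / 2) (fun s => 2 / l * s)
      (fun _ => 2 / l)); auto.
    - intros; apply continuous_th.
    - intros s _. apply is_derive_continuous with (2 / l). auto_derive; [easy|ring].
    - intros; apply is_derive_th.
    - intros s _. auto_derive; [easy|ring].
    - intros s Hs. generalize (th_bounds s ltac:(lra)) (th_lower s ltac:(lra)). intros Ht Hlow.
      rewrite Rabs_pos_eq by nra.
      apply Rle_trans with (2 / s).
      + apply Rle_trans with (1 - th s); [nra|].
        apply Rle_trans with (2 / (2 + s)).
        * replace (2 / (2 + s)) with (1 - s / (2 + s)) by (field; lra). lra.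
        * apply Rmult_le_compat_l; [lra|]. apply Rinv_le_contravar; lra.
      + apply Rmult_le_compat_l; [lra|]. apply Rinv_le_contravar; lra. }
  intros Hb Hc. destruct (Rle_lt_dec b c) as [Hbc|Hbc].
  - rewrite (Rabs_minus_sym (th b)), (Rabs_minus_sym b), (Rabs_pos_eq (c - b)) by lra.
    generalize (H b c Hb Hbc). unfold Rdiv. lra.
  - rewrite (Rabs_pos_eq (b - c)) by lra. generalize (H c b Hc). unfold Rdiv. lra.
Qed.

(* [b / th b] is even and smooth, so its derivative vanishes at [0]. *)
Lemma ratio_th_lipschitz (B b c : R) : 0 < b <= B -> 0 < c <= B ->
  Rabs (b / th b - c / th c) <= ((2 + B) ^ 2 + 12) / 24 * Rmax b c * Rabs (b - c).
Proof.
  intros HbB HcB.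
  pose (K := ((2 + B) ^ 2 + 12) / 24).
  assert (HK : 0 <= K) by (unfold K; generalize (pow2_ge_0 (2 + B)); lra).
  assert (Hd : forall s, 0 < s -> is_derive (fun s => s / th s) s
            ((1 * th s - s * ((1 - th s ^ 2) / 2)) / (th s) ^ 2)).
  { intros s Hs. generalize (th_bounds s Hs). intros Ht.
    apply (is_derive_div (fun s => s) th s 1 ((1 - th s ^ 2) / 2)).
    - auto_derive; [easy|ring].
    - apply is_derive_th.
    - lra. }
  assert (H : forall b c, 0 < b -> b <= c -> c <= B ->
            Rabs (c / th c - b / th b) <= K * c * c - K * c * b).
  { intros b' c' Hb Hbc HcB'.
    apply (mean_value_bound (fun s => s / th s)
      (fun s => (1 * th s - s * ((1 - th s ^ 2) / 2)) / (th s) ^ 2)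
      (fun s => K * c' * s) (fun _ => K * c')); auto.
    - intros s Hs. eapply is_derive_continuous, Hd. lra.
    - intros s _. apply is_derive_continuous with (K * c'). auto_derive; [easy|ring].
    - intros s Hs. apply Hd. lra.
    - intros s _. auto_derive; [easy|ring].
    - intros s Hs. assert (Hs' : 0 < s) by lra.
      generalize (th_bounds s Hs') (th_cubic s Hs') (th_lower s Hs'). intros Ht Hcub Hlow.
      set (T := th s) in *.
      assert (HsT : s <= (2 + B) * T).
      { apply Rmult_le_compat_r with (r := 2 + s) in Hlow; [|lra].
        replace (s / (2 + s) * (2 + s)) with s in Hlow by (field; lra).
        apply Rle_trans with (1 := Hlow). nra. }
      (* Both terms are of order [s]: [th_cubic] and [s <= (2 + B) * T] bound the second by
         [(2 + B) ^ 2 * s / 24], and [1 / 2 + (2 + B) ^ 2 / 24] is [K]. *)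
      replace ((1 * T - s * ((1 - T ^ 2) / 2)) / T ^ 2)
        with (s / 2 - (s - 2 * T) / 2 / T ^ 2) by (field; lra).
      assert (HT2 : 0 < T ^ 2) by nra.
      assert (0 <= (s - 2 * T) / 2 / T ^ 2 <= (2 + B) ^ 2 * s / 24).
      { split.
        - apply Rdiv_le_0_compat; lra.
        - apply Rmult_le_reg_r with (T ^ 2); [lra|].
          replace ((s - 2 * T) / 2 / T ^ 2 * T ^ 2) with ((s - 2 * T) / 2) by (field; lra).
          apply Rle_trans with (s * (s ^ 2) / 24); [lra|].
          assert (s ^ 2 <= (2 + B) ^ 2 * T ^ 2).
          { rewrite <- Rpow_mult_distr. apply pow_incr. lra. }
          assert (s * s ^ 2 <= s * ((2 + B) ^ 2 * T ^ 2)) by (apply Rmult_le_compat_l; lra).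
          lra. }
      apply Rle_trans with (K * s).
      + unfold K. apply Rabs_le.
        assert (0 <= (2 + B) ^ 2 * s) by (generalize (pow2_ge_0 (2 + B)); intros; apply Rmult_le_pos; lra).
        lra.
      + apply Rmult_le_compat_l; lra. }
  fold K. destruct (Rle_lt_dec b c) as [Hbc|Hbc].
  - rewrite Rmax_right by lra.
    rewrite (Rabs_minus_sym (b / _)), (Rabs_minus_sym b), (Rabs_pos_eq (c - b)) by lra.
    generalize (H b c). lra.
  - rewrite Rmax_left by lra.
    rewrite (Rabs_pos_eq (b - c)) by lra. generalize (H c b). lra.
Qed.

(** * Functions of class C^2 on the strip *)

(** Projection onto [[0,1]], written with absolute values so that its continuity reduces to that of
    [Rabs]. Composition with it turns data on the strip into functions continuous everywhere without
    changing them on the strip. *)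
Definition clamp (x : R) : R := (Rabs x - Rabs (x - 1) + 1) / 2.

Lemma clamp_id (x : R) : 0 <= x <= 1 -> clamp x = x.
Proof. intros H. unfold clamp. rewrite (Rabs_pos_eq x), (Rabs_left1 (x - 1)); lra. Qed.

Lemma clamp_in (x : R) : 0 <= clamp x <= 1.
Proof. unfold clamp, Rabs. destruct (Rcase_abs x), (Rcase_abs (x - 1)); lra. Qed.

Lemma continuous_clamp (x : R) : continuous clamp x.
Proof.
  unfold clamp, Rdiv.
  apply (@continuous_mult R_UniformSpace R_AbsRing); [|apply continuous_const].
  apply continuous_plus_R; [|apply continuous_const].
  apply continuous_minus_R; [apply continuous_Rabs|].
  apply (continuous_comp (fun x => x - 1) Rabs); [|apply continuous_Rabs].
  apply continuous_minus_R; [apply continuous_id|apply continuous_const].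
Qed.

Lemma locally_open_unit (x : R) : 0 < x < 1 -> locally x (fun s => 0 < s < 1).
Proof.
  intros H. apply (open_and (fun s => 0 < s) (fun s => s < 1)); auto using open_gt, open_lt.
Qed.

Lemma locally_clamp_id (x : R) : 0 < x < 1 -> locally x (fun s => s = clamp s).
Proof.
  intros H. generalize (locally_open_unit x H). apply filter_imp.
  intros s Hs. symmetry. apply clamp_id. lra.
Qed.

Lemma filterlim_within {T U : Type} (h : T -> U) (F : (T -> Prop) -> Prop)
    (G : (U -> Prop) -> Prop) (D : U -> Prop) (FF : Filter F) :
  filterlim h F G -> (forall s, D (h s)) -> filterlim h F (within D G).
Proof.
  intros H HD P HP. unfold filtermap. generalize (H _ HP). unfold filtermap.
  apply filter_imp. intros s Hs. now apply Hs.
Qed.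

Lemma continuous_clamp_on (u : R -> R) (x : R) :
  continuous_on unit_interval u -> continuous (fun s => u (clamp s)) x.
Proof.
  intros H.
  apply (filterlim_comp _ _ _ clamp u (locally x) (within unit_interval (locally (clamp x)))).
  - apply filterlim_within; [apply locally_filter|apply continuous_clamp|apply clamp_in].
  - apply H, clamp_in.
Qed.

Lemma continuous_clamp_strip (g : R -> R -> R) (z : R * R) :
  continuous_strip g -> continuous (fun z => g (clamp (fst z)) (snd z)) z.
Proof.
  intros H.
  apply (filterlim_comp _ _ _ (fun z => (clamp (fst z), snd z))
           (fun z => g (fst z) (snd z)) (locally z)
           (within (fun z => unit_interval (fst z)) (locally (clamp (fst z), snd z)))).
  - apply filterlim_within; [apply locally_filter| |intros; apply clamp_in].
    apply (continuous_comp_2 (fun z => clamp (fst z)) snd (fun a b => (a, b))).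
    + apply (continuous_comp fst clamp); [apply continuous_fst|apply continuous_clamp].
    + apply continuous_snd.
    + apply continuous_ext with (fun z : R * R => z); [now intros []|apply continuous_id].
  - apply (H (clamp (fst z), snd z)), clamp_in.
Qed.

(** The trace on [[0,1]] of the neighbourhoods of an interior point generates the same filter as the
    neighbourhoods, so the relative derivative is an ordinary one. *)
Lemma is_partial_x_interior (g gx : R -> R -> R) (x y : R) :
  is_partial_x g gx -> 0 < x < 1 -> is_derive (fun s => g s y) x (gx x y).
Proof.
  intros H Hx. destruct (H x y) as [Hl Hd]; [unfold unit_interval; lra|].
  split; [exact Hl|].
  intros z Hz eps.
  assert (Hz' : is_filter_lim (within unit_interval (locally x)) z).
  { intros P HP. apply Hz in HP. unfold within. revert HP. now apply filter_imp. }
  assert (Hq := Hd z Hz' eps). unfold within in Hq.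
  generalize (@filter_and _ (locally x) _ _ _ Hq (locally_open_unit x Hx)).
  apply filter_imp. intros s [Hs Hs']. apply Hs. unfold unit_interval. lra.
Qed.

(** The properties that survive clamping. The [x]-derivative is asked only for [0 < x < 1], because
    a clamped function is constant in [x] outside and may have a corner at 0 and 1. *)
Record C1_strip (g gx gy : R -> R -> R) : Prop := {
  C1_cont : forall z : R * R, continuous (fun z => g (fst z) (snd z)) z;
  C1_cont_x : forall z : R * R, continuous (fun z => gx (fst z) (snd z)) z;
  C1_cont_y : forall z : R * R, continuous (fun z => gy (fst z) (snd z)) z;
  C1_derive_x : forall x y, 0 < x < 1 -> is_derive (fun s => g s y) x (gx x y);
  C1_derive_y : forall x y, is_derive (fun s => g x s) y (gy x y) }.

Lemma C1_strip_clamp (g gx gy : R -> R -> R) :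
  continuous_strip g -> continuous_strip gx -> continuous_strip gy ->
  is_partial_x g gx -> is_partial_y g gy ->
  C1_strip (fun x => g (clamp x)) (fun x => gx (clamp x)) (fun x => gy (clamp x)).
Proof.
  intros Hg Hgx Hgy Hx Hy. split; try (intros; now apply continuous_clamp_strip).
  - intros x y H. rewrite (clamp_id x) by lra.
    apply is_derive_ext_loc with (fun s => g s y); [|now apply is_partial_x_interior].
    generalize (locally_clamp_id x H). apply filter_imp. now intros s <-.
  - intros x y. apply Hy, clamp_in.
Qed.

Lemma Ck_strip_continuous (k : nat) (g : R -> R -> R) : Ck_strip k g -> continuous_strip g.
Proof. destruct k; now intros [H _]. Qed.

Record C2_strip (f fx fy fxx fxy fyx fyy : R -> R -> R) : Prop := {
  C2_f : C1_strip f fx fy;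
  C2_fx : C1_strip fx fxx fxy;
  C2_fy : C1_strip fy fyx fyy }.

Lemma C2_strip_clamp (k : nat) (f : R -> R -> R) :
  (2 <= k)%nat -> Ck_strip k f ->
  exists fx fy fxx fxy fyx fyy,
    C2_strip (fun x => f (clamp x)) fx fy fxx fxy fyx fyy.
Proof.
  intros Hk Hf. destruct k as [|[|k]]; try lia.
  destruct Hf as [Hf [fx [fy [Hx [Hy [[Hfx [fxx [fxy [Hxx [Hxy [Kxx Kxy]]]]]]
    [Hfy [fyx [fyy [Hyx [Hyy [Kyx Kyy]]]]]]]]]]]].
  apply Ck_strip_continuous in Kxx, Kxy, Kyx, Kyy.
  exists (fun x => fx (clamp x)), (fun x => fy (clamp x)), (fun x => fxx (clamp x)),
    (fun x => fxy (clamp x)), (fun x => fyx (clamp x)), (fun x => fyy (clamp x)).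
  split; now apply C1_strip_clamp.
Qed.

(** Total differentiability of [g] comes from an [x]-derivative that exists nearby and is
    continuous, together with the [y]-derivative at the point. *)
Lemma C1_chain (g gx gy : R -> R -> R) (u : R -> R) (x du : R) :
  C1_strip g gx gy -> 0 < x < 1 -> is_derive u x du ->
  is_derive (fun s => g s (u s)) x (gx x (u x) + gy x (u x) * du).
Proof.
  intros [Hc Hcx Hcy Hx Hy] H Hu.
  assert (Hg : filterdiff (fun z : R * R => g (fst z) (snd z)) (locally (x, u x))
    (fun z : R * R => plus (scal (fst z) (gx x (u x))) (scal (snd z) (gy x (u x))))).
  { apply is_derive_filterdiff.
    (* This radius keeps the abscissa in the open interval, where the [x]-derivative exists. *)
    - exists (mkposreal (Rmin x (1 - x)) ltac:(apply Rmin_glb_lt; lra)).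
      intros [a b] [Ha _]. simpl in *. apply Hx.
      unfold ball in Ha; simpl in Ha; unfold AbsRing_ball, abs, minus, plus, opp in Ha; simpl in Ha.
      apply Rabs_def2 in Ha. generalize (Rmin_l x (1 - x)) (Rmin_r x (1 - x)). lra.
    - apply Hy.
    - apply Hcx. }
  unfold is_derive.
  generalize (filterdiff_comp'_2 (fun s : R => s) u g x (fun s => s) (fun h => scal h du)
    (fun a b => plus (scal a (gx x (u x))) (scal b (gy x (u x))))
    (filterdiff_id _) Hu Hg).
  intros Hf. eapply filterdiff_ext_lin; [exact Hf|].
  intros h. simpl. unfold plus, scal; simpl; unfold mult; simpl. ring.
Qed.

Lemma C1_comp_continuous (g : R -> R -> R) (u : R -> R) (x : R) :
  (forall z : R * R, continuous (fun z => g (fst z) (snd z)) z) ->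
  continuous u x -> continuous (fun s => g s (u s)) x.
Proof.
  intros Hg Hu. apply (continuous_comp_2 (fun s => s) u g); auto.
  apply continuous_id.
Qed.

(** The segment from the origin to [(x, y)] stays in the rectangle. It is cut into [n + 1] equal
    pieces shorter in each coordinate than the modulus [d] of uniform continuity for the tolerance
    1, so [g] changes by less than 1 on each piece. *)
Lemma bounded_on_rectangle (g : R -> R -> R) (M : R) :
  0 <= M ->
  (forall z : R * R, continuous (fun z => g (fst z) (snd z)) z) ->
  exists K, 1 <= K /\ forall x y, 0 <= x <= 1 -> Rabs y <= M -> Rabs (g x y) <= K.
Proof.
  intros HM Hg.
  destruct (uniform_continuity_2d g 0 1 (- M) M) with (eps := mkposreal 1 Rlt_0_1) as [d Hd].
  { intros x y _ _. apply continuity_2d_pt_filterlim, (Hg (x, y)). }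
  destruct (nfloor_ex ((1 + M) / d)) as [n [_ Hn]].
  { apply Rdiv_le_0_compat; [lra|apply cond_pos]. }
  exists (1 + (Rabs (g 0 0) + (INR n + 1))). split.
  { generalize (Rabs_pos (g 0 0)) (pos_INR n). lra. }
  intros x y Hx Hy.
  pose (p := INR n + 1). assert (Hp : 0 < p) by (unfold p; generalize (pos_INR n); lra).
  assert (Hpd : (1 + M) / p < d).
  { apply Rmult_lt_reg_r with p; [lra|]. unfold Rdiv. rewrite Rmult_assoc, Rinv_l by lra.
    fold p in Hn. apply Rmult_lt_compat_r with (r := d) in Hn; [|apply cond_pos].
    replace ((1 + M) / d * d) with (1 + M) in Hn by (field; apply Rgt_not_eq, cond_pos). lra. }
  assert (H : forall j : nat, (j <= S n)%nat ->
    Rabs (g (INR j / p * x) (INR j / p * y)) <= Rabs (g 0 0) + INR j).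
  { induction j as [|j IH]; intros Hj.
    - simpl. unfold Rdiv. rewrite !Rmult_0_l. lra.
    - assert (Hj' : 0 <= INR j / p /\ INR j / p + / p <= 1).
      { split; [apply Rdiv_le_0_compat; [apply pos_INR|lra]|].
        apply le_INR in Hj. rewrite !S_INR in Hj. fold p in Hj.
        apply Rmult_le_reg_r with p; [lra|]. field_simplify; lra. }
      apply Rabs_le_between in Hy.
      assert (Hip : 0 < / p) by (now apply Rinv_0_lt_compat).
      assert (Hst : Rabs (g (INR (S j) / p * x) (INR (S j) / p * y)
                       - g (INR j / p * x) (INR j / p * y)) < 1).
      { assert (E : INR (S j) / p = INR j / p + / p) by (rewrite S_INR; field; lra).
        rewrite E. set (a := INR j / p) in *.
        apply Hd; simpl; try (split; nra).
        - replace ((a + / p) * x - a * x) with (/ p * x) by ring.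
          rewrite Rabs_pos_eq by (apply Rmult_le_pos; lra).
          apply Rle_lt_trans with ((1 + M) / p); [|exact Hpd].
          unfold Rdiv. rewrite Rmult_comm. apply Rmult_le_compat_r; lra.
        - replace ((a + / p) * y - a * y) with (/ p * y) by ring.
          rewrite Rabs_mult, (Rabs_pos_eq (/ p)) by lra.
          apply Rle_lt_trans with ((1 + M) / p); [|exact Hpd].
          unfold Rdiv. rewrite Rmult_comm. apply Rmult_le_compat_r; [lra|].
          apply Rabs_le. lra. }
      rewrite S_INR. specialize (IH ltac:(lia)).
      generalize (Rabs_triang (g (INR (S j) / p * x) (INR (S j) / p * y)
                       - g (INR j / p * x) (INR j / p * y)) (g (INR j / p * x) (INR j / p * y))).
      rewrite S_INR in *.
      match goal with |- Rabs (?a - ?b + ?b) <= _ -> _ => replace (a - b + b) with a by ring end.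
      lra. }
  specialize (H (S n) (Nat.le_refl _)). rewrite S_INR in H. fold p in H.
  replace (p / p) with 1 in H by (field; lra). rewrite !Rmult_1_l in H. fold p. lra.
Qed.

(** Linearization of differences of [f]: it serves for the bound on [y], with [v = 0], and for the
    equation of the discrete error. *)
Lemma slope_between (f fy : R -> R -> R) (m gamma x u v : R) :
  (forall s, is_derive (fun s => f x s) s (fy x s)) ->
  (forall s, m <= fy x s <= gamma) ->
  exists q, m <= q <= gamma /\ f x u - f x v = q * (u - v).
Proof.
  intros Hd Hb.
  destruct (MVT_gen (f x) v u (fy x)) as [c [_ Hc]].
  - intros s _. apply Hd.
  - intros s _. apply continuity_pt_filterlim. eapply is_derive_continuous, Hd.
  - now exists (fy x c).
Qed.

(** * A priori bounds on the solution *)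

Record classical_solution (f : R -> R -> R) (eps : R) (y dy : R -> R) : Prop := {
  sol_cont : forall x, continuous y x;
  sol_0 : y 0 = 0;
  sol_1 : y 1 = 0;
  sol_derive : forall x, 0 < x < 1 -> is_derive y x (dy x);
  sol_eq : forall x, 0 < x < 1 -> is_derive dy x (f x (y x) / eps ^ 2) }.

Lemma bvp_solution_clamp (f : R -> R -> R) (eps : R) (y : R -> R) :
  0 < eps -> bvp_solution f eps y ->
  classical_solution (fun x => f (clamp x)) eps (fun x => y (clamp x)) (Derive y).
Proof.
  intros He [Hc [Hd [H0 H1]]]. split.
  - intros x. now apply continuous_clamp_on.
  - now rewrite clamp_id by lra.
  - now rewrite clamp_id by lra.
  - intros x Hx. apply is_derive_ext_loc with y.
    + generalize (locally_clamp_id x Hx). apply filter_imp. now intros s <-.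
    + apply Derive_correct. apply Hd, Hx.
  - intros x Hx. destruct (Hd x Hx) as [_ [E Heq]]. rewrite clamp_id by lra.
    replace (f x (y x) / eps ^ 2) with (Derive_n y 2 x).
    + apply (Derive_correct (Derive y) x E).
    + replace (f x (y x)) with (eps ^ 2 * Derive_n y 2 x) by lra. field. lra.
Qed.

Definition layer (r x : R) : R := exp (- (r * x)) + exp (- (r * (1 - x))).

Lemma layer_pos (r x : R) : 0 < layer r x.
Proof. unfold layer. generalize (exp_pos (- (r * x))) (exp_pos (- (r * (1 - x)))). lra. Qed.

Lemma is_derive2_layer (r x : R) :
  is_derive (fun x => r * (- exp (- (r * x)) + exp (- (r * (1 - x))))) x (r ^ 2 * layer r x).
Proof. unfold layer. auto_derive; [easy|unfold Rminus; ring]. Qed.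

(** With [q] the difference quotient of [f] between [y] and 0, the equation reads
    [eps^2 y'' = q y + f (x, 0)], and the constant [K / m] is a barrier. *)
Lemma solution_bound (f fy : R -> R -> R) (m gamma K eps : R) (y dy : R -> R) :
  0 < eps -> 0 < m ->
  (forall x s, is_derive (fun s => f x s) s (fy x s)) ->
  (forall x s, m <= fy x s <= gamma) ->
  (forall x, 0 <= x <= 1 -> Rabs (f x 0) <= K) ->
  classical_solution f eps y dy ->
  forall x, 0 <= x <= 1 -> Rabs (y x) <= K / m.
Proof.
  intros He Hm Hfy Hb HK [Hc H0 H1 Hd Heq].
  assert (HK0 : 0 <= K) by (generalize (HK 0 ltac:(lra)) (Rabs_pos (f 0 0)); lra).
  assert (HKm : 0 <= K / m) by (apply Rdiv_le_0_compat; lra).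
  apply (barrier y dy (fun s => f s (y s) / eps ^ 2) (fun _ => K / m) (fun _ => 0) (fun _ => 0)
    (* Where [y] vanishes the quotient is multiplied by 0, so the default only has to respect the
       lower bound [m]. *)
    (fun s => if Req_dec_T (y s) 0 then m else (f s (y s) - f s 0) / y s)
    (fun s => f s 0) (eps ^ 2) m); auto.
  - now apply pow_lt.
  - intros; auto_derive; easy.
  - intros; auto_derive; easy.
  - intros s Hs. replace (eps ^ 2 * (f s (y s) / eps ^ 2)) with (f s (y s)) by (field; lra).
    destruct (Req_dec_T (y s) 0) as [E|E]; [rewrite E; ring|field; easy].
  - intros s Hs. destruct (Req_dec_T (y s) 0) as [E|E]; [lra|].
    destruct (slope_between f fy m gamma s (y s) 0) as [q [Hq Eq]]; auto.
    rewrite Eq, Rminus_0_r. replace (q * y s / y s) with q by (field; easy). lra.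
  - intros s Hs. replace (m * (K / m) - eps ^ 2 * 0) with K by (field; lra). apply HK; lra.
  - rewrite H0, Rabs_R0. lra.
  - rewrite H1, Rabs_R0. lra.
Qed.

(* On a segment of length [eps / 2] the derivative is controlled by the
   oscillation of [y] and by [y'' = f / eps^2]. *)
Lemma derivative_crude_bound (f : R -> R -> R) (K eps : R) (y dy : R -> R) :
  0 < eps < 1 ->
  (forall x, 0 <= x <= 1 -> Rabs (y x) <= K) ->
  (forall x, 0 <= x <= 1 -> Rabs (f x (y x)) <= K) ->
  classical_solution f eps y dy ->
  forall x, 0 < x < 1 -> Rabs (dy x) <= 5 * K / eps.
Proof.
  intros He HyK HfK [Hc H0 H1 Hd Heq] x Hx.
  (* As [eps < 1], a step [eps / 2] towards the farther end of [[0,1]] stays inside. *)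
  assert (Hsg : exists sg, (sg = 1 \/ sg = -1) /\ 0 <= x + sg * (eps / 2) <= 1).
  { destruct (Rle_lt_dec x (1 / 2)); [exists 1|exists (-1)]; split; auto; lra. }
  destruct Hsg as [sg [Hsg Hin]].
  assert (Ht := taylor2 y dy (fun s => f s (y s) / eps ^ 2) 0 1 x (eps / 2) sg (K / eps ^ 2)
    Hc Hd Heq Hsg Hx ltac:(lra) Hin).
  assert (He2 : 0 < eps ^ 2) by (apply pow_lt; lra).
  match type of Ht with ?A -> _ => assert (HA : A) end.
  { intros s Hs. unfold Rdiv. rewrite Rabs_mult, (Rabs_pos_eq (/ eps ^ 2)).
    - apply Rmult_le_compat_r; [left; now apply Rinv_0_lt_compat|].
      apply HfK. destruct Hsg; subst; lra.
    - left; now apply Rinv_0_lt_compat. }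
  (* Hence [eps / 2] times the derivative is at most [2 K + K / 8], which leaves room in the factor
     5. *)
  specialize (Ht HA). replace (K / eps ^ 2 * (eps / 2) ^ 2 / 2) with (K / 8) in Ht by (field; lra).
  generalize (HyK x ltac:(lra)) (HyK _ Hin). intros A1 A2.
  apply Rabs_le_between in Ht. apply Rabs_le_between in A1. apply Rabs_le_between in A2.
  apply Rmult_le_reg_r with eps; [lra|].
  replace (5 * K / eps * eps) with (5 * K) by (field; lra).
  rewrite <- (Rabs_pos_eq eps) at 1 by lra. rewrite <- Rabs_mult.
  apply Rabs_le. destruct Hsg; subst; lra.
Qed.

Lemma exp_le_1 (u : R) : 0 <= u -> exp (- u) <= 1.
Proof.
  intros H. destruct H as [H|<-]; [|rewrite Ropp_0, exp_0; lra].
  rewrite <- exp_0. left. apply exp_increasing. lra.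
Qed.

Lemma exp_le (u v : R) : u <= v -> exp u <= exp v.
Proof. intros [H| ->]; [left; now apply exp_increasing|lra]. Qed.

(* [y'] is only controlled inside [(0,1)], so the barrier is put on [[d, 1-d]],
   with [d <= eps]; shifting the layer functions by [d] costs a factor [exp (sqrt m)]. *)
Lemma shifted_layer (m eps d x : R) :
  0 < eps -> 0 <= d <= eps ->
  exp (- (sqrt m / eps * (x - d))) + exp (- (sqrt m / eps * (1 - d - x)))
  <= exp (sqrt m) * layer (sqrt m / eps) x.
Proof.
  intros He Hd. unfold layer.
  assert (Hs : sqrt m / eps * d <= sqrt m).
  { apply Rle_trans with (sqrt m / eps * eps).
    - apply Rmult_le_compat_l; [|lra]. apply Rdiv_le_0_compat; [apply sqrt_pos|lra].
    - right; field; lra. }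
  rewrite Rmult_plus_distr_l, <- !exp_plus.
  apply Rplus_le_compat; apply exp_le; lra.
Qed.

(** This is the choice of the rate: exponentials of rate [sqrt m / eps] solve [eps^2 E'' = m E] and
    cancel in the barrier inequality. *)
Lemma rate_sq (m eps : R) : 0 < eps -> 0 < m -> eps ^ 2 * (sqrt m / eps) ^ 2 = m.
Proof.
  intros He Hm. unfold Rdiv. rewrite Rpow_mult_distr, pow2_sqrt by lra. field. lra.
Qed.

(** Differentiating the equation gives [eps^2 (y')'' = f_y y' + f_x]. In the barrier the constant
    [K / m] absorbs [f_x], and the exponentials, equal to 1 at the ends of the shrunk interval,
    carry the crude bound [5 * K / eps] there. *)
Lemma derivative_bound (f fx fy : R -> R -> R) (m gamma K eps : R) (y dy : R -> R) :
  0 < eps < 1 -> 0 < m -> 0 <= K ->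
  C1_strip f fx fy ->
  (forall x s, m <= fy x s <= gamma) ->
  (forall x, 0 <= x <= 1 -> Rabs (y x) <= K) ->
  (forall x, 0 <= x <= 1 -> Rabs (f x (y x)) <= K) ->
  (forall x, 0 <= x <= 1 -> Rabs (fx x (y x)) <= K) ->
  classical_solution f eps y dy ->
  forall x, 0 < x < 1 ->
    Rabs (dy x) <= (K / m + 5 * K * exp (sqrt m)) * (1 + layer (sqrt m / eps) x / eps).
Proof.
  intros He Hm HK0 Hf Hb HyK HfK HfxK Hsol x Hx.
  assert (Hcrude := derivative_crude_bound f K eps y dy He HyK HfK Hsol).
  destruct Hsol as [Hc H0 H1 Hd Heq].
  (* Positive, so that [dy] is controlled at [d] and [1 - d]; at most [eps], as [shifted_layer]
     requires; small enough for the given [x] to lie in [[d, 1 - d]]. *)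
  pose (d := Rmin (Rmin x (1 - x)) eps).
  assert (Hdd : 0 < d /\ d <= eps /\ d <= x <= 1 - d).
  { unfold d. generalize (Rmin_l (Rmin x (1 - x)) eps) (Rmin_r (Rmin x (1 - x)) eps)
      (Rmin_l x (1 - x)) (Rmin_r x (1 - x)).
    intros. repeat split; try lra. repeat apply Rmin_glb_lt; lra. }
  clearbody d. destruct Hdd as [Hd0 [Hde Hdx]].
  pose (r := sqrt m / eps).
  assert (Hr2 : eps ^ 2 * r ^ 2 = m) by (apply rate_sq; lra).
  assert (He2 : 0 < eps ^ 2) by (apply pow_lt; lra).
  assert (HKm : 0 <= K / m) by (apply Rdiv_le_0_compat; lra).
  assert (HKe : 0 <= 5 * K / eps) by (apply Rdiv_le_0_compat; lra).
  apply Rle_trans with (K / m + 5 * K / eps *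
    (exp (- (r * (x - d))) + exp (- (r * (1 - d - x))))).
  - apply (barrier dy (fun s => f s (y s) / eps ^ 2)
      (fun s => (fx s (y s) + fy s (y s) * dy s) * / eps ^ 2)
      (fun s => K / m + 5 * K / eps * (exp (- (r * (s - d))) + exp (- (r * (1 - d - s)))))
      (fun s => 5 * K / eps * (r * (- exp (- (r * (s - d))) + exp (- (r * (1 - d - s))))))
      (fun s => 5 * K / eps * (r ^ 2 * (exp (- (r * (s - d))) + exp (- (r * (1 - d - s))))))
      (fun s => fy s (y s)) (fun s => fx s (y s)) (eps ^ 2) m d (1 - d)); auto; try lra.
    + intros s Hs. eapply is_derive_continuous, Heq. lra.
    + intros s Hs. apply Heq. lra.
    + intros s Hs.
      apply (is_derive_scal_l (fun s => f s (y s)) s _ (/ eps ^ 2)).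
      apply (C1_chain f fx fy); auto; [lra|]. apply Hd; lra.
    + intros s Hs. auto_derive; [easy|]. unfold Rminus; field; lra.
    + intros s Hs. auto_derive; [easy|]. unfold Rminus; field; lra.
    + intros s Hs. field; lra.
    + intros s Hs. apply Hb.
    + intros s Hs. generalize (exp_pos (- (r * (s - d)))) (exp_pos (- (r * (1 - d - s)))).
      intros. apply Rplus_le_le_0_compat; [lra|]. apply Rmult_le_pos; lra.
    + intros s Hs. set (e := exp _ + exp _).
      replace (m * (K / m + 5 * K / eps * e) - eps ^ 2 * (5 * K / eps * (r ^ 2 * e)))
        with (m * (K / m) + (m - eps ^ 2 * r ^ 2) * (5 * K / eps * e)) by ring.
      rewrite Hr2. replace (m * (K / m)) with K by (field; lra).
      generalize (HfxK s ltac:(lra)). lra.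
    + replace (d - d) with 0 by ring. rewrite Rmult_0_r, Ropp_0, exp_0.
      generalize (exp_pos (- (r * (1 - d - d)))) (Hcrude d ltac:(lra)). intros. nra.
    + replace (1 - d - (1 - d)) with 0 by ring. rewrite Rmult_0_r, Ropp_0, exp_0.
      generalize (exp_pos (- (r * (1 - d - d)))) (Hcrude (1 - d) ltac:(lra)). intros. nra.
  - assert (Hl := layer_pos r x).
    generalize (shifted_layer m eps d x ltac:(lra) ltac:(lra)). fold r. intros Hs.
    apply Rmult_le_compat_l with (r := 5 * K / eps) in Hs; [|lra].
    replace (5 * K / eps * (exp (sqrt m) * layer r x))
      with (5 * K * exp (sqrt m) * (layer r x / eps)) in Hs by (field; lra).
    assert (0 <= 5 * K * exp (sqrt m)) by (apply Rmult_le_pos; [lra|left; apply exp_pos]).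
    assert (0 <= K / m * (layer r x / eps)).
    { apply Rmult_le_pos; [lra|]. apply Rdiv_le_0_compat; lra. }
    lra.
Qed.

(** * The residual along the solution and its derivatives *)

(** Along a solution this is [(f (x, y))'], that is [eps^2 y''']. *)
Definition composite_deriv (fx fy : R -> R -> R) (y dy : R -> R) (x : R) : R :=
  fx x (y x) + fy x (y x) * dy x.

(* The part of [(f (x, y))''] that does not contain [y'']. *)
Definition composite_quadratic (fxx fxy fyx fyy : R -> R -> R) (y dy : R -> R) (x : R) : R :=
  composite_deriv fxx fxy y dy x + composite_deriv fyx fyy y dy x * dy x.

Lemma is_derive_composite_deriv (f fx fy fxx fxy fyx fyy : R -> R -> R) (eps : R) (y dy : R -> R) x :
  C2_strip f fx fy fxx fxy fyx fyy -> classical_solution f eps y dy -> 0 < x < 1 ->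
  is_derive (composite_deriv fx fy y dy) x
    (composite_quadratic fxx fxy fyx fyy y dy x + fy x (y x) * (f x (y x) / eps ^ 2)).
Proof.
  intros [Hf Hfx Hfy] [Hc H0 H1 Hd Heq] Hx.
  unfold composite_quadratic, composite_deriv at 1. rewrite Rplus_assoc.
  apply is_derive_plus_R.
  - apply (C1_chain fx fxx fxy); auto.
  - apply (is_derive_mult (fun s => fy s (y s)) dy); auto.
    + apply (C1_chain fy fyx fyy); auto.
    + intros n k; apply Rmult_comm.
Qed.

Lemma layer_sq (r x : R) :
  layer r x ^ 2 <= 2 * (exp (- (r * x)) ^ 2 + exp (- (r * (1 - x))) ^ 2).
Proof. unfold layer. generalize (pow2_ge_0 (exp (- (r * x)) - exp (- (r * (1 - x))))). nra. Qed.

(** The expression is quadratic in [y'], and [eps^2 y'^2] is of size [eps^2] plus the squared layer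
    function. Keeping the squares matters: a source proportional to the layer function itself would
    be resonant and force a factor growing like [x / eps] in the barrier. *)
Lemma composite_quadratic_bound (fxx fxy fyx fyy : R -> R -> R) (K C r eps : R) (y dy : R -> R) x :
  0 < eps < 1 -> 0 <= K -> 0 <= C ->
  Rabs (fxx x (y x)) <= K -> Rabs (fxy x (y x)) <= K ->
  Rabs (fyx x (y x)) <= K -> Rabs (fyy x (y x)) <= K ->
  Rabs (dy x) <= C * (1 + layer r x / eps) ->
  Rabs (eps ^ 2 * composite_quadratic fxx fxy fyx fyy y dy x)
  <= 4 * K * (1 + C) ^ 2 * (eps ^ 2 + (exp (- (r * x)) ^ 2 + exp (- (r * (1 - x))) ^ 2)).
Proof.
  intros He HK HC A B D E HD. unfold composite_quadratic, composite_deriv.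
  set (p := Rabs (dy x)) in *. assert (Hp : 0 <= p) by apply Rabs_pos.
  assert (H1 : Rabs (fxx x (y x) + fxy x (y x) * dy x + (fyx x (y x) + fyy x (y x) * dy x) * dy x)
    <= K * (1 + p) ^ 2).
  { eapply Rle_trans; [apply Rabs_triang|].
    eapply Rle_trans; [apply Rplus_le_compat; [apply Rabs_triang|]|].
    - rewrite Rabs_mult. apply Rmult_le_compat_r; [apply Rabs_pos|apply Rabs_triang].
    - rewrite !Rabs_mult. fold p.
      assert (Rabs (fxy x (y x)) * p <= K * p) by (apply Rmult_le_compat_r; lra).
      assert (Rabs (fyy x (y x)) * p <= K * p) by (apply Rmult_le_compat_r; lra).
      assert ((Rabs (fyx x (y x)) + Rabs (fyy x (y x)) * p) * p <= (K + K * p) * p).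
      { apply Rmult_le_compat_r; lra. }
      nra. }
  rewrite Rabs_mult, (Rabs_pos_eq (eps ^ 2)) by (apply pow2_ge_0).
  assert (Hl := layer_pos r x). set (Z := layer r x) in *.
  assert (H2 : 1 + p <= (1 + C) * (1 + Z / eps)).
  { assert (0 <= Z / eps) by (apply Rdiv_le_0_compat; lra). lra. }
  assert (H3 : eps * (1 + p) <= (1 + C) * (eps + Z)).
  { replace ((1 + C) * (eps + Z)) with (eps * ((1 + C) * (1 + Z / eps))) by (field; lra).
    apply Rmult_le_compat_l; lra. }
  assert (H4 : (eps * (1 + p)) ^ 2 <= ((1 + C) * (eps + Z)) ^ 2).
  { apply pow_incr. split; [apply Rmult_le_pos; lra|exact H3]. }
  assert (H5 : (eps + Z) ^ 2 <= 4 * (eps ^ 2 + (exp (- (r * x)) ^ 2 + exp (- (r * (1 - x))) ^ 2))).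
  { generalize (layer_sq r x) (pow2_ge_0 (eps - Z)). fold Z. nra. }
  apply Rle_trans with (eps ^ 2 * (K * (1 + p) ^ 2)).
  { apply Rmult_le_compat_l; [apply pow2_ge_0|exact H1]. }
  replace (eps ^ 2 * (K * (1 + p) ^ 2)) with (K * (eps * (1 + p)) ^ 2) by ring.
  replace (4 * K * (1 + C) ^ 2 * (eps ^ 2 + (exp (- (r * x)) ^ 2 + exp (- (r * (1 - x))) ^ 2)))
    with (K * ((1 + C) ^ 2 * (4 * (eps ^ 2 + (exp (- (r * x)) ^ 2 + exp (- (r * (1 - x))) ^ 2))))) by ring.
  apply Rmult_le_compat_l; [exact HK|].
  apply Rle_trans with (1 := H4). rewrite Rpow_mult_distr.
  apply Rmult_le_compat_l; [apply pow2_ge_0|exact H5].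
Qed.

(* The barrier [2 E - E^2] (with [E] a layer function of rate [sqrt m / eps])
   absorbs the source terms of size [E^2] and still dominates [E]. *)
Lemma residual_bound (f fx fy fxx fxy fyx fyy : R -> R -> R) (m gamma K G eps : R) (y dy : R -> R) :
  0 < eps < 1 -> 0 < m -> 0 <= K -> 0 <= G ->
  C2_strip f fx fy fxx fxy fyx fyy ->
  (forall x s, m <= fy x s <= gamma) ->
  (forall x, 0 <= x <= 1 -> Rabs (f x (y x)) <= K) ->
  classical_solution f eps y dy ->
  (forall x, 0 < x < 1 -> Rabs (eps ^ 2 * composite_quadratic fxx fxy fyx fyy y dy x)
     <= G * (eps ^ 2 + (exp (- (sqrt m / eps * x)) ^ 2 + exp (- (sqrt m / eps * (1 - x))) ^ 2))) ->
  forall x, 0 < x < 1 ->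
    Rabs (f x (y x)) <= (G / m + 2 * (G / m + K) * exp (sqrt m)) * (eps ^ 2 + layer (sqrt m / eps) x).
Proof.
  intros He Hm HK0 HG0 Hf Hb HfK Hsol HG x Hx.
  assert (HF2 := fun s => is_derive_composite_deriv f fx fy fxx fxy fyx fyy eps y dy s Hf Hsol).
  destruct Hsol as [Hc H0 H1 Hd Heq].
  pose (d := Rmin (Rmin x (1 - x)) eps).
  assert (Hdd : 0 < d /\ d <= eps /\ d <= x <= 1 - d).
  { unfold d. generalize (Rmin_l (Rmin x (1 - x)) eps) (Rmin_r (Rmin x (1 - x)) eps)
      (Rmin_l x (1 - x)) (Rmin_r x (1 - x)).
    intros. repeat split; try lra. repeat apply Rmin_glb_lt; lra. }
  clearbody d. destruct Hdd as [Hd0 [Hde Hdx]].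
  set (r := sqrt m / eps) in *.
  assert (Hr0 : 0 <= r) by (apply Rdiv_le_0_compat; [apply sqrt_pos|lra]).
  assert (Hr2 : eps ^ 2 * r ^ 2 = m) by (apply rate_sq; lra).
  assert (He2 : 0 < eps ^ 2) by (apply pow_lt; lra).
  assert (HGm : 0 <= G / m) by (apply Rdiv_le_0_compat; lra).
  (* For [b = 2 E - E^2] one has [m b - eps^2 b'' = 3 m E^2], so the part [G / m] of [c] absorbs the
     source. At the ends of the shrunk interval [b = 1] for one of the exponentials, and the part
     [K] dominates the residual. *)
  pose (c := G / m + K). assert (Hc0 : 0 <= c) by (unfold c; lra).
  pose (E := fun s => exp (- (r * (s - d)))).
  pose (E' := fun s => exp (- (r * (1 - d - s)))).
  assert (HE : forall s, d <= s <= 1 - d -> 0 < E s <= 1 /\ 0 < E' s <= 1).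
  { intros s Hs. unfold E, E'. repeat split; try apply exp_pos; apply exp_le_1, Rmult_le_pos; lra. }
  assert (HB : Rabs (f x (y x)) <= G / m * eps ^ 2 + c * (2 * E x - E x ^ 2 + (2 * E' x - E' x ^ 2))).
  { apply (barrier (fun s => f s (y s)) (composite_deriv fx fy y dy)
      (fun s => composite_quadratic fxx fxy fyx fyy y dy s + fy s (y s) * (f s (y s) / eps ^ 2))
      (fun s => G / m * eps ^ 2 + c * (2 * E s - E s ^ 2 + (2 * E' s - E' s ^ 2)))
      (fun s => c * (r * (- (2 * E s - 2 * E s ^ 2) + (2 * E' s - 2 * E' s ^ 2))))
      (fun s => c * (r ^ 2 * ((2 * E s - 4 * E s ^ 2) + (2 * E' s - 4 * E' s ^ 2))))
      (fun s => fy s (y s)) (fun s => eps ^ 2 * composite_quadratic fxx fxy fyx fyy y dy s)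
      (eps ^ 2) m d (1 - d)); auto; try lra.
    - intros s Hs. eapply is_derive_continuous. apply (C1_chain f fx fy); [apply Hf|lra|apply Hd; lra].
    - intros s Hs. apply (C1_chain f fx fy); [apply Hf|lra|apply Hd; lra].
    - intros s Hs. apply HF2. lra.
    - intros s Hs. unfold E, E'. auto_derive; [easy|]. unfold Rminus; ring.
    - intros s Hs. unfold E, E'. auto_derive; [easy|]. unfold Rminus; ring.
    - intros s Hs. field; lra.
    - intros s Hs. apply Hb.
    - intros s Hs. destruct (HE s ltac:(lra)).
      apply Rplus_le_le_0_compat; [apply Rmult_le_pos; lra|]. apply Rmult_le_pos; nra.
    - intros s Hs. apply Rle_trans with (1 := HG s ltac:(lra)).
      replace (m * (G / m * eps ^ 2 + c * (2 * E s - E s ^ 2 + (2 * E' s - E' s ^ 2))) -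
        eps ^ 2 * (c * (r ^ 2 * (2 * E s - 4 * E s ^ 2 + (2 * E' s - 4 * E' s ^ 2)))))
      with (m * (G / m) * eps ^ 2 + m * c * (2 * E s - E s ^ 2 + (2 * E' s - E' s ^ 2)) -
        (eps ^ 2 * r ^ 2) * c * (2 * E s - 4 * E s ^ 2 + (2 * E' s - 4 * E' s ^ 2))) by ring.
      rewrite Hr2. replace (m * (G / m)) with G by (field; lra).
      assert (Hmc : G <= m * c).
      { unfold c. replace (m * (G / m + K)) with (G + m * K) by (field; lra).
        generalize (Rmult_le_pos m K ltac:(lra) HK0). lra. }
      assert (exp (- (r * s)) ^ 2 <= E s ^ 2).
      { apply pow_incr; split; [left; apply exp_pos|]. apply exp_le.
        generalize (Rmult_le_pos r d Hr0 ltac:(lra)). lra. }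
      assert (exp (- (r * (1 - s))) ^ 2 <= E' s ^ 2).
      { apply pow_incr; split; [left; apply exp_pos|]. apply exp_le.
        generalize (Rmult_le_pos r d Hr0 ltac:(lra)). lra. }
      assert (0 <= E s ^ 2 + E' s ^ 2) by (generalize (pow2_ge_0 (E s)) (pow2_ge_0 (E' s)); lra).
      assert (G * (exp (- (r * s)) ^ 2 + exp (- (r * (1 - s))) ^ 2) <= G * (E s ^ 2 + E' s ^ 2)).
      { apply Rmult_le_compat_l; lra. }
      assert (G * (E s ^ 2 + E' s ^ 2) <= m * c * (E s ^ 2 + E' s ^ 2)).
      { apply Rmult_le_compat_r; lra. }
      assert (0 <= m * c * (E s ^ 2 + E' s ^ 2)) by (apply Rmult_le_pos; lra).
      lra.
    - replace (E d) with 1 by (unfold E; replace (d - d) with 0 by ring; rewrite Rmult_0_r, Ropp_0, exp_0; easy).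
      destruct (HE d ltac:(lra)) as [_ HE'].
      generalize (HfK d ltac:(lra)). intros.
      assert (0 <= G / m * eps ^ 2) by (apply Rmult_le_pos; lra).
      assert (0 <= c * (2 * E' d - E' d ^ 2)) by (apply Rmult_le_pos; nra).
      unfold c in *. nra.
    - replace (E' (1 - d)) with 1 by (unfold E'; replace (1 - d - (1 - d)) with 0 by ring; rewrite Rmult_0_r, Ropp_0, exp_0; easy).
      destruct (HE (1 - d) ltac:(lra)) as [HE' _].
      generalize (HfK (1 - d) ltac:(lra)). intros.
      assert (0 <= G / m * eps ^ 2) by (apply Rmult_le_pos; lra).
      assert (0 <= c * (2 * E (1 - d) - E (1 - d) ^ 2)) by (apply Rmult_le_pos; nra).
      unfold c in *. nra. }
  apply Rle_trans with (1 := HB).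
  generalize (shifted_layer m eps d x ltac:(lra) ltac:(lra)). fold r.
  change (exp (- (r * (x - d)))) with (E x). change (exp (- (r * (1 - d - x)))) with (E' x). intros Hs.
  assert (Hl := layer_pos r x).
  assert (c * (2 * E x - E x ^ 2 + (2 * E' x - E' x ^ 2)) <= c * (2 * (exp (sqrt m) * layer r x))).
  { apply Rmult_le_compat_l; [lra|]. generalize (pow2_ge_0 (E x)) (pow2_ge_0 (E' x)). lra. }
  fold c.
  assert (0 <= G / m * layer r x) by (apply Rmult_le_pos; lra).
  assert (0 <= 2 * c * exp (sqrt m) * eps ^ 2).
  { apply Rmult_le_pos; [|lra]. apply Rmult_le_pos; [lra|left; apply exp_pos]. }
  lra.
Qed.

Lemma composite_quadratic_layer_bound (G Z eps q e e' : R) :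
  0 < eps -> 0 <= G -> 0 < e <= 1 -> 0 < e' <= 1 -> Z = e + e' ->
  Rabs (eps ^ 2 * q) <= G * (eps ^ 2 + (e ^ 2 + e' ^ 2)) ->
  Rabs q <= G * (1 + Z / eps ^ 2).
Proof.
  intros He HG Hee He' HZ H. assert (He2 : 0 < eps ^ 2) by (apply pow_lt; lra).
  apply Rmult_le_reg_l with (eps ^ 2); [lra|].
  rewrite Rabs_mult, (Rabs_pos_eq (eps ^ 2)) in H by lra.
  apply Rle_trans with (1 := H).
  replace (eps ^ 2 * (G * (1 + Z / eps ^ 2))) with (G * (eps ^ 2 + Z)) by (field; lra).
  apply Rmult_le_compat_l; [lra|]. nra.
Qed.

(** Divided by [eps ^ 2], the last three fields bound [y''], [y'''] and [y'''']. The term [eps ^ 2]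
    in [lb_f] makes [y''] bounded away from the layers; for the two higher derivatives a regular
    part of size [eps ^ -2] is enough, because the scheme compares differences of [f], which is
    [eps^2 y'']. *)
Record layer_bounds (f fx fy fxx fxy fyx fyy : R -> R -> R) (y dy : R -> R) (r C eps : R) : Prop := {
  lb_dy : forall x, 0 < x < 1 -> Rabs (dy x) <= C * (1 + layer r x / eps);
  lb_f : forall x, 0 <= x <= 1 -> Rabs (f x (y x)) <= C * (eps ^ 2 + layer r x);
  lb_df : forall x, 0 < x < 1 -> Rabs (composite_deriv fx fy y dy x) <= C * (1 + layer r x / eps);
  lb_ddf : forall x, 0 < x < 1 ->
    Rabs (composite_quadratic fxx fxy fyx fyy y dy x + fy x (y x) * (f x (y x) / eps ^ 2))
    <= C * (1 + layer r x / eps ^ 2) }.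

Lemma solution_layer_bounds (f fx fy fxx fxy fyx fyy : R -> R -> R) (m gamma : R) :
  0 < m ->
  C2_strip f fx fy fxx fxy fyx fyy ->
  (forall x s, m <= fy x s <= gamma) ->
  exists C, 0 < C /\ forall eps y dy, 0 < eps < 1 ->
    classical_solution f eps y dy ->
    layer_bounds f fx fy fxx fxy fyx fyy y dy (sqrt m / eps) C eps.
Proof.
  intros Hm Hf Hb.
  assert (Hf' := Hf). destruct Hf' as [Cf Cfx Cfy].
  destruct (bounded_on_rectangle f 0) as [K0 [HK0 Hf0]]; [lra|apply Cf|].
  pose (M := K0 / m). assert (HM : 0 <= M) by (apply Rdiv_le_0_compat; lra).
  destruct (bounded_on_rectangle f M HM) as [K1 [HK1 B1]]; [apply Cf|].
  destruct (bounded_on_rectangle fx M HM) as [K2 [HK2 B2]]; [apply Cfx|].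
  destruct (bounded_on_rectangle fxx M HM) as [K3 [HK3 B3]]; [apply Cfx|].
  destruct (bounded_on_rectangle fxy M HM) as [K4 [HK4 B4]]; [apply Cfx|].
  destruct (bounded_on_rectangle fyx M HM) as [K5 [HK5 B5]]; [apply Cfy|].
  destruct (bounded_on_rectangle fyy M HM) as [K6 [HK6 B6]]; [apply Cfy|].
  assert (Hg : 0 < gamma) by (generalize (Hb 0 0); lra).
  pose (K := M + K1 + K2 + K3 + K4 + K5 + K6 + gamma).
  assert (HK : 1 <= K) by (unfold K; lra).
  pose (C1 := K / m + 5 * K * exp (sqrt m)).
  assert (HKm : 0 <= K / m) by (apply Rdiv_le_0_compat; lra).
  assert (HC1 : 0 <= C1).
  { unfold C1. generalize (exp_pos (sqrt m)). intros. apply Rplus_le_le_0_compat; [lra|].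
    apply Rmult_le_pos; lra. }
  pose (G := 4 * K * (1 + C1) ^ 2).
  assert (HG : 0 <= G).
  { unfold G. apply Rmult_le_pos; [lra|apply pow2_ge_0]. }
  assert (HGm : 0 <= G / m) by (apply Rdiv_le_0_compat; lra).
  pose (C2 := G / m + 2 * (G / m + K) * exp (sqrt m)).
  assert (HC2 : 0 <= C2).
  { unfold C2. generalize (exp_pos (sqrt m)). intros. apply Rplus_le_le_0_compat; [lra|].
    apply Rmult_le_pos; lra. }
  exists (C1 + K + C2 + K * C1 + G + K * C2 ). split; [assert (0 <= K * C1) by (apply Rmult_le_pos; lra); assert (0 <= K * C2) by (apply Rmult_le_pos; lra); lra|].
  intros eps y dy He Hsol.
  assert (HKC1 : 0 <= K * C1) by (apply Rmult_le_pos; lra). assert (HKC2 : 0 <= K * C2) by (apply Rmult_le_pos; lra).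
  set (C := C1 + K + C2 + K * C1 + G + K * C2).
  assert (He2 : 0 < eps ^ 2) by (apply pow_lt; lra).
  assert (HyM : forall x, 0 <= x <= 1 -> Rabs (y x) <= M).
  { apply (solution_bound f fy m gamma K0 eps y dy); auto; try lra.
    - apply Cf.
    - intros x Hx. apply Hf0; [lra|]. rewrite Rabs_R0; lra. }
  assert (HyK : forall x, 0 <= x <= 1 -> Rabs (y x) <= K).
  { intros x Hx. generalize (HyM x Hx). unfold K; lra. }
  assert (HfK : forall x, 0 <= x <= 1 -> Rabs (f x (y x)) <= K).
  { intros x Hx. generalize (B1 x (y x) Hx (HyM x Hx)). unfold K; lra. }
  assert (HfxK : forall x, 0 <= x <= 1 -> Rabs (fx x (y x)) <= K).
  { intros x Hx. generalize (B2 x (y x) Hx (HyM x Hx)). unfold K; lra. }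
  assert (Hdy : forall x, 0 < x < 1 -> Rabs (dy x) <= C1 * (1 + layer (sqrt m / eps) x / eps)).
  { apply (derivative_bound f fx fy m gamma K eps y dy); auto; lra. }
  assert (Hq : forall x, 0 < x < 1 -> Rabs (eps ^ 2 * composite_quadratic fxx fxy fyx fyy y dy x)
     <= G * (eps ^ 2 + (exp (- (sqrt m / eps * x)) ^ 2 + exp (- (sqrt m / eps * (1 - x))) ^ 2))).
  { intros x Hx. assert (Hx' : 0 <= x <= 1) by lra.
    apply composite_quadratic_bound; auto; try lra.
    - generalize (B3 x (y x) Hx' (HyM x Hx')). unfold K; lra.
    - generalize (B4 x (y x) Hx' (HyM x Hx')). unfold K; lra.
    - generalize (B5 x (y x) Hx' (HyM x Hx')). unfold K; lra.
    - generalize (B6 x (y x) Hx' (HyM x Hx')). unfold K; lra. }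
  assert (HF : forall x, 0 < x < 1 -> Rabs (f x (y x)) <= C2 * (eps ^ 2 + layer (sqrt m / eps) x)).
  { apply (residual_bound f fx fy fxx fxy fyx fyy m gamma K G eps y dy); auto; lra. }
  set (r := sqrt m / eps) in *.
  assert (Hr : 0 <= r) by (apply Rdiv_le_0_compat; [apply sqrt_pos|lra]).
  assert (Hfy : forall x, Rabs (fy x (y x)) <= K).
  { intros x. generalize (Hb x (y x)). intros. rewrite Rabs_pos_eq by lra. unfold K; lra. }
  split.
  - intros x Hx. apply Rle_trans with (1 := Hdy x Hx). apply Rmult_le_compat_r; [|unfold C; lra].
    assert (0 <= layer r x / eps) by (apply Rdiv_le_0_compat; [left; apply layer_pos|lra]). lra.
  (* At 0 and 1 the layer function is at least 1, so the bound [K] of the residual suffices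
     there. *)
  - intros x Hx. destruct (Rlt_dec 0 x) as [H1|H1]; [destruct (Rlt_dec x 1) as [H2|H2]|].
    + apply Rle_trans with (1 := HF x (conj H1 H2)). apply Rmult_le_compat_r; [|unfold C; lra].
      generalize (layer_pos r x). lra.
    + replace x with 1 by lra. apply Rle_trans with (1 := HfK 1 ltac:(lra)).
      unfold layer. replace (1 - 1) with 0 by ring. rewrite Rmult_0_r, Ropp_0, exp_0.
      generalize (exp_pos (- (r * 1))). intros.
      apply Rle_trans with (C * 1); [unfold C; lra|]. apply Rmult_le_compat_l; [unfold C|]; lra.
    + replace x with 0 by lra. apply Rle_trans with (1 := HfK 0 ltac:(lra)).
      unfold layer. rewrite Rmult_0_r, Ropp_0, exp_0.
      generalize (exp_pos (- (r * (1 - 0)))). intros.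
      apply Rle_trans with (C * 1); [unfold C; lra|]. apply Rmult_le_compat_l; [unfold C|]; lra.
  - intros x Hx. assert (Hz : 0 <= layer r x / eps) by (apply Rdiv_le_0_compat; [left; apply layer_pos|lra]).
    unfold composite_deriv. eapply Rle_trans; [apply Rabs_triang|]. rewrite Rabs_mult.
    apply Rle_trans with (K + K * (C1 * (1 + layer r x / eps))).
    + apply Rplus_le_compat; [apply HfxK; lra|].
      apply Rmult_le_compat; auto using Rabs_pos.
    + set (z := layer r x / eps) in *.
      apply Rle_trans with ((K + K * C1) * (1 + z)); [|apply Rmult_le_compat_r; unfold C; lra].
      assert (0 <= K * z) by (apply Rmult_le_pos; lra). lra.
  - intros x Hx. assert (Hz : 0 <= layer r x / eps ^ 2) by (apply Rdiv_le_0_compat; [left; apply layer_pos|lra]).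
    eapply Rle_trans; [apply Rabs_triang|].
    assert (Q1 : Rabs (composite_quadratic fxx fxy fyx fyy y dy x) <= G * (1 + layer r x / eps ^ 2)).
    { apply composite_quadratic_layer_bound with (exp (- (r * x))) (exp (- (r * (1 - x)))); auto; try lra.
      - split; [apply exp_pos|]. apply exp_le_1, Rmult_le_pos; lra.
      - split; [apply exp_pos|]. apply exp_le_1, Rmult_le_pos; lra. }
    assert (Q2 : Rabs (fy x (y x) * (f x (y x) / eps ^ 2)) <= K * (C2 * (1 + layer r x / eps ^ 2))).
    { rewrite Rabs_mult. apply Rmult_le_compat; auto using Rabs_pos.
      unfold Rdiv at 1. rewrite Rabs_mult, (Rabs_pos_eq (/ eps ^ 2)) by (left; now apply Rinv_0_lt_compat).
      replace (C2 * (1 + layer r x / eps ^ 2)) with (C2 * (eps ^ 2 + layer r x) * / eps ^ 2) by (field; lra).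
      apply Rmult_le_compat_r; [left; now apply Rinv_0_lt_compat|]. now apply HF. }
    apply Rle_trans with ((G + K * C2) * (1 + layer r x / eps ^ 2)); [lra|].
    apply Rmult_le_compat_r; unfold C; lra.
Qed.

(** * The mesh *)

(** This and the next three formulas hold on ranges that include the break points, where
    neighbouring formulas agree; thus both ends of any mesh cell fall under one of them. *)
Lemma psi_left_layer (l s : R) : s <= 1 / 4 -> psi l s = 4 * l * s.
Proof.
  intros H. unfold psi, psi_left.
  destruct (Rle_dec s (1 / 2)), (Rle_dec s (1 / 4)); lra.
Qed.

Lemma psi_left_core (l s : R) : 1 / 4 <= s <= 1 / 2 ->
  psi l s = 32 * (1 - 4 * l) * (s - 1 / 4) ^ 3 + 4 * l * s.
Proof.
  intros H. unfold psi, psi_left.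
  destruct (Rle_dec s (1 / 2)), (Rle_dec s (1 / 4)); try lra.
  replace s with (1 / 4) by lra. ring.
Qed.

Lemma psi_right_core (l s : R) : 1 / 2 <= s <= 3 / 4 ->
  psi l s = 1 - (32 * (1 - 4 * l) * (3 / 4 - s) ^ 3 + 4 * l * (1 - s)).
Proof.
  intros H. unfold psi, psi_left.
  destruct (Rle_dec s (1 / 2)), (Rle_dec s (1 / 4)), (Rle_dec (1 - s) (1 / 4)); try lra.
  - replace s with (1 / 2) by lra. field.
  - replace s with (3 / 4) by lra. field.
Qed.

Lemma psi_right_layer (l s : R) : 3 / 4 <= s -> psi l s = 1 - 4 * l * (1 - s).
Proof.
  intros H. unfold psi, psi_left.
  destruct (Rle_dec s (1 / 2)), (Rle_dec s (1 / 4)), (Rle_dec (1 - s) (1 / 4)); lra.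
Qed.

(* Contribution of the cubic part of [psi] to the [i]-th step, [n = N / 4]. *)
Definition cubic_increment (n i : nat) (d : R) : R :=
  let cube s := (s + d) ^ 3 - s ^ 3 in
  if Nat.ltb i n then 0
  else if Nat.ltb i (2 * n) then cube ((INR i - INR n) * d)
  else if Nat.ltb i (3 * n) then cube ((3 * INR n - 1 - INR i) * d)
  else 0.

(** The linear part contributes [4 * l * d] to every cell. By symmetry cell [i] of the right half
    has the length of cell [4 n - 1 - i], whose cube starts at [(3 n - 1 - i) d]. *)
Lemma psi_step (l d : R) (n i : nat) : (i < 4 * n)%nat -> d = / (4 * INR n) ->
  psi l ((INR i + 1) * d) - psi l (INR i * d)
  = 4 * l * d + 32 * (1 - 4 * l) * cubic_increment n i d.
Proof.
  intros Hi Hd.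
  assert (Hn : 0 < INR n) by (apply lt_0_INR; lia).
  assert (Hd0 : 0 < d) by (rewrite Hd; apply Rinv_0_lt_compat; lra).
  assert (Hnd : INR n * d = 1 / 4) by (rewrite Hd; field; lra).
  assert (Hle : forall a b, a <= b -> a * d <= b * d) by (intros; apply Rmult_le_compat_r; lra).
  generalize (pos_INR i). intros Hi0.
  unfold cubic_increment.
  destruct (Nat.ltb_spec i n) as [H1|H1].
  { apply le_INR in H1. rewrite S_INR in H1.
    rewrite 2!psi_left_layer; [ring| |].
    - generalize (Hle (INR i) (INR n)). lra.
    - generalize (Hle (INR i + 1) (INR n)). lra. }
  apply le_INR in H1.
  destruct (Nat.ltb_spec i (2 * n)) as [H2|H2].
  { apply le_INR in H2. rewrite S_INR, mult_INR in H2. simpl INR in H2.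
    rewrite 2!psi_left_core.
    - replace (1 / 4) with (INR n * d). ring.
    - generalize (Hle (INR n) (INR i)) (Hle (INR i) (2 * INR n)). lra.
    - generalize (Hle (INR n) (INR i + 1)) (Hle (INR i + 1) (2 * INR n)). lra. }
  apply le_INR in H2. rewrite mult_INR in H2. simpl INR in H2.
  destruct (Nat.ltb_spec i (3 * n)) as [H3|H3].
  { apply le_INR in H3. rewrite S_INR, mult_INR in H3. simpl INR in H3.
    rewrite 2!psi_right_core.
    - replace (3 / 4) with (3 * (INR n * d)) by lra. ring.
    - generalize (Hle (2 * INR n) (INR i)) (Hle (INR i) (3 * INR n)). lra.
    - generalize (Hle (2 * INR n) (INR i + 1)) (Hle (INR i + 1) (3 * INR n)). lra. }
  apply le_INR in H3. rewrite mult_INR in H3. simpl INR in H3.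
  rewrite 2!psi_right_layer; [ring| |].
  - generalize (Hle (3 * INR n) (INR i)). lra.
  - generalize (Hle (3 * INR n) (INR i + 1)). lra.
Qed.

(** With [s + d <= 1 / 4], the increment of the cube is at most [3 d (s + d)^2 <= 3 d / 16]. *)
Lemma cubic_increment_bounds (n i : nat) (d : R) : (i < 4 * n)%nat -> d = / (4 * INR n) ->
  0 <= cubic_increment n i d <= 3 / 16 * d.
Proof.
  intros Hi Hd.
  assert (Hn : 0 < INR n) by (apply lt_0_INR; lia).
  assert (Hd0 : 0 < d) by (rewrite Hd; apply Rinv_0_lt_compat; lra).
  assert (Hnd : INR n * d = 1 / 4) by (rewrite Hd; field; lra).
  assert (Hcube : forall c, 0 <= c -> c + 1 <= INR n -> 0 <= (c * d + d) ^ 3 - (c * d) ^ 3 <= 3 / 16 * d).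
  { intros c H0 H1. assert (0 <= c * d) by (apply Rmult_le_pos; lra).
    assert (c * d + d <= 1 / 4).
    { rewrite <- Hnd. replace (c * d + d) with ((c + 1) * d) by ring. apply Rmult_le_compat_r; lra. }
    set (s := c * d) in *.
    replace ((s + d) ^ 3 - s ^ 3) with (d * (3 * s ^ 2 + 3 * s * d + d ^ 2)) by ring.
    assert (3 * s ^ 2 + 3 * s * d + d ^ 2 <= 3 * (s + d) ^ 2) by nra.
    assert ((s + d) ^ 2 <= (1 / 4) ^ 2) by (apply pow_incr; lra).
    split; [apply Rmult_le_pos; nra|]. nra. }
  unfold cubic_increment.
  destruct (Nat.ltb_spec i n) as [H1|H1]; [lra|].
  apply le_INR in H1.
  destruct (Nat.ltb_spec i (2 * n)) as [H2|H2].
  { apply le_INR in H2. rewrite S_INR, mult_INR in H2. simpl INR in H2. apply Hcube; lra. }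
  apply le_INR in H2. rewrite mult_INR in H2. simpl INR in H2.
  destruct (Nat.ltb_spec i (3 * n)) as [H3|H3]; [|lra].
  apply le_INR in H3. rewrite S_INR, mult_INR in H3. simpl INR in H3. apply Hcube; lra.
Qed.

(** Inside a cubic piece this is the second difference [6 (s + d) d^2] of the cube, with
    [s + d <= 1 / 4]. At the transition points it is [d^3] in absolute value, since the cube
    vanishes there to third order, and at the midpoint it is 0 by symmetry. *)
Lemma cubic_increment_variation (n i : nat) (d : R) : (S i < 4 * n)%nat -> d = / (4 * INR n) ->
  Rabs (cubic_increment n (S i) d - cubic_increment n i d) <= 3 / 2 * d ^ 2.
Proof.
  intros Hi Hd.
  assert (Hn1 : 1 <= INR n) by (apply (le_INR 1); lia).
  assert (Hd0 : 0 < d) by (rewrite Hd; apply Rinv_0_lt_compat; lra).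
  assert (Hnd : INR n * d = 1 / 4) by (rewrite Hd; field; lra).
  assert (Hd2 : 0 < d ^ 2) by (apply pow_lt; lra).
  assert (Hd4 : d <= 1 / 4) by nra.
  assert (Hd3 : Rabs (d ^ 3) <= 3 / 2 * d ^ 2).
  { rewrite Rabs_pos_eq by (apply pow_le; lra). simpl. simpl in Hd2. nra. }
  assert (Hc : forall c, 0 <= c -> c + 1 <= INR n -> Rabs (6 * (c * d) * d ^ 2) <= 3 / 2 * d ^ 2).
  { intros c H0 H1. assert (0 <= c * d <= 1 / 4) by nra.
    rewrite Rabs_pos_eq; nra. }
  unfold cubic_increment.
  destruct (Nat.ltb_spec (S i) n); destruct (Nat.ltb_spec i n); try lia.
  { rewrite Rminus_0_r, Rabs_R0. lra. }
  { assert (E : S i = n) by lia.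
    destruct (Nat.ltb_spec (S i) (2 * n)); try lia.
    rewrite E. replace ((INR n - INR n) * d) with 0 by ring.
    replace ((0 + d) ^ 3 - 0 ^ 3 - 0) with (d ^ 3) by ring. exact Hd3. }
  rewrite S_INR.
  assert (Hin : INR n <= INR i) by (now apply le_INR).
  destruct (Nat.ltb_spec (S i) (2 * n)) as [H2|H2]; destruct (Nat.ltb_spec i (2 * n)) as [H3|H3]; try lia.
  { apply le_INR in H2. rewrite 2!S_INR, mult_INR in H2. simpl INR in H2.
    match goal with |- Rabs ?e <= _ =>
      replace e with (6 * ((INR i + 1 - INR n) * d) * d ^ 2) by ring end.
    apply Hc; lra. }
  { assert (E : INR i + 1 = 2 * INR n).
    { rewrite <- S_INR. replace (S i) with (2 * n)%nat by lia. rewrite mult_INR. reflexivity. }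
    destruct (Nat.ltb_spec (S i) (3 * n)); try lia.
    match goal with |- Rabs ?e <= _ => replace e with 0 end.
    - rewrite Rabs_R0; lra.
    - rewrite E. replace (INR i) with (2 * INR n - 1) by lra. ring. }
  assert (Hin2 : 2 * INR n <= INR i).
  { apply le_INR in H3. rewrite mult_INR in H3. exact H3. }
  destruct (Nat.ltb_spec (S i) (3 * n)) as [H4|H4]; destruct (Nat.ltb_spec i (3 * n)) as [H5|H5]; try lia.
  { apply le_INR in H4. rewrite 2!S_INR, mult_INR in H4. simpl INR in H4.
    match goal with |- Rabs ?e <= _ =>
      replace e with (- (6 * ((3 * INR n - 1 - INR i) * d) * d ^ 2)) by ring end.
    rewrite Rabs_Ropp. apply Hc; lra. }
  { assert (E : INR i = 3 * INR n - 1).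
    { assert (E : INR (S i) = INR (3 * n)) by (f_equal; lia). rewrite S_INR, mult_INR in E. simpl INR in E. lra. }
    match goal with |- Rabs ?e <= _ => replace e with (- d ^ 3) end.
    - now rewrite Rabs_Ropp.
    - rewrite E. ring. }
  { rewrite Rminus_0_r, Rabs_R0. lra. }
Qed.

Lemma INR_4 (n : nat) : INR (4 * n) = 4 * INR n.
Proof. rewrite mult_INR. simpl. ring. Qed.

Lemma mesh_div (m eps : R) (N i : nat) :
  mesh m eps N i = psi (lambda m eps N) (INR i * / INR N).
Proof. reflexivity. Qed.

Lemma step_formula (m eps : R) (n i : nat) : (i < 4 * n)%nat ->
  step m eps (4 * n) i = 4 * lambda m eps (4 * n) / INR (4 * n)
    + 32 * (1 - 4 * lambda m eps (4 * n)) * cubic_increment n i (/ INR (4 * n)).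
Proof.
  intros Hi. unfold step. rewrite !mesh_div, plus_INR. simpl (INR 1).
  rewrite (psi_step _ _ n i Hi); [reflexivity|]. now rewrite INR_4.
Qed.

Lemma lambda_bounds (m eps : R) (N : nat) : 0 < m -> 0 < eps -> (4 <= N)%nat ->
  0 < lambda m eps N <= 1 / 4.
Proof.
  intros Hm He HN. unfold lambda. split; [|apply Rmin_r].
  apply Rmin_glb_lt; [|lra]. apply le_INR in HN. simpl in HN.
  assert (0 < ln (INR N)) by (rewrite <- ln_1; apply ln_increasing; lra).
  apply Rdiv_lt_0_compat; [|now apply sqrt_lt_R0]. nra.
Qed.

(** The constant is [4 * lambda <= 1] from the linear part plus [32 * 3 / 16 = 6] from the cubic
    part. *)
Lemma step_bounds (m eps : R) (n i : nat) : 0 < m -> 0 < eps -> (i < 4 * n)%nat ->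
  0 < step m eps (4 * n) i <= 7 / INR (4 * n).
Proof.
  intros Hm He Hi. rewrite step_formula by auto.
  generalize (lambda_bounds m eps (4 * n) Hm He ltac:(lia)). intros Hl.
  generalize (cubic_increment_bounds n i (/ INR (4 * n)) Hi ltac:(now rewrite INR_4)). intros Hc.
  assert (Hd : 0 < / INR (4 * n)) by (apply Rinv_0_lt_compat, lt_0_INR; lia).
  unfold Rdiv. set (d := / INR (4 * n)) in *. set (l := lambda m eps (4 * n)) in *.
  assert (0 <= 32 * (1 - 4 * l) <= 32) by lra. nra.
Qed.

Lemma step_variation (m eps : R) (n i : nat) : 0 < m -> 0 < eps -> (S i < 4 * n)%nat ->
  Rabs (step m eps (4 * n) (S i) - step m eps (4 * n) i) <= 48 / INR (4 * n) ^ 2.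
Proof.
  intros Hm He Hi. rewrite !step_formula by lia.
  generalize (lambda_bounds m eps (4 * n) Hm He ltac:(lia)). intros Hl.
  generalize (cubic_increment_variation n i (/ INR (4 * n)) Hi ltac:(now rewrite INR_4)). intros Hc.
  set (l := lambda m eps (4 * n)) in *.
  match goal with |- Rabs ?e <= _ => replace e with
    (32 * (1 - 4 * l) * (cubic_increment n (S i) (/ INR (4 * n)) - cubic_increment n i (/ INR (4 * n)))) by ring end.
  rewrite Rabs_mult, Rabs_pos_eq by lra.
  rewrite pow_inv in Hc. unfold Rdiv in *.
  generalize (Rabs_pos (cubic_increment n (S i) (/ INR (4 * n)) - cubic_increment n i (/ INR (4 * n)))).
  nra.
Qed.

(** In the layers the cubic increment is 0; when [lambda = 1 / 4] its coefficient is 0 and the whole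
    mesh is uniform. *)
Lemma step_layer (m eps : R) (n i : nat) : (i < 4 * n)%nat ->
  (i < n \/ 3 * n <= i)%nat \/ lambda m eps (4 * n) = 1 / 4 ->
  step m eps (4 * n) i = 4 * lambda m eps (4 * n) / INR (4 * n).
Proof.
  intros Hi H. rewrite step_formula by auto.
  destruct H as [H|H]; [|rewrite H; field; apply not_0_INR; lia].
  unfold cubic_increment.
  destruct (Nat.ltb_spec i n); [ring|].
  destruct (Nat.ltb_spec i (2 * n)); [lia|].
  destruct (Nat.ltb_spec i (3 * n)); [lia|ring].
Qed.

Lemma mesh_0 (m eps : R) (N : nat) : mesh m eps N 0 = 0.
Proof. rewrite mesh_div. simpl. rewrite Rmult_0_l, psi_left_layer by lra. ring. Qed.

Lemma mesh_N (m eps : R) (N : nat) : (0 < N)%nat -> mesh m eps N N = 1.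
Proof.
  intros H. rewrite mesh_div, Rinv_r by (apply not_0_INR; lia).
  rewrite psi_right_layer by lra. ring.
Qed.

Lemma mesh_S (m eps : R) (N i : nat) : mesh m eps N (S i) = mesh m eps N i + step m eps N i.
Proof. unfold step. rewrite Nat.add_1_r. ring. Qed.

Lemma mesh_monotone (m eps : R) (n i j : nat) : 0 < m -> 0 < eps ->
  (i <= j)%nat -> (j <= 4 * n)%nat -> mesh m eps (4 * n) i <= mesh m eps (4 * n) j.
Proof.
  intros Hm He Hij. induction Hij as [|j Hij IH]; intros Hj; [lra|].
  rewrite mesh_S. generalize (step_bounds m eps n j Hm He ltac:(lia)) (IH ltac:(lia)). lra.
Qed.

Lemma mesh_in (m eps : R) (n i : nat) : 0 < m -> 0 < eps -> (i <= 4 * n)%nat -> (0 < n)%nat ->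
  0 <= mesh m eps (4 * n) i <= 1.
Proof.
  intros Hm He Hi Hn. split.
  - rewrite <- (mesh_0 m eps (4 * n)). apply mesh_monotone; auto; lia.
  - rewrite <- (mesh_N m eps (4 * n)) by lia. apply mesh_monotone; auto; lia.
Qed.

Lemma mesh_core (m eps : R) (n i : nat) : 0 < m -> 0 < eps -> (n <= i <= 3 * n)%nat -> (0 < n)%nat ->
  lambda m eps (4 * n) <= mesh m eps (4 * n) i <= 1 - lambda m eps (4 * n).
Proof.
  intros Hm He Hi Hn.
  assert (H1 : mesh m eps (4 * n) n = lambda m eps (4 * n)).
  { rewrite mesh_div, INR_4, psi_left_layer; [field|right; field]; apply not_0_INR; lia. }
  assert (H2 : mesh m eps (4 * n) (3 * n) = 1 - lambda m eps (4 * n)).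
  { rewrite mesh_div, INR_4, mult_INR. simpl (INR 3).
    rewrite psi_right_layer; [field|right; field]; apply not_0_INR; lia. }
  split.
  - rewrite <- H1. apply mesh_monotone; auto; lia.
  - rewrite <- H2. apply mesh_monotone; auto; lia.
Qed.

(* [exp (- sqrt m lambda / eps) = N^-2] at the transition point; one step
   [4 lambda / N] back from it costs at most the factor [e^8]. *)
Lemma exp_transition (m eps x : R) (N : nat) : 0 < m -> 0 < eps -> (4 <= N)%nat ->
  lambda m eps N <> 1 / 4 ->
  lambda m eps N - 4 * lambda m eps N / INR N <= x ->
  exp (- (sqrt m / eps * x)) <= exp 8 / INR N ^ 2.
Proof.
  intros Hm He HN Hl Hx.
  assert (HN4 := le_INR _ _ HN). simpl in HN4.
  assert (Hs := sqrt_lt_R0 m Hm).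
  assert (El : lambda m eps N = 2 * eps * ln (INR N) / sqrt m).
  { unfold lambda in *. unfold Rmin in *.
    destruct (Rle_dec (2 * eps * ln (INR N) / sqrt m) (1 / 4)); [easy|lra]. }
  assert (Hln : ln (INR N) <= INR N).
  { rewrite <- (ln_exp (INR N)) at 2. apply ln_le; [lra|].
    generalize (exp_ineq1_le (INR N)). lra. }
  assert (Hln0 : 0 < ln (INR N)) by (rewrite <- ln_1; apply ln_increasing; lra).
  replace (exp 8 / INR N ^ 2) with (exp (8 - 2 * ln (INR N))).
  - apply exp_le.
    apply Rmult_le_compat_l with (r := sqrt m / eps) in Hx; [|left; now apply Rdiv_lt_0_compat].
    rewrite El in Hx.
    replace (sqrt m / eps * (2 * eps * ln (INR N) / sqrt m -
      4 * (2 * eps * ln (INR N) / sqrt m) / INR N))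
      with (2 * ln (INR N) - 8 * (ln (INR N) / INR N)) in Hx by (field; lra).
    assert (ln (INR N) / INR N <= 1).
    { apply Rmult_le_reg_r with (INR N); [lra|]. unfold Rdiv.
      rewrite Rmult_assoc, Rinv_l; lra. }
    lra.
  - unfold Rminus, Rdiv. rewrite exp_plus. f_equal.
    rewrite exp_Ropp. f_equal.
    replace (2 * ln (INR N)) with (ln (INR N) + ln (INR N)) by ring.
    rewrite exp_plus, exp_ln; [ring|lra].
Qed.

Lemma layer_step_bound (m eps : R) (N : nat) : 0 < m -> 0 < eps -> (4 <= N)%nat ->
  4 * lambda m eps N / INR N <= 8 / sqrt m * eps * (ln (INR N) / INR N).
Proof.
  intros Hm He HN. assert (HN4 := le_INR _ _ HN). simpl in HN4.
  assert (Hs := sqrt_lt_R0 m Hm).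
  assert (lambda m eps N <= 2 * eps * ln (INR N) / sqrt m) by apply Rmin_l.
  replace (8 / sqrt m * eps * (ln (INR N) / INR N)) with
    (4 * (2 * eps * ln (INR N) / sqrt m) / INR N) by (field; lra).
  unfold Rdiv at 1 3. apply Rmult_le_compat_r; [left; apply Rinv_0_lt_compat|]; lra.
Qed.

(** The version for one cell, used for interpolation. A uniform mesh falls in the first case: then
    [1 / 4 <= 2 eps ln N / sqrt m], so [eps] is not small compared with [1 / ln N]. *)
Lemma step_dichotomy (m eps : R) (n i : nat) : 0 < m -> 0 < eps -> (i < 4 * n)%nat ->
  step m eps (4 * n) i <= 8 / sqrt m * eps * (ln (INR (4 * n)) / INR (4 * n)) \/
  exp (- (sqrt m / eps * mesh m eps (4 * n) i))
  + exp (- (sqrt m / eps * (1 - mesh m eps (4 * n) (S i)))) <= 2 * exp 8 / INR (4 * n) ^ 2.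
Proof.
  intros Hm He Hi.
  destruct (Req_dec (lambda m eps (4 * n)) (1 / 4)) as [El|El].
  { left. rewrite step_layer by auto. apply layer_step_bound; auto; lia. }
  destruct (Nat.lt_ge_cases i n) as [H1|H1].
  { left. rewrite step_layer by auto. apply layer_step_bound; auto; lia. }
  destruct (Nat.lt_ge_cases i (3 * n)) as [H2|H2].
  2:{ left. rewrite step_layer by auto. apply layer_step_bound; auto; lia. }
  right.
  generalize (lambda_bounds m eps (4 * n) Hm He ltac:(lia)). intros Hl.
  assert (0 <= 4 * lambda m eps (4 * n) / INR (4 * n)).
  { apply Rdiv_le_0_compat; [lra|]. apply lt_0_INR; lia. }
  assert (A1 := mesh_core m eps n i Hm He ltac:(lia) ltac:(lia)).
  assert (A2 := mesh_core m eps n (S i) Hm He ltac:(lia) ltac:(lia)).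
  generalize (exp_transition m eps (mesh m eps (4 * n) i) (4 * n) Hm He ltac:(lia) El ltac:(lra)).
  generalize (exp_transition m eps (1 - mesh m eps (4 * n) (S i)) (4 * n) Hm He ltac:(lia) El ltac:(lra)).
  lra.
Qed.

(** The version for a three-point stencil, used for the truncation error. The stencils centred at
    the transition points have unequal steps and belong to the second case, although they reach one
    step into a layer; [exp_transition] allows for that step. *)
Lemma node_dichotomy (m eps : R) (n i : nat) : 0 < m -> 0 < eps -> (S i < 4 * n)%nat ->
  (step m eps (4 * n) i = step m eps (4 * n) (S i) /\
   step m eps (4 * n) i <= 8 / sqrt m * eps * (ln (INR (4 * n)) / INR (4 * n))) \/
  exp (- (sqrt m / eps * mesh m eps (4 * n) i))
  + exp (- (sqrt m / eps * (1 - mesh m eps (4 * n) (S (S i))))) <= 2 * exp 8 / INR (4 * n) ^ 2.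
Proof.
  intros Hm He Hi.
  destruct (Req_dec (lambda m eps (4 * n)) (1 / 4)) as [El|El].
  { left. rewrite 2!step_layer by (auto; lia). split; [easy|]. apply layer_step_bound; auto; lia. }
  destruct (Nat.lt_ge_cases (S i) n) as [H1|H1].
  { left. rewrite 2!step_layer by lia. split; [easy|]. apply layer_step_bound; auto; lia. }
  destruct (Nat.le_gt_cases (S i) (3 * n)) as [H2|H2].
  2:{ left. rewrite 2!step_layer by lia. split; [easy|]. apply layer_step_bound; auto; lia. }
  right.
  generalize (lambda_bounds m eps (4 * n) Hm He ltac:(lia)). intros Hl.
  assert (0 <= 4 * lambda m eps (4 * n) / INR (4 * n)).
  { apply Rdiv_le_0_compat; [lra|]. apply lt_0_INR; lia. }
  assert (A1 : lambda m eps (4 * n) - 4 * lambda m eps (4 * n) / INR (4 * n) <= mesh m eps (4 * n) i).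
  { generalize (mesh_core m eps n (S i) Hm He ltac:(lia) ltac:(lia)). rewrite mesh_S. intros.
    destruct (Nat.lt_ge_cases i n) as [H3|H3].
    - rewrite <- (step_layer m eps n i) by lia. lra.
    - generalize (mesh_core m eps n i Hm He ltac:(lia) ltac:(lia)). lra. }
  assert (A2 : lambda m eps (4 * n) - 4 * lambda m eps (4 * n) / INR (4 * n)
               <= 1 - mesh m eps (4 * n) (S (S i))).
  { generalize (mesh_core m eps n (S i) Hm He ltac:(lia) ltac:(lia)). intros.
    destruct (Nat.le_gt_cases (3 * n) (S i)) as [H3|H3].
    - rewrite mesh_S, <- (step_layer m eps n (S i)) by lia. lra.
    - generalize (mesh_core m eps n (S (S i)) Hm He ltac:(lia) ltac:(lia)). lra. }
  generalize (exp_transition m eps _ (4 * n) Hm He ltac:(lia) El A1).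
  generalize (exp_transition m eps _ (4 * n) Hm He ltac:(lia) El A2).
  lra.
Qed.

(** * Consistency of the scheme *)

(* [T] at an interior node is [gamma / (th bl + th br)] times this, where
   [bl], [br] are [beta] times the adjacent steps and [g = f / gamma]. *)
Definition scheme (t bl br yl y0 yr gl g0 gr : R) : R :=
  diffusion_weight t bl * (yl - y0) - diffusion_weight t br * (y0 - yr)
  - ((1 - t) * gl + t * g0) * th bl - (t * g0 + (1 - t) * gr) * th br.

Lemma Rabs_le_mult (a b A B : R) : Rabs a <= A -> Rabs b <= B -> Rabs (a * b) <= A * B.
Proof. intros. rewrite Rabs_mult. apply Rmult_le_compat; auto using Rabs_pos. Qed.

Lemma Rabs_le_plus (a b A B : R) : Rabs a <= A -> Rabs b <= B -> Rabs (a + b) <= A + B.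
Proof. intros. eapply Rle_trans; [apply Rabs_triang|lra]. Qed.

Lemma Rabs_le_minus (a b A B : R) : Rabs a <= A -> Rabs b <= B -> Rabs (a - b) <= A + B.
Proof. intros. apply Rabs_le_plus; [easy|now rewrite Rabs_Ropp]. Qed.

Lemma th_ge_linear (B b : R) : 0 < b <= B -> b <= (2 + B) * th b.
Proof.
  intros Hb. generalize (th_lower b ltac:(lra)) (th_bounds b ltac:(lra)). intros H Ht.
  apply Rmult_le_compat_r with (r := 2 + b) in H; [|lra].
  replace (b / (2 + b) * (2 + b)) with b in H by (field; lra).
  apply Rle_trans with (1 := H). nra.
Qed.

(** Multiplication by [b] removes the singularity at 0 and leaves two smooth even functions of
    [b]. *)
Lemma scaled_weight (t b : R) : 0 < b ->
  b * diffusion_weight t b = (b / th b) / 2 + (1 / 2 - t) * (b * th b).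
Proof. intros H. generalize (th_bounds b H). intros. unfold diffusion_weight. field. lra. Qed.

Lemma scaled_weight_bound (t B b : R) : 0 <= t <= 1 -> 0 < b <= B ->
  Rabs (b * diffusion_weight t b) <= 1 + B.
Proof.
  intros Ht Hb. rewrite scaled_weight by lra.
  generalize (th_bounds b ltac:(lra)) (th_ge_linear B b Hb). intros H1 H2.
  assert (0 <= b / th b <= 2 + B).
  { split; [apply Rdiv_le_0_compat; lra|]. apply Rmult_le_reg_r with (th b); [lra|].
    replace (b / th b * th b) with b by (field; lra). exact H2. }
  assert (Rabs ((1 / 2 - t) * (b * th b)) <= 1 / 2 * B).
  { apply Rabs_le_mult; apply Rabs_le; nra. }
  apply Rle_trans with ((2 + B) / 2 + 1 / 2 * B); [|lra].
  apply Rabs_le_plus; [rewrite Rabs_pos_eq; lra|easy].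
Qed.

(** The function [b * th b] is quadratic at 0, so its Lipschitz constant near 0 is of order [b],
    hence of order [th bl + th br]. *)
Lemma b_th_lipschitz (B bl br : R) : 0 < bl <= B -> 0 < br <= B ->
  Rabs (br * th br - bl * th bl) <= (2 + B) * (th bl + th br) * Rabs (bl - br).
Proof.
  intros Hl Hr.
  generalize (th_bounds bl ltac:(lra)) (th_bounds br ltac:(lra))
    (th_ge_linear B bl Hl) (th_lipschitz bl br ltac:(lra) ltac:(lra)).
  intros Al Ar Gl Hlip.
  replace (br * th br - bl * th bl) with (- ((bl - br) * th br) - bl * (th bl - th br)) by ring.
  set (D := Rabs (bl - br)) in *.
  apply Rle_trans with (D * th br + (2 + B) * th bl * (D / 2)).
  - apply Rabs_le_minus.
    + rewrite Rabs_Ropp. apply Rabs_le_mult; [unfold D; lra|rewrite Rabs_pos_eq; lra].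
    + apply Rabs_le_mult; [rewrite Rabs_pos_eq; lra|easy].
  - assert (HD : 0 <= D) by apply Rabs_pos.
    assert (H1 : 0 <= D * th br) by (apply Rmult_le_pos; lra).
    assert (H2 : 0 <= D * th bl) by (apply Rmult_le_pos; lra).
    assert (H3 : 0 <= B * (D * th br)) by (apply Rmult_le_pos; lra).
    assert (H4 : 0 <= B * (D * th bl)) by (apply Rmult_le_pos; lra).
    lra.
Qed.

(** Both parts of the scaled weight have zero derivative at 0, which again yields the factor
    [th bl + th br]. *)
Lemma scaled_weight_lipschitz (t B bl br : R) : 0 <= t <= 1 -> 0 < bl <= B -> 0 < br <= B ->
  Rabs (br * diffusion_weight t br - bl * diffusion_weight t bl)
  <= (2 + B) * ((2 + B) ^ 2 + 36) / 24 * (th bl + th br) * Rabs (bl - br).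
Proof.
  intros Ht Hl Hr. rewrite !scaled_weight by lra.
  generalize (th_bounds bl ltac:(lra)) (th_bounds br ltac:(lra))
    (th_ge_linear B bl Hl) (th_ge_linear B br Hr) (ratio_th_lipschitz B br bl Hr Hl)
    (b_th_lipschitz B bl br Hl Hr).
  intros Al Ar Gl Gr H1 H2. rewrite (Rabs_minus_sym br bl) in H1.
  generalize (Rabs_pos (bl - br)). set (D := Rabs (bl - br)) in *. intros HD.
  assert (Hmax : Rmax br bl <= (2 + B) * (th bl + th br)).
  { apply Rmax_lub; nra. }
  replace (br / th br / 2 + (1 / 2 - t) * (br * th br) - (bl / th bl / 2 + (1 / 2 - t) * (bl * th bl)))
    with ((/ 2) * (br / th br - bl / th bl) + (1 / 2 - t) * (br * th br - bl * th bl)) by (field; lra).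
  apply Rle_trans with (/ 2 * (((2 + B) ^ 2 + 12) / 24 * ((2 + B) * (th bl + th br)) * D)
    + 1 / 2 * ((2 + B) * (th bl + th br) * D)).
  - apply Rabs_le_plus.
    + apply Rabs_le_mult; [rewrite Rabs_pos_eq; lra|].
      apply Rle_trans with (1 := H1). apply Rmult_le_compat_r; [easy|].
      apply Rmult_le_compat_l; [|easy]. generalize (pow2_ge_0 (2 + B)). lra.
    + apply Rabs_le_mult; [apply Rabs_le; lra|easy].
  - set (W := (2 + B) * (th bl + th br) * D).
    assert (HW : 0 <= W) by (unfold W; apply Rmult_le_pos; [apply Rmult_le_pos; lra|lra]).
    replace ((2 + B) * ((2 + B) ^ 2 + 36) / 24 * (th bl + th br) * D)
      with (((2 + B) ^ 2 + 36) / 24 * W) by (unfold W; field).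
    replace (((2 + B) ^ 2 + 12) / 24 * ((2 + B) * (th bl + th br)) * D)
      with (((2 + B) ^ 2 + 12) / 24 * W) by (unfold W; field).
    assert (0 <= (2 + B) ^ 2 * W) by (apply Rmult_le_pos; [apply pow2_ge_0|easy]).
    lra.
Qed.

(** Half of this difference is the mismatch between the coefficient of [y''] from one side of the
    stencil and the weight of [f] there. It equals [(b^2 - 4 th^2) / (2 th) + (1/2 - t) th b^2], and
    [th_cubic] controls the factor [b - 2 th]. *)
Lemma second_order_consistency (t B b : R) : 0 <= t <= 1 -> 0 < b <= B ->
  Rabs (b * diffusion_weight t b * b - 2 * th b) <= ((2 + B) ^ 2 + 6) / 12 * th b * b ^ 2.
Proof.
  intros Ht Hb. rewrite scaled_weight by lra.
  generalize (th_bounds b ltac:(lra)) (th_ge_linear B b Hb) (th_cubic b ltac:(lra)). intros H1 H2 H3.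
  set (A := th b) in *.
  replace ((b / A / 2 + (1 / 2 - t) * (b * A)) * b - 2 * A)
    with ((b - 2 * A) * ((b + 2 * A) / (2 * A)) + (1 / 2 - t) * (A * b ^ 2)) by (field; lra).
  assert (Hq : 0 <= (b + 2 * A) / (2 * A) <= b / A).
  { split; [apply Rdiv_le_0_compat; lra|].
    apply Rmult_le_reg_r with (2 * A); [lra|].
    replace ((b + 2 * A) / (2 * A) * (2 * A)) with (b + 2 * A) by (field; lra).
    replace (b / A * (2 * A)) with (2 * b) by (field; lra). lra. }
  assert (Hb2 : b * b <= (2 + B) ^ 2 * (A * A)).
  { replace ((2 + B) ^ 2 * (A * A)) with (((2 + B) * A) * ((2 + B) * A)) by ring.
    apply Rmult_le_compat; lra. }
  assert (Hp : 0 <= A * b ^ 2) by (apply Rmult_le_pos; [lra|apply pow2_ge_0]).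
  apply Rle_trans with (b ^ 3 / 12 * (b / A) + 1 / 2 * (A * b ^ 2)).
  - apply Rabs_le_plus.
    + apply Rabs_le_mult; rewrite Rabs_pos_eq; lra.
    + apply Rabs_le_mult; [apply Rabs_le; lra|rewrite Rabs_pos_eq; lra].
  - assert (b ^ 3 / 12 * (b / A) <= (2 + B) ^ 2 / 12 * (A * b ^ 2)); [|lra].
    apply Rmult_le_reg_r with A; [lra|].
    replace (b ^ 3 / 12 * (b / A) * A) with (b ^ 2 / 12 * (b * b)) by (field; lra).
    replace ((2 + B) ^ 2 / 12 * (A * b ^ 2) * A) with (b ^ 2 / 12 * ((2 + B) ^ 2 * (A * A))) by field.
    apply Rmult_le_compat_l; [|easy]. generalize (pow2_ge_0 b). lra.
Qed.

(** In the variable [beta x] the equation is [y'' = g] with [g = f / gamma], so [Y2] is at once the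
    second derivative of [y] and the value of [g], and [Y3], [Y4] serve the expansions of both. [B]
    bounds the ratio of the steps to [eps], up to a constant. *)
Lemma scheme_fine (B : R) : 0 < B -> exists C, 0 < C /\
  forall t bl br yl y0 yr gl gr Y1 Y2 Y3 Y4,
    0 <= t <= 1 -> 0 < bl <= B -> 0 < br <= B -> 0 <= Y4 ->
    Rabs (yl - (y0 - bl * Y1 + bl ^ 2 / 2 * Y2 - bl ^ 3 / 6 * Y3)) <= Y4 * bl ^ 4 / 24 ->
    Rabs (yr - (y0 + br * Y1 + br ^ 2 / 2 * Y2 + br ^ 3 / 6 * Y3)) <= Y4 * br ^ 4 / 24 ->
    Rabs (gl - (Y2 - bl * Y3)) <= Y4 * bl ^ 2 / 2 ->
    Rabs (gr - (Y2 + br * Y3)) <= Y4 * br ^ 2 / 2 ->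
    Rabs (scheme t bl br yl y0 yr gl Y2 gr)
    <= C * (th bl + th br) *
       (Rabs (bl - br) * (Rabs Y1 + Rabs Y3) + (bl ^ 2 + br ^ 2) * (Rabs Y2 + Y4)).
Proof.
  intros HB.
  pose (c2 := (2 + B) * ((2 + B) ^ 2 + 36) / 24).
  pose (c3 := ((2 + B) ^ 2 + 6) / 12).
  assert (Hsq := pow2_ge_0 (2 + B)).
  assert (Hc2 : 0 <= c2).
  { unfold c2. apply Rmult_le_pos; [|lra]. apply Rmult_le_pos; lra. }
  assert (Hc3 : 0 <= c3) by (unfold c3; lra).
  assert (HBB : 0 <= c2 * B ^ 2) by (apply Rmult_le_pos; [easy|apply pow2_ge_0]).
  pose (c4 := (1 + B) * (2 + B)). assert (Hc4 : 0 <= c4) by (apply Rmult_le_pos; lra).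
  exists (c2 + c3 + c4 + c2 * B ^ 2 + (2 + B) + 1). split; [lra|].
  intros t bl br yl y0 yr gl gr Y1 Y2 Y3 Y4 Ht Hl Hr HY4 El Er Fl Fr.
  generalize (th_bounds bl ltac:(lra)) (th_bounds br ltac:(lra)). intros Al Ar.
  generalize (th_ge_linear B bl Hl) (th_ge_linear B br Hr). intros Gl Gr.
  assert (L1 := scaled_weight_lipschitz t B bl br Ht Hl Hr). fold c2 in L1.
  assert (L2 := b_th_lipschitz B bl br Hl Hr).
  assert (S1 := second_order_consistency t B bl Ht Hl).
  assert (S2 := second_order_consistency t B br Ht Hr). fold c3 in S1, S2.
  assert (D1 := scaled_weight_bound t B bl Ht Hl).
  assert (D2 := scaled_weight_bound t B br Ht Hr).
  set (dl := bl * diffusion_weight t bl) in *. set (dr := br * diffusion_weight t br) in *.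
  set (W := th bl + th br) in *. set (D := Rabs (bl - br)) in *.
  assert (HD : 0 <= D) by apply Rabs_pos.
  assert (HW : 0 < W) by (unfold W; lra).
  set (el := yl - (y0 - bl * Y1 + bl ^ 2 / 2 * Y2 - bl ^ 3 / 6 * Y3)) in *.
  set (er := yr - (y0 + br * Y1 + br ^ 2 / 2 * Y2 + br ^ 3 / 6 * Y3)) in *.
  set (fl := gl - (Y2 - bl * Y3)) in *. set (fr := gr - (Y2 + br * Y3)) in *.
  (* The expansion sorted by derivatives: the coefficients of [Y1] and [Y3] are differences between
     the two sides, which vanish for equal steps; that of [Y2] is the consistency defect; the rest
     are Taylor remainders. *)
  replace (scheme t bl br yl y0 yr gl Y2 gr) with
    ((dr - dl) * Y1 + / 2 * ((dl * bl - 2 * th bl) + (dr * br - 2 * th br)) * Y2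
     + / 6 * (dr * (br ^ 2 - bl ^ 2) + (dr - dl) * bl ^ 2) * Y3
     - (1 - t) * (br * th br - bl * th bl) * Y3
     + (dl * (el / bl) + dr * (er / br)) - (1 - t) * (fl * th bl + fr * th br)).
  2:{ unfold scheme, dl, dr, el, er, fl, fr. field. lra. }
  assert (Hbb : bl + br <= (2 + B) * W) by (unfold W; lra).
  assert (Q1 : Rabs ((dr - dl) * Y1) <= c2 * W * D * Rabs Y1).
  { apply Rabs_le_mult; lra. }
  assert (Q2 : Rabs (/ 2 * ((dl * bl - 2 * th bl) + (dr * br - 2 * th br)) * Y2)
    <= / 2 * (c3 * W * (bl ^ 2 + br ^ 2)) * Rabs Y2).
  { apply Rabs_le_mult; [|lra]. apply Rabs_le_mult; [rewrite Rabs_pos_eq; lra|].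
    apply Rle_trans with (c3 * th bl * bl ^ 2 + c3 * th br * br ^ 2).
    - apply Rabs_le_plus; lra.
    - assert (c3 * th bl * bl ^ 2 <= c3 * W * bl ^ 2).
      { apply Rmult_le_compat_r; [apply pow2_ge_0|]. apply Rmult_le_compat_l; unfold W; lra. }
      assert (c3 * th br * br ^ 2 <= c3 * W * br ^ 2).
      { apply Rmult_le_compat_r; [apply pow2_ge_0|]. apply Rmult_le_compat_l; unfold W; lra. }
      lra. }
  assert (Q3 : Rabs (/ 6 * (dr * (br ^ 2 - bl ^ 2) + (dr - dl) * bl ^ 2) * Y3)
    <= / 6 * (c4 * W * D + c2 * W * D * B ^ 2) * Rabs Y3).
  { apply Rabs_le_mult; [|lra]. apply Rabs_le_mult; [rewrite Rabs_pos_eq; lra|].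
    apply Rabs_le_plus.
    - apply Rle_trans with ((1 + B) * (D * ((2 + B) * W))); [|unfold c4; lra].
      apply Rabs_le_mult; [lra|].
      replace (br ^ 2 - bl ^ 2) with (- (bl - br) * (bl + br)) by ring.
      apply Rabs_le_mult; [rewrite Rabs_Ropp; unfold D; lra|rewrite Rabs_pos_eq; lra].
    - apply Rabs_le_mult; [lra|]. rewrite Rabs_pos_eq by (apply pow2_ge_0). apply pow_incr; lra. }
  assert (Q4 : Rabs ((1 - t) * (br * th br - bl * th bl) * Y3) <= 1 * ((2 + B) * W * D) * Rabs Y3).
  { apply Rabs_le_mult; [|lra]. apply Rabs_le_mult; [apply Rabs_le; lra|lra]. }
  assert (Q5 : forall d b e, 0 < b <= B -> b <= (2 + B) * W -> Rabs d <= 1 + B ->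
    Rabs e <= Y4 * b ^ 4 / 24 -> Rabs (d * (e / b)) <= c4 * W * (b ^ 2 * Y4) / 24).
  { intros d b e Hb HbW Hd He.
    apply Rle_trans with ((1 + B) * ((Y4 * b ^ 4 / 24) * / b)).
    - apply Rabs_le_mult; [easy|]. apply Rabs_le_mult; [easy|].
      rewrite Rabs_pos_eq; [lra|]. left; apply Rinv_0_lt_compat; lra.
    - replace ((1 + B) * (Y4 * b ^ 4 / 24 * / b)) with ((1 + B) * (b ^ 2 * Y4) / 24 * b) by (field; lra).
      replace (c4 * W * (b ^ 2 * Y4) / 24) with ((1 + B) * (b ^ 2 * Y4) / 24 * ((2 + B) * W))
        by (unfold c4; field).
      apply Rmult_le_compat_l; [|easy].
      assert (0 <= (1 + B) * (b ^ 2 * Y4)); [|lra].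
      apply Rmult_le_pos; [lra|]. apply Rmult_le_pos; [apply pow2_ge_0|easy]. }
  assert (Q5' : Rabs (dl * (el / bl) + dr * (er / br))
     <= c4 * W * (bl ^ 2 * Y4) / 24 + c4 * W * (br ^ 2 * Y4) / 24).
  { apply Rabs_le_plus; apply Q5; auto; lra. }
  assert (Q6 : Rabs ((1 - t) * (fl * th bl + fr * th br))
     <= 1 * (Y4 * bl ^ 2 / 2 * W + Y4 * br ^ 2 / 2 * W)).
  { apply Rabs_le_mult; [apply Rabs_le; lra|].
    apply Rabs_le_plus; apply Rabs_le_mult; auto; rewrite Rabs_pos_eq; unfold W; lra. }
  eapply Rle_trans.
  { apply Rabs_le_minus; [|exact Q6]. apply Rabs_le_plus; [|exact Q5'].
    apply Rabs_le_minus; [|exact Q4]. apply Rabs_le_plus; [|exact Q3].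
    apply Rabs_le_plus; [exact Q1|exact Q2]. }
  (* In terms of these four nonnegative products the remaining inequality is linear. *)
  set (p1 := W * D * Rabs Y1). set (p3 := W * D * Rabs Y3).
  set (p2 := W * (bl ^ 2 + br ^ 2) * Rabs Y2). set (p4 := W * (bl ^ 2 + br ^ 2) * Y4).
  assert (Hs : 0 <= bl ^ 2 + br ^ 2) by (generalize (pow2_ge_0 bl) (pow2_ge_0 br); lra).
  assert (Hp1 : 0 <= p1) by (unfold p1; repeat apply Rmult_le_pos; auto using Rabs_pos; lra).
  assert (Hp3 : 0 <= p3) by (unfold p3; repeat apply Rmult_le_pos; auto using Rabs_pos; lra).
  assert (Hp2 : 0 <= p2) by (unfold p2; repeat apply Rmult_le_pos; auto using Rabs_pos; lra).
  assert (Hp4 : 0 <= p4) by (unfold p4; repeat apply Rmult_le_pos; auto using Rabs_pos; lra).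
  match goal with |- ?L <= _ => replace L with
    (c2 * p1 + c3 / 2 * p2 + (c4 + c2 * B ^ 2) / 6 * p3 + (2 + B) * p3 + c4 / 24 * p4 + / 2 * p4)
    by (unfold p1, p2, p3, p4; field) end.
  match goal with |- _ <= ?L => replace L with
    ((c2 + c3 + c4 + c2 * B ^ 2 + (2 + B) + 1) * (p1 + p2 + p3 + p4))
    by (unfold p1, p2, p3, p4; ring) end.
  assert (P : forall c p, 0 <= c -> 0 <= p -> 0 <= c * p) by (intros; now apply Rmult_le_pos).
  assert (H2B : 0 <= 2 + B) by lra.
  generalize (P _ _ Hc2 Hp1) (P _ _ Hc2 Hp2) (P _ _ Hc2 Hp3) (P _ _ Hc2 Hp4)
    (P _ _ Hc3 Hp1) (P _ _ Hc3 Hp2) (P _ _ Hc3 Hp3) (P _ _ Hc3 Hp4)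
    (P _ _ Hc4 Hp1) (P _ _ Hc4 Hp2) (P _ _ Hc4 Hp3) (P _ _ Hc4 Hp4)
    (P _ _ HBB Hp1) (P _ _ HBB Hp2) (P _ _ HBB Hp3) (P _ _ HBB Hp4)
    (P _ _ H2B Hp1) (P _ _ H2B Hp2) (P _ _ H2B Hp3) (P _ _ H2B Hp4).
  intros. lra.
Qed.

(** The Taylor remainder of [u] is at most that of a function whose second derivative dominates.
    With a layer function in [g], integrating twice gains back the factor [1 / eps^2] that a
    supremum of [y''] would cost. *)
Lemma taylor_majorant_right (u u1 u2 g g1 g2 : R -> R) (h : R) :
  0 <= h ->
  (forall s, 0 <= s <= h -> continuous u s) ->
  (forall s, 0 <= s < h -> is_derive u s (u1 s)) ->
  (forall s, 0 <= s < h -> is_derive u1 s (u2 s)) ->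
  (forall s, is_derive g s (g1 s)) ->
  (forall s, is_derive g1 s (g2 s)) ->
  (forall s, 0 < s < h -> Rabs (u2 s) <= g2 s) ->
  Rabs (u h - (u 0 + h * u1 0)) <= g h - (g 0 + h * g1 0).
Proof.
  intros Hh Hc H1 H2 G1 G2 HM.
  assert (E1 : forall s, 0 < s < h -> Rabs (u1 s - u1 0) <= g1 s - g1 0).
  { intros s Hs. apply (mean_value_bound u1 u2 g1 g2); try lra.
    - intros r Hr. apply is_derive_continuous with (u2 r), H2; lra.
    - intros r Hr. apply is_derive_continuous with (g2 r), G2.
    - intros r Hr. apply H2; lra.
    - intros r Hr. apply G2.
    - intros r Hr. apply HM; lra. }
  apply (integrate_bound u u1 (fun s => u 0 + s * u1 0) (fun s => u1 0)
           (fun s => g s - (g 0 + s * g1 0)) (fun s => g1 s - g1 0)); try lra; auto.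
  - intros; apply H1; lra.
  - derive_poly.
  - intros s. apply is_derive_minus_R; [apply G1|]. auto_derive; [easy|ring].
Qed.

Lemma taylor_majorant (u u1 u2 g g1 g2 : R -> R) (a b x h sg : R) :
  (forall s, continuous u s) ->
  (forall s, a < s < b -> is_derive u s (u1 s)) ->
  (forall s, a < s < b -> is_derive u1 s (u2 s)) ->
  (forall s, is_derive g s (g1 s)) ->
  (forall s, is_derive g1 s (g2 s)) ->
  (forall s, a < s < b -> Rabs (u2 s) <= g2 s) ->
  sg = 1 \/ sg = -1 ->
  a < x < b -> 0 <= h -> a <= x + sg * h <= b ->
  Rabs (u (x + sg * h) - (u x + sg * h * u1 x)) <= g (x + sg * h) - (g x + sg * h * g1 x).
Proof.
  intros Hc H1 H2 G1 G2 HM Hsg Hx Hh Hxh.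
  assert (Hin : forall s, 0 <= s < h -> a < x + sg * s < b) by (intros; destruct Hsg; subst; lra).
  assert (Hsq : forall z, sg * (sg * z) = z) by (destruct Hsg; intros; subst; ring).
  generalize (taylor_majorant_right (fun s => u (x + sg * s)) (fun s => sg * u1 (x + sg * s))
    (fun s => sg * (sg * u2 (x + sg * s)))
    (fun s => g (x + sg * s)) (fun s => sg * g1 (x + sg * s))
    (fun s => sg * (sg * g2 (x + sg * s))) h Hh).
  cbv beta. rewrite !Rmult_0_r, !Rplus_0_r. intros Ht.
  replace (sg * h * u1 x) with (h * (sg * u1 x)) by ring.
  replace (sg * h * g1 x) with (h * (sg * g1 x)) by ring.
  apply Ht.
  - intros s Hs. now apply continuous_affine_comp.
  - intros s Hs. now apply is_derive_affine_comp, H1, Hin.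
  - intros s Hs. apply is_derive_scal. now apply is_derive_affine_comp, H2, Hin.
  - intros s. now apply is_derive_affine_comp, G1.
  - intros s. apply is_derive_scal. now apply is_derive_affine_comp, G2.
  - intros s Hs. rewrite !Hsq. apply HM, Hin; lra.
Qed.

Lemma layer_le (r a b s : R) : 0 <= r -> a <= s <= b ->
  layer r s <= exp (- (r * a)) + exp (- (r * (1 - b))).
Proof.
  intros Hr Hs. unfold layer. apply Rplus_le_compat; apply exp_le, Ropp_le_contravar;
  apply Rmult_le_compat_l; lra.
Qed.

(** * Truncation error *)

(** Truncation error without the prefactor [gamma / (th bl + th br)]; this is why the final
    estimates carry that sum on the right. *)
Definition residual (f : R -> R -> R) (gamma t eps : R) (y : R -> R) (x hl hr : R) : R :=
  scheme t (sqrt gamma / eps * hl) (sqrt gamma / eps * hr) (y (x - hl)) (y x) (y (x + hr))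
    (f (x - hl) (y (x - hl)) / gamma) (f x (y x) / gamma) (f (x + hr) (y (x + hr)) / gamma).

(** Majorant of the layer function on [[a,b]], with each exponential taken at the end nearest to its
    own layer. *)
Definition end_layer (r a b : R) : R := exp (- (r * a)) + exp (- (r * (1 - b))).

Lemma end_layer_pos (r a b : R) : 0 < end_layer r a b.
Proof. unfold end_layer. generalize (exp_pos (- (r * a))) (exp_pos (- (r * (1 - b)))). lra. Qed.

Lemma rate_nonneg (m eps : R) : 0 < eps -> 0 <= sqrt m / eps.
Proof. intros. apply Rdiv_le_0_compat; [apply sqrt_pos|easy]. Qed.

Lemma one_plus_div_mono (c Q Z e : R) : 0 <= c -> 0 < e -> Z <= Q -> c * (1 + Z / e) <= c * (1 + Q / e).
Proof.
  intros. apply Rmult_le_compat_l; [easy|]. apply Rplus_le_compat_l, Rmult_le_compat_r; [|easy].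
  left. now apply Rinv_0_lt_compat.
Qed.

Lemma truncation_fine (f fx fy fxx fxy fyx fyy : R -> R -> R) (m gamma C0 K : R) :
  0 < m -> 0 < gamma -> 0 < C0 -> 0 < K ->
  C2_strip f fx fy fxx fxy fyx fyy ->
  exists C, 0 < C /\ forall t eps y dy x hl hr,
    0 <= t <= 1 -> 0 < eps < 1 ->
    classical_solution f eps y dy ->
    layer_bounds f fx fy fxx fxy fyx fyy y dy (sqrt m / eps) C0 eps ->
    0 < x < 1 -> 0 < hl <= K * eps -> 0 < hr <= K * eps -> 0 <= x - hl -> x + hr <= 1 ->
    let Q := end_layer (sqrt m / eps) (x - hl) (x + hr) in
    Rabs (residual f gamma t eps y x hl hr)
    <= C * (th (sqrt gamma / eps * hl) + th (sqrt gamma / eps * hr)) *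
       (Rabs (hl - hr) * (1 + Q / eps) + (hl ^ 2 + hr ^ 2) * (1 + Q / eps ^ 2)).
Proof.
  intros Hm Hg HC0 HK Hf.
  assert (Hsqrt := sqrt_lt_R0 gamma Hg).
  destruct (scheme_fine (sqrt gamma * K)) as [C1 [HC1 Hfine]].
  { now apply Rmult_lt_0_compat. }
  exists (C1 * (C0 + C0 / gamma)).
  assert (HCg : 0 < C0 / gamma) by (now apply Rdiv_lt_0_compat).
  split; [apply Rmult_lt_0_compat; lra|].
  intros t eps y dy x hl hr Ht He Hsol Hlb Hx Hhl Hhr Hxl Hxr Q.
  assert (Hd2 := fun s => is_derive_composite_deriv f fx fy fxx fxy fyx fyy eps y dy s Hf Hsol).
  assert (Hsol' := Hsol). destruct Hsol' as [Hc _ _ Hd Heq].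
  destruct Hlb as [L1 L2 L3 L4].
  set (r := sqrt m / eps) in *.
  assert (Hr : 0 <= r) by (apply rate_nonneg; lra).
  assert (He2 : 0 < eps ^ 2) by (apply pow_lt; lra).
  assert (HQ : 0 < Q) by apply end_layer_pos.
  assert (HLQ : forall s, x - hl <= s <= x + hr -> layer r s <= Q) by (intros; now apply layer_le).
  set (F := fun s => f s (y s)).
  set (F1 := composite_deriv fx fy y dy) in *.
  set (F2 := fun s => composite_quadratic fxx fxy fyx fyy y dy s + fy s (y s) * (f s (y s) / eps ^ 2)).
  assert (HFc : forall s, continuous F s).
  { intros s. apply (C1_comp_continuous f y s); [apply (C1_cont _ _ _ (C2_f _ _ _ _ _ _ _ Hf))|apply Hc]. }
  assert (HF1 : forall s, 0 < s < 1 -> is_derive F s (F1 s)).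
  { intros s Hs. apply (C1_chain f fx fy); auto. apply Hf. }
  assert (HF2 : forall s, 0 < s < 1 -> is_derive F1 s (F2 s)) by (intros; now apply Hd2).
  assert (Hscal : forall u s l, is_derive u s l -> is_derive (fun s => u s / eps ^ 2) s (l / eps ^ 2)).
  { intros u s l Hu. exact (is_derive_scal_l u s l (/ eps ^ 2) Hu). }
  pose (M := C0 * (1 + Q / eps ^ 2)).
  assert (HM : 0 < M).
  { apply Rmult_lt_0_compat; [easy|]. generalize (Rdiv_lt_0_compat Q _ HQ He2). lra. }
  assert (HF2M : forall s, 0 < s < 1 -> x - hl <= s <= x + hr -> Rabs (F2 s) <= M).
  { intros s Hs Hs'. apply Rle_trans with (1 := L4 s Hs).
    apply one_plus_div_mono; try lra. now apply HLQ. }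
  assert (T4 : forall sg h, sg = 1 \/ sg = -1 -> 0 <= h -> x - hl <= x + sg * h <= x + hr ->
    Rabs (y (x + sg * h) - (y x + sg * h * dy x + h ^ 2 / 2 * (F x / eps ^ 2)
      + sg * h ^ 3 / 6 * (F1 x / eps ^ 2))) <= M / eps ^ 2 * h ^ 4 / 24).
  { intros sg h Hsg Hh Hin.
    apply (taylor4 y dy (fun s => F s / eps ^ 2) (fun s => F1 s / eps ^ 2)
      (fun s => F2 s / eps ^ 2) 0 1 x h sg (M / eps ^ 2)); auto; try lra.
    intros s Hs. unfold Rdiv. rewrite Rabs_mult, (Rabs_pos_eq (/ eps ^ 2)) by (left; now apply Rinv_0_lt_compat).
    apply Rmult_le_compat_r; [left; now apply Rinv_0_lt_compat|].
    apply HF2M; destruct Hsg; subst; lra. }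
  assert (T2 : forall sg h, sg = 1 \/ sg = -1 -> 0 <= h -> x - hl <= x + sg * h <= x + hr ->
    Rabs (F (x + sg * h) - (F x + sg * h * F1 x)) <= M * h ^ 2 / 2).
  { intros sg h Hsg Hh Hin.
    apply (taylor2 F F1 F2 0 1 x h sg M); auto; try lra.
    intros s Hs. apply HF2M; destruct Hsg; subst; lra. }
  set (w := sqrt gamma) in *.
  assert (Egw : gamma = w ^ 2) by (unfold w; rewrite pow2_sqrt; lra).
  assert (Hw2 : 0 < w ^ 2) by (apply pow_lt; lra).
  pose (b := w / eps). assert (Hb : 0 < b) by (apply Rdiv_lt_0_compat; lra).
  assert (HbB : forall h, 0 < h <= K * eps -> 0 < b * h <= w * K).
  { intros h Hh. split; [apply Rmult_lt_0_compat; lra|].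
    replace (w * K) with (b * (K * eps)) by (unfold b; field; lra).
    apply Rmult_le_compat_l; lra. }
  unfold residual. fold w b.
  (* The derivatives of [y] divided by powers of [b = beta], using [b^2 = gamma / eps^2]. For
     instance [Y4] is [(M / eps^2) / b^4], and [Y4 * b^2 = M / gamma] makes it fit the expansion of
     [f / gamma] too. *)
  set (Y1 := dy x / b). set (Y2 := f x (y x) / gamma). set (Y3 := F1 x / (gamma * b)).
  set (Y4 := M * eps ^ 2 / gamma ^ 2).
  assert (HY4 : 0 < Y4).
  { unfold Y4. apply Rdiv_lt_0_compat; [now apply Rmult_lt_0_compat|now apply pow_lt]. }
  assert (Hscheme : Rabs (scheme t (b * hl) (b * hr) (y (x - hl)) (y x) (y (x + hr))
    (f (x - hl) (y (x - hl)) / gamma) Y2 (f (x + hr) (y (x + hr)) / gamma))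
    <= C1 * (th (b * hl) + th (b * hr)) *
       (Rabs (b * hl - b * hr) * (Rabs Y1 + Rabs Y3) + ((b * hl) ^ 2 + (b * hr) ^ 2) * (Rabs Y2 + Y4))).
  { apply (Hfine t (b * hl) (b * hr) (y (x - hl)) (y x) (y (x + hr))
      (f (x - hl) (y (x - hl)) / gamma) (f (x + hr) (y (x + hr)) / gamma) Y1 Y2 Y3 Y4); auto.
    - lra.
    - generalize (T4 (-1) hl (or_intror eq_refl) ltac:(lra) ltac:(lra)).
      replace (x + -1 * hl) with (x - hl) by ring. intros H.
      match type of H with Rabs ?e <= ?g => match goal with |- Rabs ?e' <= ?g' =>
        replace e' with e; [replace g' with g; [exact H|]|] end end.
      + unfold Y4, b. rewrite Egw. field. lra.
      + unfold Y1, Y2, Y3, b, F. rewrite Egw. field. lra.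
    - generalize (T4 1 hr (or_introl eq_refl) ltac:(lra) ltac:(lra)).
      replace (x + 1 * hr) with (x + hr) by ring. intros H.
      match type of H with Rabs ?e <= ?g => match goal with |- Rabs ?e' <= ?g' =>
        replace e' with e; [replace g' with g; [exact H|]|] end end.
      + unfold Y4, b. rewrite Egw. field. lra.
      + unfold Y1, Y2, Y3, b, F. rewrite Egw. field. lra.
    - generalize (T2 (-1) hl (or_intror eq_refl) ltac:(lra) ltac:(lra)).
      replace (x + -1 * hl) with (x - hl) by ring. intros H.
      apply Rmult_le_compat_r with (r := / gamma) in H; [|left; now apply Rinv_0_lt_compat].
      rewrite <- (Rabs_pos_eq (/ gamma)) in H at 1 by (left; now apply Rinv_0_lt_compat).
      rewrite <- Rabs_mult in H.
      match type of H with Rabs ?e <= ?g => match goal with |- Rabs ?e' <= ?g' =>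
        replace e' with e; [replace g' with g; [exact H|]|] end end.
      + unfold Y4, b. rewrite Egw. field. lra.
      + unfold Y2, Y3, b, F. rewrite Egw. field. lra.
    - generalize (T2 1 hr (or_introl eq_refl) ltac:(lra) ltac:(lra)).
      replace (x + 1 * hr) with (x + hr) by ring. intros H.
      apply Rmult_le_compat_r with (r := / gamma) in H; [|left; now apply Rinv_0_lt_compat].
      rewrite <- (Rabs_pos_eq (/ gamma)) in H at 1 by (left; now apply Rinv_0_lt_compat).
      rewrite <- Rabs_mult in H.
      match type of H with Rabs ?e <= ?g => match goal with |- Rabs ?e' <= ?g' =>
        replace e' with e; [replace g' with g; [exact H|]|] end end.
      + unfold Y4, b. rewrite Egw. field. lra.
      + unfold Y2, Y3, b, F. rewrite Egw. field. lra. }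
  apply Rle_trans with (1 := Hscheme).
  rewrite (Rmult_assoc C1), (Rmult_assoc (C1 * (C0 + C0 / gamma))), (Rmult_assoc C1).
  apply Rmult_le_compat_l; [lra|].
  assert (HW : 0 < th (b * hl) + th (b * hr)).
  { generalize (th_bounds (b * hl)) (th_bounds (b * hr)) (HbB hl Hhl) (HbB hr Hhr). lra. }
  match goal with |- ?W * ?p <= ?c * (?W * ?q) =>
    replace (c * (W * q)) with (W * (c * q)) by ring end.
  apply Rmult_le_compat_l; [lra|].
  assert (HQe : 0 < Q / eps) by (apply Rdiv_lt_0_compat; lra).
  assert (HQe2 : 0 < Q / eps ^ 2) by (apply Rdiv_lt_0_compat; lra).
  assert (P1 : b * (Rabs Y1 + Rabs Y3) <= (C0 + C0 / gamma) * (1 + Q / eps)).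
  { assert (E1 : b * Rabs Y1 = Rabs (dy x)).
    { unfold Y1, Rdiv. rewrite Rabs_mult, (Rabs_pos_eq (/ b)) by (left; now apply Rinv_0_lt_compat).
      field; lra. }
    assert (E3 : b * Rabs Y3 = Rabs (F1 x) / gamma).
    { unfold Y3, Rdiv. rewrite Rabs_mult, (Rabs_pos_eq (/ (gamma * b))).
      - field; lra.
      - left. apply Rinv_0_lt_compat. now apply Rmult_lt_0_compat. }
    rewrite Rmult_plus_distr_l, E1, E3, Rmult_plus_distr_r. apply Rplus_le_compat.
    - apply Rle_trans with (1 := L1 x Hx). apply one_plus_div_mono; try lra. apply HLQ; lra.
    - apply Rle_trans with (C0 * (1 + Q / eps) / gamma); [|right; field; lra].
      apply Rmult_le_compat_r; [left; now apply Rinv_0_lt_compat|].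
      apply Rle_trans with (1 := L3 x Hx). apply one_plus_div_mono; try lra. apply HLQ; lra. }
  assert (P2 : b ^ 2 * (Rabs Y2 + Y4) <= (C0 + C0 / gamma) * (1 + Q / eps ^ 2)).
  { assert (E2 : b ^ 2 * Rabs Y2 = Rabs (f x (y x)) / eps ^ 2).
    { unfold Y2, Rdiv. rewrite Rabs_mult, (Rabs_pos_eq (/ gamma)) by (left; now apply Rinv_0_lt_compat).
      unfold b. rewrite Egw. field; lra. }
    assert (E4 : b ^ 2 * Y4 = C0 / gamma * (1 + Q / eps ^ 2)).
    { unfold Y4, M, b. rewrite Egw. field; lra. }
    rewrite Rmult_plus_distr_l, E2, E4, Rmult_plus_distr_r. apply Rplus_le_compat_r.
    apply Rle_trans with (C0 * (eps ^ 2 + Q) / eps ^ 2); [|right; field; lra].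
    apply Rmult_le_compat_r; [left; now apply Rinv_0_lt_compat|].
    apply Rle_trans with (1 := L2 x ltac:(lra)). apply Rmult_le_compat_l; [lra|].
    generalize (HLQ x). lra. }
  replace (b * hl - b * hr) with (b * (hl - hr)) by ring.
  rewrite Rabs_mult, (Rabs_pos_eq b), !Rpow_mult_distr by lra.
  rewrite (Rmult_plus_distr_l (C0 + C0 / gamma)). apply Rplus_le_compat.
  - replace (b * Rabs (hl - hr) * (Rabs Y1 + Rabs Y3))
      with (Rabs (hl - hr) * (b * (Rabs Y1 + Rabs Y3))) by ring.
    replace ((C0 + C0 / gamma) * (Rabs (hl - hr) * (1 + Q / eps)))
      with (Rabs (hl - hr) * ((C0 + C0 / gamma) * (1 + Q / eps))) by ring.
    apply Rmult_le_compat_l; [apply Rabs_pos|exact P1].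
  - replace ((b ^ 2 * hl ^ 2 + b ^ 2 * hr ^ 2) * (Rabs Y2 + Y4))
      with ((hl ^ 2 + hr ^ 2) * (b ^ 2 * (Rabs Y2 + Y4))) by ring.
    replace ((C0 + C0 / gamma) * ((hl ^ 2 + hr ^ 2) * (1 + Q / eps ^ 2)))
      with ((hl ^ 2 + hr ^ 2) * ((C0 + C0 / gamma) * (1 + Q / eps ^ 2))) by ring.
    apply Rmult_le_compat_l; [|exact P2].
    generalize (pow2_ge_0 hl) (pow2_ge_0 hr). lra.
Qed.

(** The first bound integrates the layer function, so no [1 / eps] remains; the second takes its
    supremum and keeps the factor [b - a], which cancels the singularity of the weight for small
    steps. *)
Lemma increment_bound (f fx fy fxx fxy fyx fyy : R -> R -> R) (m C0 eps : R) (y dy : R -> R) (a b : R) :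
  0 < m -> 0 < C0 -> 0 < eps < 1 ->
  classical_solution f eps y dy ->
  layer_bounds f fx fy fxx fxy fyx fyy y dy (sqrt m / eps) C0 eps ->
  0 <= a -> a <= b -> b <= 1 ->
  let Q := end_layer (sqrt m / eps) a b in
  Rabs (y b - y a) <= C0 * ((b - a) + Q / sqrt m) /\
  Rabs (y b - y a) <= C0 * (b - a) * (1 + Q / eps).
Proof.
  intros Hm HC0 He [Hc _ _ Hd _] [L1 _ _ _] Ha Hab Hb Q.
  set (r := sqrt m / eps) in *.
  assert (Hs := sqrt_lt_R0 m Hm).
  assert (Hr : 0 <= r) by (apply rate_nonneg; lra).
  split.
  - apply Rle_trans with
      ((C0 * (b + (- exp (- (r * b)) + exp (- (r * (1 - b)))) / sqrt m))
       - C0 * (a + (- exp (- (r * a)) + exp (- (r * (1 - a)))) / sqrt m)).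
    + apply (mean_value_bound y dy
        (fun s => C0 * (s + (- exp (- (r * s)) + exp (- (r * (1 - s)))) / sqrt m))
        (fun s => C0 * (1 + layer r s / eps))); auto.
      * intros s _. eapply is_derive_continuous. auto_derive; [easy|reflexivity].
      * intros s Hs'. apply Hd; lra.
      * intros s Hs'. unfold layer, r. auto_derive; [easy|]. unfold Rminus. field. lra.
      * intros s Hs'. apply L1; lra.
    + unfold Q, end_layer.
      assert (Hi : 0 < / sqrt m) by (now apply Rinv_0_lt_compat).
      generalize (Rmult_lt_0_compat _ _ (exp_pos (- (r * b))) Hi)
        (Rmult_lt_0_compat _ _ (exp_pos (- (r * (1 - a)))) Hi). intros P1 P2.
      rewrite <- Rmult_minus_distr_l. apply Rmult_le_compat_l; [lra|]. unfold Rdiv. lra.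
  - replace (C0 * (b - a) * (1 + Q / eps)) with (C0 * (1 + Q / eps) * b - C0 * (1 + Q / eps) * a) by ring.
    apply (mean_value_bound y dy (fun s => C0 * (1 + Q / eps) * s) (fun s => C0 * (1 + Q / eps))); auto.
    + intros s _. eapply is_derive_continuous. auto_derive; [easy|reflexivity].
    + intros s Hs'. apply Hd; lra.
    + intros s Hs'. auto_derive; [easy|ring].
    + intros s Hs'. apply Rle_trans with (1 := L1 s ltac:(lra)).
      apply one_plus_div_mono; try lra. apply layer_le; lra.
Qed.

Lemma diffusion_weight_bound (t b : R) : 0 <= t <= 1 -> 0 < b ->
  Rabs (diffusion_weight t b) <= 2 + / b.
Proof.
  intros Ht Hb. generalize (th_bounds b Hb) (th_ge_linear b b ltac:(lra)). intros HA HL.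
  assert (0 < / th b <= 1 + 2 * / b).
  { split; [apply Rinv_0_lt_compat; lra|].
    apply Rmult_le_reg_r with (th b * b); [apply Rmult_lt_0_compat; lra|].
    replace (/ th b * (th b * b)) with b by (field; lra).
    replace ((1 + 2 * / b) * (th b * b)) with ((2 + b) * th b) by (field; lra). lra. }
  unfold diffusion_weight. apply Rabs_le. nra.
Qed.

(** No cancellation is used. The weight is at most [2 + 1 / (beta h)]: the constant part goes with
    the first bound of [increment_bound], and the singular part with the second, where
    [1 / (beta h)] times [h (1 + Q / eps)] is of order [eps + Q]. *)
Lemma truncation_crude (f fx fy fxx fxy fyx fyy : R -> R -> R) (m gamma C0 : R) :
  0 < m -> 0 < gamma -> 0 < C0 ->
  exists C, 0 < C /\ forall t eps y dy x hl hr,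
    0 <= t <= 1 -> 0 < eps < 1 ->
    classical_solution f eps y dy ->
    layer_bounds f fx fy fxx fxy fyx fyy y dy (sqrt m / eps) C0 eps ->
    0 < x < 1 -> 0 < hl -> 0 < hr -> 0 <= x - hl -> x + hr <= 1 ->
    let Q := end_layer (sqrt m / eps) (x - hl) (x + hr) in
    Rabs (residual f gamma t eps y x hl hr) <= C * (hl + hr + eps + Q).
Proof.
  intros Hm Hg HC0.
  assert (Hs := sqrt_lt_R0 m Hm). assert (Hw := sqrt_lt_R0 gamma Hg).
  set (w := sqrt gamma) in *.
  assert (Hi : 0 < / sqrt m) by (now apply Rinv_0_lt_compat).
  assert (Hiw : 0 < / w) by (now apply Rinv_0_lt_compat).
  assert (Hig : 0 < / gamma) by (now apply Rinv_0_lt_compat).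
  pose (c := 2 + 2 * / sqrt m + 2 * / w).
  exists (2 * C0 * c + 2 * (C0 * / gamma)).
  assert (HCg : 0 < C0 * / gamma) by (now apply Rmult_lt_0_compat).
  assert (HCc : 0 < C0 * c) by (apply Rmult_lt_0_compat; unfold c; lra).
  split; [lra|].
  intros t eps y dy x hl hr Ht He Hsol Hlb Hx Hhl Hhr Hxl Hxr Q.
  set (r := sqrt m / eps) in *.
  assert (Hr : 0 <= r) by (apply rate_nonneg; lra).
  assert (HQ : 0 < Q) by apply end_layer_pos.
  assert (Hb : forall h, 0 < h -> 0 < w / eps * h).
  { intros h Hh. apply Rmult_lt_0_compat; [apply Rdiv_lt_0_compat; lra|easy]. }
  assert (HD : forall h a b, 0 < h -> b - a = h -> 0 <= a -> b <= 1 ->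
    x - hl <= a -> b <= x + hr ->
    Rabs (diffusion_weight t (w / eps * h)) * Rabs (y b - y a) <= C0 * c * (h + eps + Q)).
  { intros h a b Hh Eh Ha Hb1 Hxa Hbx.
    destruct (increment_bound f fx fy fxx fxy fyx fyy m C0 eps y dy a b) as [I1 I2]; auto; try lra.
    fold r in I1, I2.
    assert (HQ' : end_layer r a b <= Q).
    { unfold Q, end_layer. apply Rplus_le_compat; apply exp_le, Ropp_le_contravar;
      apply Rmult_le_compat_l; lra. }
    assert (HQ0 := end_layer_pos r a b). set (q := end_layer r a b) in *.
    rewrite Eh in I1, I2. set (z := Rabs (y b - y a)) in *.
    assert (Hz : 0 <= z) by apply Rabs_pos.
    apply Rle_trans with ((2 + / (w / eps * h)) * z).
    { apply Rmult_le_compat_r; [easy|]. apply diffusion_weight_bound; auto. }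
    assert (J1 : 2 * z <= C0 * (2 + 2 * / sqrt m) * (h + eps + Q)).
    { apply Rle_trans with (2 * (C0 * (h + q / sqrt m))); [lra|].
      replace (2 * (C0 * (h + q / sqrt m))) with (C0 * (2 * h + 2 * / sqrt m * q)) by (field; lra).
      rewrite (Rmult_assoc C0 (2 + _)). apply Rmult_le_compat_l; [lra|].
      assert (2 * / sqrt m * q <= 2 * / sqrt m * Q) by (apply Rmult_le_compat_l; lra).
      assert (0 <= / sqrt m * (h + eps)) by (apply Rmult_le_pos; lra). lra. }
    assert (J2 : / (w / eps * h) * z <= C0 * (2 * / w) * (h + eps + Q)).
    { apply Rle_trans with (/ (w / eps * h) * (C0 * h * (1 + q / eps))).
      - apply Rmult_le_compat_l; [|easy]. left. apply Rinv_0_lt_compat. auto.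
      - replace (/ (w / eps * h) * (C0 * h * (1 + q / eps))) with (C0 * / w * (eps + q)) by (field; lra).
        assert (HCw : 0 < C0 * / w) by (apply Rmult_lt_0_compat; lra).
        apply Rle_trans with (C0 * / w * (2 * (h + eps + Q))); [|lra].
        apply Rmult_le_compat_l; lra. }
    unfold c. lra. }
  assert (HG : forall s, 0 <= s <= 1 -> x - hl <= s <= x + hr ->
     Rabs (f s (y s) / gamma) <= C0 * / gamma * (eps + Q)).
  { intros s Hs1 Hs2. unfold Rdiv. rewrite Rabs_mult, (Rabs_pos_eq (/ gamma)) by lra.
    replace (C0 * / gamma * (eps + Q)) with (C0 * (eps + Q) * / gamma) by ring.
    apply Rmult_le_compat_r; [lra|]. destruct Hlb as [_ L2 _ _].
    apply Rle_trans with (1 := L2 s Hs1). apply Rmult_le_compat_l; [lra|].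
    generalize (layer_le r (x - hl) (x + hr) s Hr Hs2). fold (end_layer r (x - hl) (x + hr)). fold Q.
    nra. }
  assert (Hcomb : forall u v B, Rabs u <= B -> Rabs v <= B -> Rabs (t * u + (1 - t) * v) <= B).
  { intros u v B Hu Hv. apply Rabs_le_between in Hu. apply Rabs_le_between in Hv. apply Rabs_le. nra. }
  assert (HGl := HG (x - hl) ltac:(lra) ltac:(lra)).
  assert (HG0 := HG x ltac:(lra) ltac:(lra)).
  assert (HGr := HG (x + hr) ltac:(lra) ltac:(lra)).
  assert (Hth : forall h, 0 < h -> Rabs (th (w / eps * h)) <= 1).
  { intros h Hh. apply Rabs_le. generalize (th_bounds _ (Hb h Hh)). lra. }
  unfold residual, scheme. fold w.
  eapply Rle_trans.
  { apply Rabs_le_minus; [apply Rabs_le_minus; [apply Rabs_le_minus|]|].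
    - rewrite Rabs_mult, Rabs_minus_sym. apply HD; lra.
    - rewrite Rabs_mult, Rabs_minus_sym. apply HD; lra.
    - apply Rabs_le_mult.
      + rewrite Rplus_comm. apply Hcomb; [exact HG0|exact HGl].
      + now apply Hth.
    - apply Rabs_le_mult.
      + apply Hcomb; [exact HG0|exact HGr].
      + now apply Hth. }
  assert (0 <= C0 * / gamma * (hl + hr)) by (apply Rmult_le_pos; lra).
  assert (0 <= C0 * c * hl) by (apply Rmult_le_pos; lra).
  assert (0 <= C0 * c * hr) by (apply Rmult_le_pos; lra).
  lra.
Qed.

Lemma mul_exp_opp_le (u : R) : 0 <= u -> u * exp (- u) <= 1.
Proof.
  intros Hu. rewrite exp_Ropp. generalize (exp_ineq1_le u). intros H.
  apply Rmult_le_reg_r with (exp u); [lra|].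
  rewrite Rmult_assoc, Rinv_l by lra. lra.
Qed.

(* [h <= 2 hl] and [h <= 2 hr]: the factor [h / eps] is absorbed by moving
   each exponential to the end of the stencil nearest to its layer. *)
Lemma layer_absorb (r x hl hr h : R) : 0 <= r -> 0 <= h -> 0 <= hl -> 0 <= hr ->
  h <= 2 * hl -> h <= 2 * hr ->
  h * r * layer r x <= 2 * end_layer r (x - hl) (x + hr).
Proof.
  intros Hr Hh Hhl Hhr Hl2 Hr2. unfold layer, end_layer.
  assert (E1 : exp (- (r * x)) = exp (- (r * (x - hl))) * exp (- (r * hl))).
  { rewrite <- exp_plus. f_equal. ring. }
  assert (E2 : exp (- (r * (1 - x))) = exp (- (r * (1 - (x + hr)))) * exp (- (r * hr))).
  { rewrite <- exp_plus. f_equal. ring. }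
  rewrite E1, E2.
  assert (A : forall d z, 0 <= d -> 0 < z -> h <= 2 * d -> h * r * (z * exp (- (r * d))) <= 2 * z).
  { intros d z Hd Hz Hhd.
    assert (H1 := mul_exp_opp_le (r * d) ltac:(now apply Rmult_le_pos)).
    assert (0 <= r * exp (- (r * d))) by (apply Rmult_le_pos; [easy|left; apply exp_pos]).
    assert (h * (r * exp (- (r * d))) <= 2 * d * (r * exp (- (r * d)))) by (apply Rmult_le_compat_r; lra).
    replace (h * r * (z * exp (- (r * d)))) with (z * (h * (r * exp (- (r * d))))) by ring.
    rewrite (Rmult_comm 2 z). apply Rmult_le_compat_l; lra. }
  rewrite Rmult_plus_distr_l, Rmult_plus_distr_l. apply Rplus_le_compat; apply A; auto using exp_pos.
Qed.

(** Both neighbours are expanded at [x] with the majorant [C0 * (s ^ 2 / 2 + layer / m)], which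
    dominates [y'']. The first-order terms leave [(hr - hl) y']. Since the steps are within a factor
    2, [layer_absorb] removes the factor [1 / eps] from this term and from the slope of the
    majorant. *)
Lemma second_difference_bound (f fx fy fxx fxy fyx fyy : R -> R -> R) (m C0 eps : R) (y dy : R -> R) (x hl hr : R) :
  0 < m -> 0 < C0 -> 0 < eps < 1 ->
  classical_solution f eps y dy ->
  layer_bounds f fx fy fxx fxy fyx fyy y dy (sqrt m / eps) C0 eps ->
  0 < x < 1 -> 0 < hl -> 0 < hr -> 0 <= x - hl -> x + hr <= 1 -> hl <= 2 * hr -> hr <= 2 * hl ->
  let Q := end_layer (sqrt m / eps) (x - hl) (x + hr) in
  Rabs (y (x - hl) - 2 * y x + y (x + hr))
  <= C0 * (1 + 6 / m + 2 / sqrt m) * (Rabs (hl - hr) + (hl ^ 2 + hr ^ 2) + Q).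
Proof.
  intros Hm HC0 He [Hc _ _ Hd Heq] [L1 L2 _ _] Hx Hhl Hhr Hxl Hxr Hlr Hrl Q.
  set (r := sqrt m / eps) in *.
  assert (Hs := sqrt_lt_R0 m Hm).
  assert (Hr : 0 <= r) by (apply rate_nonneg; lra).
  assert (Hr2 : eps ^ 2 * r ^ 2 = m) by (apply rate_sq; lra).
  assert (He2 : 0 < eps ^ 2) by (apply pow_lt; lra).
  assert (HQ : 0 < Q) by apply end_layer_pos.
  set (L1d := fun s => r * (- exp (- (r * s)) + exp (- (r * (1 - s))))).
  assert (T : forall sg h, sg = 1 \/ sg = -1 -> 0 <= h -> h <= 2 * hl -> h <= 2 * hr ->
    x - hl <= x + sg * h <= x + hr ->
    Rabs (y (x + sg * h) - (y x + sg * h * dy x)) <= C0 * (h ^ 2 / 2 + 3 * Q / m)).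
  { intros sg h Hsg Hh Hh1 Hh2 Hin.
    eapply Rle_trans.
    - apply (taylor_majorant y dy (fun s => f s (y s) / eps ^ 2)
        (fun s => C0 * (s ^ 2 / 2 + layer r s / m)) (fun s => C0 * (s + L1d s / m))
        (fun s => C0 * (1 + layer r s / eps ^ 2)) 0 1 x h sg); auto; try lra.
      + intros s. unfold L1d, layer. auto_derive; [easy|]. unfold Rminus. field. lra.
      + intros s. unfold L1d. apply (is_derive_scal (fun s => s + r * (- exp (- (r * s)) + exp (- (r * (1 - s)))) / m)).
        replace (1 + layer r s / eps ^ 2) with (1 + r ^ 2 * layer r s / m).
        * apply is_derive_plus_R; [auto_derive; [easy|ring]|].
          apply (is_derive_scal_l (fun s => r * (- exp (- (r * s)) + exp (- (r * (1 - s))))) s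
            (r ^ 2 * layer r s) (/ m)), is_derive2_layer.
        * replace (r ^ 2) with (m / eps ^ 2) by (rewrite <- Hr2 at 1; field; lra). field. lra.
      + intros s Hs'. unfold Rdiv. rewrite Rabs_mult, (Rabs_pos_eq (/ eps ^ 2)) by (left; now apply Rinv_0_lt_compat).
        replace (C0 * (1 + layer r s * / eps ^ 2)) with (C0 * (eps ^ 2 + layer r s) * / eps ^ 2) by (field; lra).
        apply Rmult_le_compat_r; [left; now apply Rinv_0_lt_compat|]. apply L2; lra.
    - assert (Hab := layer_absorb r x hl hr h Hr Hh ltac:(lra) ltac:(lra) Hh1 Hh2). fold Q in Hab.
      assert (HLx := layer_pos r x).
      assert (HLq : layer r (x + sg * h) <= Q) by (now apply layer_le).
      assert (Hd1 : - (sg * h * L1d x) <= h * r * layer r x).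
      { assert (Hu := Rmult_le_pos _ _ (Rmult_le_pos _ _ Hh Hr) (Rlt_le _ _ (exp_pos (- (r * x))))).
        assert (Hv := Rmult_le_pos _ _ (Rmult_le_pos _ _ Hh Hr) (Rlt_le _ _ (exp_pos (- (r * (1 - x)))))).
        unfold L1d, layer. destruct Hsg as [-> | ->]; lra. }
      replace (C0 * ((x + sg * h) ^ 2 / 2 + layer r (x + sg * h) / m) -
        (C0 * (x ^ 2 / 2 + layer r x / m) + sg * h * (C0 * (x + L1d x / m))))
        with (C0 * (h ^ 2 / 2 + (layer r (x + sg * h) - layer r x - sg * h * L1d x) / m)).
      2:{ destruct Hsg as [-> | ->]; field; lra. }
      apply Rmult_le_compat_l; [lra|]. apply Rplus_le_compat_l.
      apply Rmult_le_compat_r; [left; now apply Rinv_0_lt_compat|]. lra. }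
  assert (Tl := T (-1) hl (or_intror eq_refl) ltac:(lra) ltac:(lra) Hlr ltac:(lra)).
  assert (Tr := T 1 hr (or_introl eq_refl) ltac:(lra) Hrl ltac:(lra) ltac:(lra)).
  replace (x + -1 * hl) with (x - hl) in Tl by ring.
  replace (x + 1 * hr) with (x + hr) in Tr by ring.
  set (D := Rabs (hl - hr)) in *.
  assert (HD : 0 <= D <= 2 * hl /\ D <= 2 * hr).
  { unfold D. generalize (Rabs_pos (hl - hr)). intros.
    assert (Rabs (hl - hr) <= 2 * hl) by (apply Rabs_le; lra).
    assert (Rabs (hl - hr) <= 2 * hr) by (apply Rabs_le; lra). lra. }
  assert (Td : Rabs ((hr - hl) * dy x) <= C0 * (D + 2 * Q / sqrt m)).
  { apply Rle_trans with (D * (C0 * (1 + layer r x / eps))).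
    - apply Rabs_le_mult; [unfold D; rewrite Rabs_minus_sym; lra|now apply L1].
    - assert (Hab := layer_absorb r x hl hr D Hr ltac:(lra) ltac:(lra) ltac:(lra) ltac:(lra) ltac:(lra)).
      fold Q in Hab.
      replace (D * (C0 * (1 + layer r x / eps))) with (C0 * (D + D * r * layer r x / sqrt m))
        by (unfold r; field; lra).
      apply Rmult_le_compat_l; [lra|]. apply Rplus_le_compat_l.
      apply Rmult_le_compat_r; [left; now apply Rinv_0_lt_compat|]. lra. }
  replace (y (x - hl) - 2 * y x + y (x + hr)) with
    ((y (x - hl) - (y x + -1 * hl * dy x)) + (y (x + hr) - (y x + 1 * hr * dy x)) + (hr - hl) * dy x) by ring.
  eapply Rle_trans.
  { apply Rabs_le_plus; [apply Rabs_le_plus; [exact Tl|exact Tr]|exact Td]. }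
  assert (Hi : 0 < / sqrt m) by (now apply Rinv_0_lt_compat).
  assert (Hj : 0 < / m) by (now apply Rinv_0_lt_compat).
  unfold Rdiv. rewrite (Rmult_assoc C0), <- !Rmult_plus_distr_l. apply Rmult_le_compat_l; [lra|].
  set (S2 := hl ^ 2 + hr ^ 2).
  assert (HS2 : 0 <= S2) by (unfold S2; generalize (pow2_ge_0 hl) (pow2_ge_0 hr); lra).
  replace (hl ^ 2) with (S2 - hr ^ 2) by (unfold S2; ring).
  assert (0 <= / m * D /\ 0 <= / m * S2) by (split; apply Rmult_le_pos; lra).
  assert (0 <= / sqrt m * D /\ 0 <= / sqrt m * S2) by (split; apply Rmult_le_pos; lra).
  lra.
Qed.

Lemma th_ge_const (w b : R) : 0 < w <= b -> w / (2 + w) <= th b.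
Proof.
  intros H. apply Rle_trans with (2 := th_lower b ltac:(lra)).
  apply Rmult_le_reg_r with ((2 + w) * (2 + b)); [apply Rmult_lt_0_compat; lra|].
  field_simplify; nra.
Qed.

(** For steps at least [eps] the values of [th] are bounded below, hence the weights are bounded.
    The difference of the fluxes is split into a weight times the second difference of [y] and a
    difference of weights times one increment. The terms in [f] are of size [eps ^ 2 + Q], and
    [eps ^ 2] is at most the squared steps. *)
Lemma truncation_comparable (f fx fy fxx fxy fyx fyy : R -> R -> R) (m gamma C0 : R) :
  0 < m -> 0 < gamma -> 0 < C0 ->
  exists C, 0 < C /\ forall t eps y dy x hl hr,
    0 <= t <= 1 -> 0 < eps < 1 ->
    classical_solution f eps y dy ->
    layer_bounds f fx fy fxx fxy fyx fyy y dy (sqrt m / eps) C0 eps ->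
    0 < x < 1 -> eps <= hl -> eps <= hr -> 0 <= x - hl -> x + hr <= 1 ->
    hl <= 2 * hr -> hr <= 2 * hl ->
    let Q := end_layer (sqrt m / eps) (x - hl) (x + hr) in
    Rabs (residual f gamma t eps y x hl hr) <= C * (Rabs (hl - hr) + (hl ^ 2 + hr ^ 2) + Q).
Proof.
  intros Hm Hg HC0.
  assert (Hs := sqrt_lt_R0 m Hm). assert (Hw := sqrt_lt_R0 gamma Hg).
  set (w := sqrt gamma) in *.
  assert (Hi : 0 < / sqrt m) by (now apply Rinv_0_lt_compat).
  assert (Hj : 0 < / m) by (now apply Rinv_0_lt_compat).
  assert (Hiw : 0 < / w) by (now apply Rinv_0_lt_compat).
  assert (Hig : 0 < / gamma) by (now apply Rinv_0_lt_compat).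
  pose (A0 := w / (2 + w)). assert (HA0 : 0 < A0) by (apply Rdiv_lt_0_compat; lra).
  pose (c1 := C0 * (1 + 6 / m + 2 / sqrt m)).
  pose (c2 := / 2 + / (2 * A0 ^ 2)).
  assert (Hc1 : 0 < c1) by (apply Rmult_lt_0_compat; [easy|unfold Rdiv; lra]).
  assert (Hc2 : 0 < c2).
  { unfold c2. assert (0 < / (2 * A0 ^ 2)); [|lra]. apply Rinv_0_lt_compat.
    generalize (pow_lt A0 2 HA0). lra. }
  exists ((2 + / w) * c1 + c2 * (C0 * (4 + / sqrt m)) + 2 * (C0 * / gamma)).
  assert (HCg : 0 < C0 * / gamma) by (now apply Rmult_lt_0_compat).
  assert (P1 : 0 < (2 + / w) * c1) by (apply Rmult_lt_0_compat; lra).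
  assert (P2 : 0 < c2 * (C0 * (4 + / sqrt m))) by (repeat apply Rmult_lt_0_compat; lra).
  split; [lra|].
  intros t eps y dy x hl hr Ht He Hsol Hlb Hx Hhl Hhr Hxl Hxr Hlr Hrl Q.
  assert (HSD := second_difference_bound f fx fy fxx fxy fyx fyy m C0 eps y dy x hl hr Hm HC0 He
    Hsol Hlb Hx ltac:(lra) ltac:(lra) Hxl Hxr Hlr Hrl). cbv zeta in HSD. fold Q c1 in HSD.
  destruct (increment_bound f fx fy fxx fxy fyx fyy m C0 eps y dy (x - hl) x) as [I1 _]; auto; try lra.
  set (r := sqrt m / eps) in *.
  assert (Hr : 0 <= r) by (apply rate_nonneg; lra).
  assert (HQ : 0 < Q) by apply end_layer_pos.
  assert (HQ' : end_layer r (x - hl) x <= Q).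
  { unfold Q, end_layer. apply Rplus_le_compat_l, exp_le, Ropp_le_contravar, Rmult_le_compat_l; lra. }
  assert (HQ0 := end_layer_pos r (x - hl) x). set (q := end_layer r (x - hl) x) in *.
  replace (x - (x - hl)) with hl in I1 by ring.
  set (D := Rabs (hl - hr)) in *. assert (HD : 0 <= D) by apply Rabs_pos.
  set (S2 := hl ^ 2 + hr ^ 2) in *.
  assert (HS2 : eps ^ 2 <= S2).
  { unfold S2. generalize (pow2_ge_0 hr) (pow_incr eps hl 2 ltac:(lra)). lra. }
  assert (He2 : 0 < eps ^ 2) by (apply pow_lt; lra).
  set (X := D + S2 + Q) in *. assert (HX : 0 < X) by (unfold X; lra).
  assert (Hb : forall h, eps <= h -> w <= w / eps * h).
  { intros h Hh. replace w with (w / eps * eps) at 1 by (field; lra).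
    apply Rmult_le_compat_l; [apply Rdiv_le_0_compat|]; lra. }
  set (bl := w / eps * hl). set (br := w / eps * hr).
  assert (Hbl : w <= bl) by now apply Hb. assert (Hbr : w <= br) by now apply Hb.
  assert (Al := th_bounds bl ltac:(lra)). assert (Ar := th_bounds br ltac:(lra)).
  assert (Al0 : A0 <= th bl) by (apply th_ge_const; lra).
  assert (Ar0 : A0 <= th br) by (apply th_ge_const; lra).
  assert (HDw : Rabs (diffusion_weight t br) <= 2 + / w).
  { apply Rle_trans with (2 + / br); [apply diffusion_weight_bound; lra|].
    apply Rplus_le_compat_l, Rinv_le_contravar; lra. }
  assert (Hdiff : Rabs (diffusion_weight t bl - diffusion_weight t br) <= c2 * Rabs (th bl - th br)).
  { unfold diffusion_weight.
    replace ((th bl + / th bl) / 2 - t * th bl - ((th br + / th br) / 2 - t * th br))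
      with (((1 / 2 - t) - / (2 * (th bl * th br))) * (th bl - th br)) by (field; lra).
    apply Rabs_le_mult; [|lra]. unfold c2. apply Rabs_le_minus; [apply Rabs_le; lra|].
    assert (A0 ^ 2 <= th bl * th br).
    { simpl. rewrite Rmult_1_r. apply Rmult_le_compat; lra. }
    assert (0 < A0 ^ 2) by (now apply pow_lt).
    rewrite Rabs_pos_eq by (left; apply Rinv_0_lt_compat; lra).
    apply Rinv_le_contravar; lra. }
  assert (Hth : Rabs (th bl - th br) * Rabs (y x - y (x - hl)) <= C0 * (4 + / sqrt m) * X).
  { apply Rle_trans with (Rabs (th bl - th br) * (C0 * (hl + q / sqrt m))).
    { apply Rmult_le_compat_l; [apply Rabs_pos|exact I1]. }
    assert (M1 : Rabs (th bl - th br) <= 1) by (apply Rabs_le; lra).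
    (* Both arguments are at least [bl / 2]; the factor [beta] in [bl - br] cancels with the one in
       [bl], so the bound does not depend on [eps]. *)
    assert (M2 : Rabs (th bl - th br) * hl <= 4 * D).
    { assert (Hlip := th_lipschitz_decay (bl / 2) bl br ltac:(lra) ltac:(lra)).
      assert (Hbb : bl / 2 <= br).
      { unfold bl, br. assert (0 < w / eps) by (apply Rdiv_lt_0_compat; lra). nra. }
      specialize (Hlip Hbb).
      replace (bl - br) with (w / eps * (hl - hr)) in Hlip by (unfold bl, br; ring).
      rewrite (Rabs_mult (w / eps)), (Rabs_pos_eq (w / eps)) in Hlip by (apply Rdiv_le_0_compat; lra).
      fold D in Hlip.
      replace (4 * D) with (2 * (w / eps * D) / (bl / 2) * hl) by (unfold bl; field; lra).
      apply Rmult_le_compat_r; lra. }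
    assert (M3 : Rabs (th bl - th br) * (q / sqrt m) <= 1 * (Q * / sqrt m)).
    { apply Rmult_le_compat; try lra; [apply Rabs_pos|apply Rdiv_le_0_compat; lra|].
      unfold Rdiv. apply Rmult_le_compat_r; lra. }
    replace (Rabs (th bl - th br) * (C0 * (hl + q / sqrt m)))
      with (C0 * (Rabs (th bl - th br) * hl + Rabs (th bl - th br) * (q / sqrt m))) by ring.
    rewrite Rmult_assoc. apply Rmult_le_compat_l; [lra|].
    assert (0 <= / sqrt m * (D + S2)) by (apply Rmult_le_pos; lra).
    unfold X. lra. }
  assert (HG : forall s, 0 <= s <= 1 -> x - hl <= s <= x + hr ->
     Rabs (f s (y s) / gamma) <= C0 * / gamma * X).
  { intros s Hs1 Hs2. unfold Rdiv. rewrite Rabs_mult, (Rabs_pos_eq (/ gamma)) by lra.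
    replace (C0 * / gamma * X) with (C0 * X * / gamma) by ring.
    apply Rmult_le_compat_r; [lra|]. destruct Hlb as [_ L2 _ _].
    apply Rle_trans with (1 := L2 s Hs1). apply Rmult_le_compat_l; [lra|].
    generalize (layer_le r (x - hl) (x + hr) s Hr Hs2). fold (end_layer r (x - hl) (x + hr)). fold Q.
    unfold X. lra. }
  assert (Hcomb : forall u v B, Rabs u <= B -> Rabs v <= B -> Rabs (t * u + (1 - t) * v) <= B).
  { intros u v B Hu Hv. apply Rabs_le_between in Hu. apply Rabs_le_between in Hv. apply Rabs_le. nra. }
  assert (HGl := HG (x - hl) ltac:(lra) ltac:(lra)).
  assert (HG0 := HG x ltac:(lra) ltac:(lra)).
  assert (HGr := HG (x + hr) ltac:(lra) ltac:(lra)).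
  unfold residual, scheme. fold w bl br.
  replace (diffusion_weight t bl * (y (x - hl) - y x) - diffusion_weight t br * (y x - y (x + hr)))
    with (diffusion_weight t br * (y (x - hl) - 2 * y x + y (x + hr))
      + (diffusion_weight t bl - diffusion_weight t br) * (y (x - hl) - y x)) by ring.
  eapply Rle_trans.
  { apply Rabs_le_minus; [apply Rabs_le_minus; [apply Rabs_le_plus|]|].
    - apply Rabs_le_mult; [exact HDw|exact HSD].
    - rewrite Rabs_mult, (Rabs_minus_sym (y (x - hl))).
      apply Rle_trans with (c2 * (Rabs (th bl - th br) * Rabs (y x - y (x - hl)))).
      + rewrite <- Rmult_assoc. apply Rmult_le_compat_r; [apply Rabs_pos|exact Hdiff].
      + apply Rmult_le_compat_l; [lra|exact Hth].
    - apply Rabs_le_mult.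
      + rewrite Rplus_comm. apply Hcomb; [exact HG0|exact HGl].
      + rewrite Rabs_pos_eq by lra. apply Rlt_le, Al.
    - apply Rabs_le_mult.
      + apply Hcomb; [exact HG0|exact HGr].
      + rewrite Rabs_pos_eq by lra. apply Rlt_le, Ar. }
  right. ring.
Qed.

(* If the two steps are comparable to [eps] use the fourth-order expansion; if
   they are larger than [eps] and comparable to each other use the second
   difference; otherwise the steps themselves are of size [|hl - hr|]. *)
Lemma truncation_outside_layers (f fx fy fxx fxy fyx fyy : R -> R -> R) (m gamma C0 c : R) :
  0 < m -> 0 < gamma -> 0 < C0 -> 0 < c ->
  C2_strip f fx fy fxx fxy fyx fyy ->
  exists C, 0 < C /\ forall t eps y dy x hl hr nu,
    0 <= t <= 1 -> 0 < eps < 1 -> 0 < nu ->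
    classical_solution f eps y dy ->
    layer_bounds f fx fy fxx fxy fyx fyy y dy (sqrt m / eps) C0 eps ->
    0 < x < 1 -> 0 < hl -> 0 < hr -> 0 <= x - hl -> x + hr <= 1 ->
    end_layer (sqrt m / eps) (x - hl) (x + hr) <= c * nu ->
    Rabs (hl - hr) <= c * nu -> hl ^ 2 <= c * nu -> hr ^ 2 <= c * nu ->
    Rabs (residual f gamma t eps y x hl hr)
    <= C * (th (sqrt gamma / eps * hl) + th (sqrt gamma / eps * hr)) * nu.
Proof.
  intros Hm Hg HC0 Hc Hf.
  destruct (truncation_fine f fx fy fxx fxy fyx fyy m gamma C0 2) as [C1 [HC1 B1]]; auto; try lra.
  destruct (truncation_crude f fx fy fxx fxy fyx fyy m gamma C0) as [C2 [HC2 B2]]; auto.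
  destruct (truncation_comparable f fx fy fxx fxy fyx fyy m gamma C0) as [C3 [HC3 B3]]; auto.
  assert (Hw := sqrt_lt_R0 gamma Hg). set (w := sqrt gamma) in *.
  pose (A0 := w / (2 + w)). assert (HA0 : 0 < A0) by (apply Rdiv_lt_0_compat; lra).
  assert (P1 : 0 < C1 * c) by (now apply Rmult_lt_0_compat).
  assert (P2 : 0 < C2 * c / A0) by (apply Rdiv_lt_0_compat; [now apply Rmult_lt_0_compat|easy]).
  assert (P3 : 0 < C3 * c / A0) by (apply Rdiv_lt_0_compat; [now apply Rmult_lt_0_compat|easy]).
  exists (13 * (C1 * c) + 7 * (C2 * c / A0) + 4 * (C3 * c / A0)). split; [lra|].
  intros t eps y dy x hl hr nu Ht He Hnu Hsol Hlb Hx Hhl Hhr Hxl Hxr HQc HDc Hl2 Hr2.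
  assert (HQ := end_layer_pos (sqrt m / eps) (x - hl) (x + hr)).
  assert (Hb : forall h, 0 < h -> 0 < w / eps * h).
  { intros h Hh. apply Rmult_lt_0_compat; [apply Rdiv_lt_0_compat; lra|easy]. }
  assert (Al := th_bounds _ (Hb hl Hhl)). assert (Ar := th_bounds _ (Hb hr Hhr)).
  set (W := th (w / eps * hl) + th (w / eps * hr)) in *.
  set (Q := end_layer (sqrt m / eps) (x - hl) (x + hr)) in *.
  assert (HW : 0 < W) by (unfold W; lra).
  assert (HWn : 0 < W * nu) by (now apply Rmult_lt_0_compat).
  set (D := Rabs (hl - hr)) in *. assert (HD : 0 <= D) by apply Rabs_pos.
  assert (K1 : 0 <= C1 * c * (W * nu)) by (apply Rmult_le_pos; lra).
  assert (K2 : 0 <= C2 * c / A0 * (W * nu)) by (apply Rmult_le_pos; lra).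
  assert (K3 : 0 <= C3 * c / A0 * (W * nu)) by (apply Rmult_le_pos; lra).
  destruct (Rle_lt_dec hl (2 * eps)) as [Cl|Cl]; [destruct (Rle_lt_dec hr (2 * eps)) as [Cr|Cr]|].
  { apply Rle_trans with (C1 * W * (D * (1 + Q / eps) + (hl ^ 2 + hr ^ 2) * (1 + Q / eps ^ 2))).
    - apply (B1 t eps y dy x hl hr); auto; lra.
    - assert (HDe : D <= 2 * eps) by (apply Rabs_le; lra).
      assert (Q1 : D * (Q / eps) <= 2 * Q).
      { apply Rle_trans with (2 * eps * (Q / eps)); [|right; field; lra].
        apply Rmult_le_compat_r; [apply Rdiv_le_0_compat; lra|easy]. }
      assert (Q2 : forall h, 0 < h -> h <= 2 * eps -> h ^ 2 * (Q / eps ^ 2) <= 4 * Q).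
      { intros h Hh Hh2. apply Rle_trans with ((2 * eps) ^ 2 * (Q / eps ^ 2)); [|right; field; lra].
        apply Rmult_le_compat_r; [apply Rdiv_le_0_compat; [lra|apply pow_lt; lra]|].
        apply pow_incr; lra. }
      generalize (Q2 hl Hhl Cl) (Q2 hr Hhr Cr). intros Q3 Q4.
      assert (D * (1 + Q / eps) + (hl ^ 2 + hr ^ 2) * (1 + Q / eps ^ 2) <= 13 * (c * nu)) by lra.
      apply Rle_trans with (C1 * W * (13 * (c * nu))).
      + apply Rmult_le_compat_l; [|easy]. apply Rmult_le_pos; lra.
      + replace (C1 * W * (13 * (c * nu))) with (13 * (C1 * c * (W * nu))) by ring. lra. }
  all: assert (HWA : A0 <= W).
  { assert (A0 <= th (w / eps * hr)); [|unfold W; lra]. apply th_ge_const. split; [easy|].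
    replace w with (w / eps * eps) at 1 by (field; lra).
    apply Rmult_le_compat_l; [apply Rdiv_le_0_compat|]; lra. }
  2:{ assert (A0 <= th (w / eps * hl)); [|unfold W; lra]. apply th_ge_const. split; [easy|].
    replace w with (w / eps * eps) at 1 by (field; lra).
    apply Rmult_le_compat_l; [apply Rdiv_le_0_compat|]; lra. }
  (* In both remaining cases one step exceeds [2 * eps], so [W >= A0] and a bound without the factor
     [W] can be given one at the cost of [1 / A0]. *)
  all: assert (Hup : forall C k X, 0 < C -> 0 <= k -> X <= k * (c * nu) ->
         C * X <= k * (C * c / A0 * (W * nu))).
  1, 3: intros C k X HC Hk HX; apply Rle_trans with (C * (k * (c * nu)));
      [apply Rmult_le_compat_l; lra|];
      replace (k * (C * c / A0 * (W * nu))) with (C * (k * (c * nu)) * (W / A0)) by (field; lra);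
      rewrite <- (Rmult_1_r (C * (k * (c * nu)))) at 1;
      apply Rmult_le_compat_l;
      [ repeat apply Rmult_le_pos; lra
      | apply Rmult_le_reg_r with A0; [easy|]; replace (W / A0 * A0) with W by (field; lra); lra ].
  all: destruct (Rle_lt_dec hl (2 * hr)) as [Dl|Dl]; [destruct (Rle_lt_dec hr (2 * hl)) as [Dr|Dr]|].
  all: assert (HD1 : hl - hr <= D) by apply Rle_abs;
       assert (HD2 : hr - hl <= D) by (unfold D; rewrite Rabs_minus_sym; apply Rle_abs).
  (* Comparable steps, one of them above [2 * eps]: both are then at least [eps], which is the
     reason for the threshold. *)
  1, 4: apply Rle_trans with (C3 * (D + (hl ^ 2 + hr ^ 2) + Q));
    [apply (B3 t eps y dy x hl hr); auto; lra|];
    generalize (Hup C3 4 (D + (hl ^ 2 + hr ^ 2) + Q) HC3 ltac:(lra) ltac:(lra)); lra.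
  (* One step is more than twice the other and the larger exceeds [2 * eps], so each of [hl], [hr],
     [eps] is at most [2 * D]; whence the 7. *)
  all: apply Rle_trans with (C2 * (hl + hr + eps + Q));
    [apply (B2 t eps y dy x hl hr); auto; lra|];
    generalize (Hup C2 7 (hl + hr + eps + Q) HC2 ltac:(lra) ltac:(lra)); lra.
Qed.

(** With equal steps the term in [hl - hr] disappears. The remaining factor [1 + Q / eps^2] is at
    most [3 / eps^2], and [h / eps <= K l]. *)
Lemma truncation_layers (f fx fy fxx fxy fyx fyy : R -> R -> R) (m gamma C0 K : R) :
  0 < m -> 0 < gamma -> 0 < C0 -> 0 < K ->
  C2_strip f fx fy fxx fxy fyx fyy ->
  exists C, 0 < C /\ forall t eps y dy x h l,
    0 <= t <= 1 -> 0 < eps < 1 -> 0 < l <= 1 ->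
    classical_solution f eps y dy ->
    layer_bounds f fx fy fxx fxy fyx fyy y dy (sqrt m / eps) C0 eps ->
    0 < x < 1 -> 0 < h <= K * eps * l -> 0 <= x - h -> x + h <= 1 ->
    Rabs (residual f gamma t eps y x h h)
    <= C * (th (sqrt gamma / eps * h) + th (sqrt gamma / eps * h)) * l ^ 2.
Proof.
  intros Hm Hg HC0 HK Hf.
  destruct (truncation_fine f fx fy fxx fxy fyx fyy m gamma C0 K) as [C1 [HC1 B1]]; auto; try lra.
  exists (6 * C1 * K ^ 2). split.
  { apply Rmult_lt_0_compat; [lra|now apply pow_lt]. }
  intros t eps y dy x h l Ht He Hl Hsol Hlb Hx Hh Hxl Hxr.
  assert (HhK : h <= K * eps).
  { assert (0 < K * eps) by (apply Rmult_lt_0_compat; lra). nra. }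
  assert (H := B1 t eps y dy x h h Ht He Hsol Hlb Hx ltac:(lra) ltac:(lra) Hxl Hxr).
  cbv zeta in H. apply Rle_trans with (1 := H).
  assert (Hr := rate_nonneg m eps ltac:(lra)). set (r := sqrt m / eps) in *.
  assert (HQ : 0 < end_layer r (x - h) (x + h) <= 2).
  { split; [apply end_layer_pos|]. unfold end_layer.
    assert (exp (- (r * (x - h))) <= 1) by (apply exp_le_1, Rmult_le_pos; lra).
    assert (exp (- (r * (1 - (x + h)))) <= 1) by (apply exp_le_1, Rmult_le_pos; lra). lra. }
  set (Q := end_layer r (x - h) (x + h)) in *.
  replace (h - h) with 0 by ring. rewrite Rabs_R0, Rmult_0_l, Rplus_0_l.
  assert (Hb : 0 < sqrt gamma / eps * h).
  { apply Rmult_lt_0_compat; [|lra]. apply Rdiv_lt_0_compat; [now apply sqrt_lt_R0|lra]. }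
  assert (Al := th_bounds _ Hb). set (W := th _ + th _).
  assert (HW : 0 < W) by (unfold W; lra).
  replace (6 * C1 * K ^ 2 * W * l ^ 2) with (C1 * W * (6 * (K * l) ^ 2)) by ring.
  apply Rmult_le_compat_l; [apply Rmult_le_pos; lra|].
  assert (He2 : 0 < eps ^ 2) by (apply pow_lt; lra).
  assert (He1 : eps ^ 2 <= 1) by (simpl; nra).
  apply Rle_trans with ((h ^ 2 + h ^ 2) * (3 / eps ^ 2)).
  - apply Rmult_le_compat_l; [generalize (pow2_ge_0 h); lra|].
    apply Rmult_le_reg_r with (eps ^ 2); [easy|]. field_simplify; lra.
  - apply Rle_trans with (2 * (K * eps * l) ^ 2 * (3 / eps ^ 2)); [|right; field; lra].
    apply Rmult_le_compat_r; [apply Rdiv_le_0_compat; lra|].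
    generalize (pow_incr h (K * eps * l) 2 ltac:(lra)). lra.
Qed.

(** * Interpolation, stability and convergence *)

Definition interpolant (a b ya yb x : R) : R := (yb - ya) / (b - a) * (x - a) + ya.

(** The error has second derivative [u2], so plus or minus the error, less [B], has a positive
    second derivative and is at most 0 at both ends; the maximum principle concludes. *)
Lemma interpolation_barrier (u u1 u2 B B1 B2 : R -> R) (a b : R) :
  a < b ->
  (forall s, a <= s <= b -> continuous u s) ->
  (forall s, a < s < b -> is_derive u s (u1 s)) ->
  (forall s, a < s < b -> is_derive u1 s (u2 s)) ->
  (forall s, is_derive B s (B1 s)) ->
  (forall s, is_derive B1 s (B2 s)) ->
  (forall s, a < s < b -> Rabs (u2 s) < - B2 s) ->
  0 <= B a -> 0 <= B b ->
  forall x, a <= x <= b -> Rabs (u x - interpolant a b (u a) (u b) x) <= B x.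
Proof.
  intros Hab Hc H1 H2 G1 G2 HM Ba Bb x Hx.
  set (k := (u b - u a) / (b - a)).
  assert (Hk : k * (b - a) = u b - u a) by (unfold k; field; lra).
  unfold interpolant. fold k.
  assert (Hlin : forall s, is_derive (fun s => k * (s - a) + u a) s k).
  { intros s. auto_derive; [easy|ring]. }
  assert (Hsg : forall sg, sg = 1 \/ sg = -1 -> sg * (u x - (k * (x - a) + u a)) - B x <= 0).
  { intros sg Hsg.
    apply (maximum_principle (fun s => sg * (u s - (k * (s - a) + u a)) - B s)
      (fun s => sg * (u1 s - k) - B1 s) (fun s => sg * (u2 s - 0) - B2 s) a b); auto.
    - intros s Hs. apply continuous_minus_R; [|eapply is_derive_continuous, G1].
      apply (continuous_scal_r sg (fun s => u s - (k * (s - a) + u a))).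
      apply continuous_minus_R; [now apply Hc|eapply is_derive_continuous, Hlin].
    - intros s Hs. apply is_derive_minus_R; [|apply G1].
      apply (is_derive_scal (fun s => u s - (k * (s - a) + u a))).
      apply is_derive_minus_R; [now apply H1|apply Hlin].
    - intros s Hs. apply is_derive_minus_R; [|apply G2].
      apply (is_derive_scal (fun s => u1 s - k)).
      apply is_derive_minus_R; [now apply H2|]. apply (@is_derive_const R_AbsRing R_NormedModule).
    - intros s Hs _. generalize (Rabs_def2 _ _ (HM s Hs)). destruct Hsg as [-> | ->]; lra.
    - replace (u a - (k * (a - a) + u a)) with 0 by ring. lra.
    - replace (u b - (k * (b - a) + u a)) with 0 by lra. lra. }
  apply Rabs_le.
  generalize (Hsg 1 (or_introl eq_refl)) (Hsg (-1) (or_intror eq_refl)). lra.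
Qed.

(** Here [y''] is at most [3 C0 / eps^2], because the layer function is at most 2; the parabola used
    as barrier has second derivative [- 4 C0 / eps^2], which gives the strict inequality. *)
Lemma interpolation_layers (f fx fy fxx fxy fyx fyy : R -> R -> R) (r C0 eps : R) (y dy : R -> R) (a b : R) :
  0 <= r -> 0 < C0 -> 0 < eps < 1 ->
  classical_solution f eps y dy ->
  layer_bounds f fx fy fxx fxy fyx fyy y dy r C0 eps ->
  0 <= a -> a < b -> b <= 1 ->
  forall x, a <= x <= b ->
    Rabs (y x - interpolant a b (y a) (y b) x) <= 2 * C0 * ((b - a) / eps) ^ 2.
Proof.
  intros Hr HC0 He [Hc _ _ Hd Heq] [_ L2 _ _] Ha Hab Hb x Hx.
  assert (He2 : 0 < eps ^ 2) by (apply pow_lt; lra).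
  assert (He1 : eps ^ 2 <= 1) by (simpl; nra).
  assert (Hi : 0 < / eps ^ 2) by (now apply Rinv_0_lt_compat).
  set (c := 2 * C0 * / eps ^ 2).
  assert (H2C : 0 < c) by (unfold c; apply Rmult_lt_0_compat; lra).
  apply Rle_trans with (c * ((x - a) * (b - x))).
  - apply (interpolation_barrier y dy (fun s => f s (y s) / eps ^ 2)
      (fun s => c * ((s - a) * (b - s))) (fun s => c * ((b - s) - (s - a))) (fun _ => - (2 * c))); auto.
    + intros s Hs. apply Hd; lra.
    + intros s Hs. apply Heq; lra.
    + intros s. auto_derive; [easy|]. ring.
    + intros s. auto_derive; [easy|]. ring.
    + intros s Hs. unfold Rdiv. rewrite Rabs_mult, (Rabs_pos_eq (/ eps ^ 2)) by lra.
      assert (HL : layer r s <= 2).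
      { unfold layer.
        assert (exp (- (r * s)) <= 1) by (apply exp_le_1, Rmult_le_pos; lra).
        assert (exp (- (r * (1 - s))) <= 1) by (apply exp_le_1, Rmult_le_pos; lra). lra. }
      assert (HF : Rabs (f s (y s)) <= 3 * C0).
      { apply Rle_trans with (1 := L2 s ltac:(lra)). rewrite (Rmult_comm 3).
        apply Rmult_le_compat_l; lra. }
      unfold c. rewrite Ropp_involutive, <- !Rmult_assoc. apply Rmult_lt_compat_r; lra.
    + replace ((a - a) * (b - a)) with 0 by ring. lra.
    + replace ((b - a) * (b - b)) with 0 by ring. lra.
  - replace (2 * C0 * ((b - a) / eps) ^ 2) with (c * ((b - a) * (b - a))) by (unfold c; field; lra).
    apply Rmult_le_compat_l; [lra|]. apply Rmult_le_compat; lra.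
Qed.

(** The concave term [(Q - layer) / m] in the barrier has second derivative [- layer / eps^2] and
    matches the layer part of [y'']. It is nonnegative on the cell and at most [Q / m], so no power
    of [1 / eps] is left. *)
Lemma interpolation_outside_layers (f fx fy fxx fxy fyx fyy : R -> R -> R) (m C0 eps : R) (y dy : R -> R) (a b : R) :
  0 < m -> 0 < C0 -> 0 < eps < 1 ->
  classical_solution f eps y dy ->
  layer_bounds f fx fy fxx fxy fyx fyy y dy (sqrt m / eps) C0 eps ->
  0 <= a -> a < b -> b <= 1 ->
  forall x, a <= x <= b ->
    Rabs (y x - interpolant a b (y a) (y b) x)
    <= C0 * ((b - a) ^ 2 + end_layer (sqrt m / eps) a b / m).
Proof.
  intros Hm HC0 He [Hc _ _ Hd Heq] [_ L2 _ _] Ha Hab Hb x Hx.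
  assert (Hr := rate_nonneg m eps ltac:(lra)).
  assert (Hr2 := rate_sq m eps ltac:(lra) Hm).
  set (r := sqrt m / eps) in *. set (Q := end_layer r a b).
  assert (He2 : 0 < eps ^ 2) by (apply pow_lt; lra).
  assert (Hi : 0 < / eps ^ 2) by (now apply Rinv_0_lt_compat).
  assert (Hj : 0 < / m) by (now apply Rinv_0_lt_compat).
  set (L1d := fun s => r * (- exp (- (r * s)) + exp (- (r * (1 - s))))).
  assert (HQ : forall s, a <= s <= b -> 0 <= (Q - layer r s) / m).
  { intros s Hs. apply Rdiv_le_0_compat; [|easy]. generalize (layer_le r a b s Hr Hs).
    unfold Q, end_layer. lra. }
  apply Rle_trans with (C0 * ((x - a) * (b - x) + (Q - layer r x) / m)).
  - apply (interpolation_barrier y dy (fun s => f s (y s) / eps ^ 2)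
      (fun s => C0 * ((s - a) * (b - s) + (Q - layer r s) / m))
      (fun s => C0 * (((b - s) - (s - a)) + (0 - L1d s) / m))
      (fun s => C0 * (- 2 + (0 - r ^ 2 * layer r s) / m))); auto.
    + intros s Hs. apply Hd; lra.
    + intros s Hs. apply Heq; lra.
    + intros s. unfold L1d, layer. auto_derive; [easy|]. unfold Rminus. field. lra.
    + intros s. unfold L1d, layer. auto_derive; [easy|]. unfold Rminus. field. lra.
    + intros s Hs. unfold Rdiv. rewrite Rabs_mult, (Rabs_pos_eq (/ eps ^ 2)) by lra.
      replace (r ^ 2) with (m / eps ^ 2) by (rewrite <- Hr2 at 1; field; lra).
      replace (- (C0 * (-2 + (0 - m / eps ^ 2 * layer r s) * / m)))
        with (C0 * (2 + layer r s * / eps ^ 2)) by (field; lra).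
      apply Rle_lt_trans with (C0 * (eps ^ 2 + layer r s) * / eps ^ 2).
      * apply Rmult_le_compat_r; [lra|]. apply L2; lra.
      * replace (C0 * (eps ^ 2 + layer r s) * / eps ^ 2)
          with (C0 * (1 + layer r s * / eps ^ 2)) by (field; lra).
        apply Rmult_lt_compat_l; lra.
    + replace ((a - a) * (b - a)) with 0 by ring.
      generalize (HQ a ltac:(lra)). intros. apply Rmult_le_pos; lra.
    + replace ((b - a) * (b - b)) with 0 by ring.
      generalize (HQ b ltac:(lra)). intros. apply Rmult_le_pos; lra.
  - apply Rmult_le_compat_l; [lra|]. apply Rplus_le_compat.
    + simpl. rewrite Rmult_1_r. apply Rmult_le_compat; lra.
    + apply Rmult_le_compat_r; [lra|]. generalize (layer_pos r x). lra.
Qed.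

Lemma interpolant_stable (a b ua ub ya yb E x : R) :
  a < b -> a <= x <= b -> Rabs (ua - ya) <= E -> Rabs (ub - yb) <= E ->
  Rabs (interpolant a b ya yb x - interpolant a b ua ub x) <= E.
Proof.
  intros Hab Hx Ha Hb. apply Rabs_le_between in Ha. apply Rabs_le_between in Hb.
  set (s := (x - a) / (b - a)).
  assert (Hs : 0 <= s <= 1).
  { unfold s. split; [apply Rdiv_le_0_compat; lra|].
    apply Rmult_le_reg_r with (b - a); [lra|]. field_simplify; lra. }
  unfold interpolant.
  replace ((yb - ya) / (b - a) * (x - a) + ya - ((ub - ua) / (b - a) * (x - a) + ua))
    with (- (s * (ub - yb) + (1 - s) * (ua - ya))) by (unfold s; field; lra).
  apply Rabs_le. nra.
Qed.

(* Discrete maximum principle at a node where the error is largest; the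
   off-diagonal coefficients are nonnegative because [q <= gamma]. *)
Lemma scheme_stable (t bl br m gamma el e0 er ql q0 qr S : R) :
  0 <= t <= 1 -> 0 < bl -> 0 < br -> 0 < m ->
  m <= ql <= gamma -> m <= q0 <= gamma -> m <= qr <= gamma ->
  Rabs el <= Rabs e0 -> Rabs er <= Rabs e0 ->
  Rabs (scheme t bl br el e0 er (ql * el / gamma) (q0 * e0 / gamma) (qr * er / gamma))
    <= S * (th bl + th br) ->
  Rabs e0 <= gamma / m * S.
Proof.
  intros Ht Hl Hr Hm Hql Hq0 Hqr Hel Her HS.
  assert (Hg : 0 < gamma) by lra.
  assert (Al := th_bounds bl Hl). assert (Ar := th_bounds br Hr).
  set (W := th bl + th br) in *. assert (HW : 0 < W) by (unfold W; lra).
  assert (Hco : forall b q, 0 < th b < 1 -> m <= q <= gamma ->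
     0 <= diffusion_weight t b - (1 - t) * (q / gamma) * th b).
  { intros b q Hb Hq. unfold diffusion_weight.
    assert (Hqg : 0 <= q / gamma <= 1).
    { split; [apply Rdiv_le_0_compat; lra|]. apply Rmult_le_reg_r with gamma; [lra|]. field_simplify; lra. }
    assert (1 <= / th b) by (rewrite <- Rinv_1 at 1; apply Rinv_le_contravar; lra).
    assert ((1 - t) * (q / gamma) * th b <= (1 - t) * 1 * th b).
    { apply Rmult_le_compat_r; [lra|]. apply Rmult_le_compat_l; lra. }
    lra. }
  assert (Cl := Hco bl ql Al Hql). assert (Cr := Hco br qr Ar Hqr).
  set (al := diffusion_weight t bl - (1 - t) * (ql / gamma) * th bl) in *.
  set (ar := diffusion_weight t br - (1 - t) * (qr / gamma) * th br) in *.
  set (a0 := diffusion_weight t bl + diffusion_weight t br + t * (q0 / gamma) * W).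
  assert (E : scheme t bl br el e0 er (ql * el / gamma) (q0 * e0 / gamma) (qr * er / gamma)
    = al * el + ar * er - a0 * e0).
  { unfold scheme, al, ar, a0, W. field. lra. }
  rewrite E in HS.
  assert (Ha0 : m / gamma * W <= a0 - al - ar).
  { replace (a0 - al - ar) with (/ gamma * (t * q0 * W + (1 - t) * (ql * th bl + qr * th br)))
      by (unfold a0, al, ar, W; field; lra).
    replace (m / gamma * W) with (/ gamma * (t * m * W + (1 - t) * (m * th bl + m * th br)))
      by (unfold W; field; lra).
    apply Rmult_le_compat_l; [left; now apply Rinv_0_lt_compat|].
    apply Rplus_le_compat.
    - apply Rmult_le_compat_r; [lra|]. apply Rmult_le_compat_l; lra.
    - apply Rmult_le_compat_l; [lra|]. apply Rplus_le_compat; apply Rmult_le_compat_r; lra. }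
  assert (Hlow : (a0 - al - ar) * Rabs e0 <= Rabs (al * el + ar * er - a0 * e0)).
  { assert (Hm0 : 0 <= m / gamma * W).
    { apply Rmult_le_pos; [apply Rdiv_le_0_compat; lra|lra]. }
    assert (T : Rabs (a0 * e0) <= Rabs (al * el + ar * er - a0 * e0) + (al * Rabs e0 + ar * Rabs e0)).
    { replace (a0 * e0) with (- (al * el + ar * er - a0 * e0) + (al * el + ar * er)) at 1 by ring.
      apply Rabs_le_plus; [rewrite Rabs_Ropp; lra|].
      apply Rabs_le_plus; apply Rabs_le_mult; auto; rewrite Rabs_pos_eq; lra. }
    rewrite Rabs_mult, (Rabs_pos_eq a0) in T by lra. lra. }
  assert (Hfin : m / gamma * W * Rabs e0 <= S * W).
  { apply Rle_trans with ((a0 - al - ar) * Rabs e0); [|lra].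
    apply Rmult_le_compat_r; [apply Rabs_pos|easy]. }
  apply Rmult_le_reg_l with (m / gamma * W).
  { apply Rmult_lt_0_compat; [apply Rdiv_lt_0_compat|]; lra. }
  replace (m / gamma * W * (gamma / m * S)) with (S * W) by (field; lra). exact Hfin.
Qed.

(** * Discrete stability *)

Lemma finite_argmax (e : nat -> R) (N : nat) :
  exists i, (i <= N)%nat /\ forall j, (j <= N)%nat -> e j <= e i.
Proof.
  induction N as [|N [i [Hi H]]].
  - exists O. split; [lia|]. intros j Hj. replace j with O by lia. lra.
  - destruct (Rle_lt_dec (e (S N)) (e i)) as [C|C].
    + exists i. split; [lia|]. intros j Hj.
      destruct (Nat.eq_dec j (S N)) as [->|]; [easy|]. apply H; lia.
    + exists (S N). split; [lia|]. intros j Hj.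
      destruct (Nat.eq_dec j (S N)) as [->|]; [lra|]. specialize (H j ltac:(lia)). lra.
Qed.

Lemma T_interior (f : R -> R -> R) (m gamma t eps : R) (n i : nat) (u : nat -> R) :
  0 < m -> 0 < gamma -> 0 < eps -> (S i < 4 * n)%nat ->
  let h j := sqrt gamma / eps * step m eps (4 * n) j in
  let g j := f (mesh m eps (4 * n) j) (u j) / gamma in
  T f m gamma t eps (4 * n) u (S i)
  = gamma / (th (h i) + th (h (S i))) *
    scheme t (h i) (h (S i)) (u i) (u (S i)) (u (S (S i))) (g i) (g (S i)) (g (S (S i))).
Proof.
  intros Hm Hg He Hi h g.
  assert (Hh : forall j, (j < 4 * n)%nat -> 0 < h j).
  { intros j Hj. unfold h. apply Rmult_lt_0_compat.
    - apply Rdiv_lt_0_compat; [now apply sqrt_lt_R0|easy].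
    - now apply step_bounds. }
  unfold T. cbv zeta.
  destruct (Nat.eqb_spec (S i) 0) as [|_]; [lia|].
  destruct (Nat.eqb_spec (S i) (4 * n)) as [|_]; [lia|]. simpl orb. cbv iota.
  replace (S i - 1)%nat with i by lia. replace (S i + 1)%nat with (S (S i)) by lia.
  change (sqrt gamma / eps * step m eps (4 * n) i) with (h i).
  change (sqrt gamma / eps * step m eps (4 * n) (S i)) with (h (S i)).
  rewrite !th_cosh_sinh, !diffusion_weight_cosh_sinh by (apply Hh; lia).
  unfold scheme, g. f_equal. field. lra.
Qed.

(** The error vanishes at both end nodes. At an interior node where it is largest, [scheme] of [u]
    is 0, since the prefactor in [T] is positive; hence [scheme] of the error, with [f] linearized
    by [slope_between], is minus the residual, and [scheme_stable] applies. *)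
Lemma discrete_stability (f fy : R -> R -> R) (m gamma t eps E : R) (n : nat) (y : R -> R) (u : nat -> R) :
  0 < m -> 0 < gamma -> 0 < eps -> 0 <= t <= 1 -> (0 < n)%nat -> 0 <= E ->
  (forall x s, is_derive (fun s => f x s) s (fy x s)) ->
  (forall x s, m <= fy x s <= gamma) ->
  y 0 = 0 -> y 1 = 0 ->
  discrete_solution f m gamma t eps (4 * n) u ->
  (forall i, (S i < 4 * n)%nat ->
     Rabs (residual f gamma t eps y (mesh m eps (4 * n) (S i))
       (step m eps (4 * n) i) (step m eps (4 * n) (S i)))
     <= E * (th (sqrt gamma / eps * step m eps (4 * n) i)
             + th (sqrt gamma / eps * step m eps (4 * n) (S i)))) ->
  forall i, (i <= 4 * n)%nat -> Rabs (u i - y (mesh m eps (4 * n) i)) <= gamma / m * E.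
Proof.
  intros Hm Hg He Ht Hn HE Hfy Hb Hy0 Hy1 Hu Hres.
  set (e := fun i => u i - y (mesh m eps (4 * n) i)).
  assert (HK : 0 <= gamma / m * E) by (apply Rmult_le_pos; [apply Rdiv_le_0_compat|]; lra).
  destruct (finite_argmax (fun i => Rabs (e i)) (4 * n)) as [k [Hk Hmax]].
  intros i Hi. apply Rle_trans with (Rabs (e k)); [now apply Hmax|].
  assert (E0 : e 0%nat = 0).
  { unfold e. rewrite mesh_0, Hy0. specialize (Hu 0%nat ltac:(lia)). unfold T in Hu. simpl in Hu. lra. }
  assert (EN : e (4 * n)%nat = 0).
  { unfold e. rewrite mesh_N, Hy1 by lia. specialize (Hu (4 * n)%nat ltac:(lia)). unfold T in Hu.
    rewrite (Nat.eqb_refl (4 * n)), Bool.orb_true_r in Hu. lra. }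
  destruct (Nat.eq_dec k 0) as [->|Hk0]; [rewrite E0, Rabs_R0; lra|].
  destruct (Nat.eq_dec k (4 * n)) as [->|HkN]; [rewrite EN, Rabs_R0; lra|].
  destruct k as [|j]; [lia|].
  assert (HT := Hu (S j) Hk).
  rewrite T_interior in HT by (auto; lia).
  specialize (Hres j ltac:(lia)).
  set (h := fun j => sqrt gamma / eps * step m eps (4 * n) j). cbv beta zeta in HT.
  change (sqrt gamma / eps * step m eps (4 * n) j) with (h j) in HT, Hres.
  change (sqrt gamma / eps * step m eps (4 * n) (S j)) with (h (S j)) in HT, Hres.
  assert (Hh : forall j, (j < 4 * n)%nat -> 0 < h j).
  { intros l Hl. unfold h. apply Rmult_lt_0_compat.
    - apply Rdiv_lt_0_compat; [now apply sqrt_lt_R0|easy].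
    - now apply step_bounds. }
  assert (H0 := Hh j ltac:(lia)). assert (H1 := Hh (S j) ltac:(lia)).
  assert (A0 := th_bounds _ H0). assert (A1 := th_bounds _ H1).
  assert (HT0 := Rmult_integral _ _ HT). destruct HT0 as [HT0|HT0].
  { exfalso. assert (0 < gamma / (th (h j) + th (h (S j)))); [|lra].
    apply Rdiv_lt_0_compat; lra. }
  unfold residual in Hres.
  change (sqrt gamma / eps * step m eps (4 * n) j) with (h j) in Hres.
  change (sqrt gamma / eps * step m eps (4 * n) (S j)) with (h (S j)) in Hres.
  replace (mesh m eps (4 * n) (S j) - step m eps (4 * n) j) with (mesh m eps (4 * n) j)
    in Hres by (rewrite mesh_S; ring).
  rewrite <- mesh_S in Hres.
  set (x := mesh m eps (4 * n)) in *.
  destruct (slope_between f fy m gamma (x j) (u j) (y (x j))) as [ql [Hql Eql]]; auto.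
  destruct (slope_between f fy m gamma (x (S j)) (u (S j)) (y (x (S j))))
    as [q0 [Hq0 Eq0]]; auto.
  destruct (slope_between f fy m gamma (x (S (S j))) (u (S (S j)))
    (y (x (S (S j))))) as [qr [Hqr Eqr]]; auto.
  apply (scheme_stable t (h j) (h (S j)) m gamma (e j) (e (S j))
    (e (S (S j))) ql q0 qr E); auto; try (apply Hmax; lia).
  unfold e at 1 2 3 4 5 6. fold x. rewrite <- Eql, <- Eq0, <- Eqr.
  rewrite <- Rabs_Ropp.
  match type of Hres with Rabs ?a <= _ => match type of HT0 with ?b = 0 =>
    match goal with |- Rabs ?c <= _ => replace c with (a - b) end end end.
  - rewrite HT0, Rminus_0_r. exact Hres.
  - unfold scheme, Rdiv. ring.
Qed.

(** * Assembly of the global error estimate *)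

Lemma mesh_cell (m eps x : R) (n : nat) : 0 < m -> 0 < eps -> (0 < n)%nat -> 0 <= x <= 1 ->
  exists i, (i < 4 * n)%nat /\ mesh m eps (4 * n) i <= x <= mesh m eps (4 * n) (S i).
Proof.
  intros Hm He Hn Hx.
  assert (H : forall k, (k <= 4 * n)%nat -> x <= mesh m eps (4 * n) k -> (0 < k)%nat ->
    exists i, (i < 4 * n)%nat /\ mesh m eps (4 * n) i <= x <= mesh m eps (4 * n) (S i)).
  { induction k as [|k IH]; intros Hk Hxk Hk0; [lia|].
    destruct (Rle_lt_dec (mesh m eps (4 * n) k) x) as [C|C].
    - exists k. split; [lia|lra].
    - apply IH; [lia|lra|]. destruct k; [|lia]. rewrite mesh_0 in C. lra. }
  apply (H (4 * n)%nat); try lia. rewrite mesh_N by lia. lra.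
Qed.

(** It turns the contributions of order [N^-2] from the core into contributions of order
    [(ln N / N)^2]. *)
Lemma ln_ge_1 (N : nat) : (4 <= N)%nat -> 1 <= ln (INR N).
Proof.
  intros HN. apply le_INR in HN. simpl in HN.
  rewrite <- (ln_exp 1) at 1. apply ln_le; [apply exp_pos|].
  generalize exp_le_3. lra.
Qed.

Lemma ln_le_self (x : R) : 0 < x -> ln x <= x.
Proof.
  intros Hx. rewrite <- (ln_exp x) at 2. apply ln_le; [easy|].
  generalize (exp_ineq1_le x). lra.
Qed.

Lemma global_error (f fx fy fxx fxy fyx fyy : R -> R -> R) (m gamma t : R) :
  0 < m -> 0 < gamma -> 0 <= t <= 1 ->
  C2_strip f fx fy fxx fxy fyx fyy ->
  (forall x s, m <= fy x s <= gamma) ->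
  exists C, 0 < C /\ forall eps n y dy u,
    0 < eps < 1 -> (0 < n)%nat ->
    classical_solution f eps y dy ->
    discrete_solution f m gamma t eps (4 * n) u ->
    forall i x, (i < 4 * n)%nat -> mesh m eps (4 * n) i <= x <= mesh m eps (4 * n) (S i) ->
      Rabs (y x - interpolant (mesh m eps (4 * n) i) (mesh m eps (4 * n) (S i)) (u i) (u (S i)) x)
      <= C * (ln (INR (4 * n)) / INR (4 * n)) ^ 2.
Proof.
  intros Hm Hg Ht Hf Hb.
  destruct (solution_layer_bounds f fx fy fxx fxy fyx fyy m gamma Hm Hf Hb) as [C0 [HC0 Hlb]].
  (* [K] is the constant of [layer_step_bound]. In [c], the term [2 * exp 8] is the size of the
     layer function in the core, and [49 = 7 ^ 2] bounds the squared steps and also the 48 of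
     [step_variation]. *)
  pose (K := 8 / sqrt m). pose (c := 2 * exp 8 + 49).
  assert (HK : 0 < K) by (apply Rdiv_lt_0_compat; [lra|now apply sqrt_lt_R0]).
  assert (He8 := exp_pos 8). assert (Hc : 0 < c) by (unfold c; lra).
  destruct (truncation_layers f fx fy fxx fxy fyx fyy m gamma C0 K) as [C1 [HC1 B1]]; auto.
  destruct (truncation_outside_layers f fx fy fxx fxy fyx fyy m gamma C0 c) as [C2 [HC2 B2]]; auto.
  assert (P1 : 0 < gamma / m) by (now apply Rdiv_lt_0_compat).
  assert (P2 : 0 < gamma / m * (C1 + C2)) by (apply Rmult_lt_0_compat; lra).
  assert (P3 : 0 < 2 * C0 * K ^ 2) by (apply Rmult_lt_0_compat; [lra|now apply pow_lt]).
  assert (P4 : 0 < C0 * (c + c / m)).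
  { apply Rmult_lt_0_compat; [easy|]. generalize (Rdiv_lt_0_compat c m Hc Hm). lra. }
  exists (gamma / m * (C1 + C2) + 2 * C0 * K ^ 2 + C0 * (c + c / m)). split; [lra|].
  intros eps n y dy u He Hn Hsol Hu i x Hi Hx.
  specialize (Hlb eps y dy He Hsol).
  assert (HN4 : (4 <= 4 * n)%nat) by lia.
  set (N := (4 * n)%nat) in *.
  assert (Hln := ln_ge_1 N HN4).
  assert (HNR : 4 <= INR N) by (apply le_INR in HN4; simpl in HN4; lra).
  set (l := ln (INR N) / INR N).
  assert (Hl : 0 < l <= 1).
  { unfold l. split; [apply Rdiv_lt_0_compat; lra|].
    apply Rmult_le_reg_r with (INR N); [lra|].
    replace (ln (INR N) / INR N * INR N) with (ln (INR N)) by (field; lra).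
    generalize (ln_le_self (INR N)). lra. }
  assert (Hl2 : 0 < l ^ 2) by (apply pow_lt; lra).
  assert (HN2 : 0 < / INR N ^ 2) by (apply Rinv_0_lt_compat, pow_lt; lra).
  assert (Hnu : / INR N ^ 2 <= l ^ 2).
  { unfold l, Rdiv. rewrite Rpow_mult_distr, pow_inv.
    rewrite <- (Rmult_1_l (/ INR N ^ 2)) at 1. apply Rmult_le_compat_r; [lra|].
    apply pow_R1_Rle. lra. }
  assert (Hst : forall j, (j < N)%nat -> 0 < step m eps N j <= 7 / INR N).
  { intros j Hj. apply step_bounds; auto; lra. }
  assert (Hst2 : forall j, (j < N)%nat -> step m eps N j ^ 2 <= 49 * / INR N ^ 2).
  { intros j Hj. replace (49 * / INR N ^ 2) with ((7 / INR N) ^ 2) by (field; lra).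
    apply pow_incr. generalize (Hst j Hj). lra. }
  assert (Hmesh : forall j, (j <= N)%nat -> 0 <= mesh m eps N j <= 1).
  { intros j Hj. apply mesh_in; auto; lra. }
  assert (HQ : 2 * exp 8 / INR N ^ 2 <= c * l ^ 2).
  { apply Rle_trans with (c * / INR N ^ 2); [|apply Rmult_le_compat_l; lra].
    apply Rmult_le_compat_r; [lra|unfold c; lra]. }
  assert (H49 : 49 * / INR N ^ 2 <= c * l ^ 2).
  { apply Rle_trans with (c * / INR N ^ 2); [|apply Rmult_le_compat_l; lra].
    apply Rmult_le_compat_r; [lra|unfold c; lra]. }
  assert (Hnode : forall j, (j <= N)%nat ->
    Rabs (u j - y (mesh m eps N j)) <= gamma / m * ((C1 + C2) * l ^ 2)).
  { apply (discrete_stability f fy m gamma t eps ((C1 + C2) * l ^ 2) n y u); auto; try lra.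
    - apply Rmult_le_pos; lra.
    - apply (C1_derive_y f fx fy), Hf.
    - apply Hsol.
    - apply Hsol.
    - intros j Hj. fold N in Hj |- *.
      assert (S0 := Hst j ltac:(lia)). assert (S1 := Hst (S j) ltac:(lia)).
      assert (M0 := Hmesh j ltac:(lia)). assert (M2 := Hmesh (S (S j)) ltac:(lia)).
      assert (E0 : mesh m eps N (S j) - step m eps N j = mesh m eps N j) by (rewrite mesh_S; ring).
      assert (E2 : mesh m eps N (S j) + step m eps N (S j) = mesh m eps N (S (S j))) by (now rewrite <- mesh_S).
      assert (Hb0 : forall j, (j < N)%nat -> 0 < th (sqrt gamma / eps * step m eps N j)).
      { intros k Hk. apply th_bounds, Rmult_lt_0_compat; [|now apply Hst].
        apply Rdiv_lt_0_compat; [now apply sqrt_lt_R0|lra]. }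
      assert (T0 := Hb0 j ltac:(lia)). assert (T1 := Hb0 (S j) Hj).
      set (W := th _ + th _) in *. assert (HW : 0 < W) by (unfold W; lra).
      assert (HC1l : 0 <= C1 * l ^ 2 * W) by (repeat apply Rmult_le_pos; lra).
      assert (HC2l : 0 <= C2 * l ^ 2 * W) by (repeat apply Rmult_le_pos; lra).
      assert (Hdich := node_dichotomy m eps n j Hm ltac:(lra) Hj). fold N in Hdich.
      destruct Hdich as [[Eq Hsm]|HQj].
      + apply Rle_trans with (C1 * W * l ^ 2); [|lra].
        unfold W. rewrite <- Eq in *.
        apply (B1 t eps y dy (mesh m eps N (S j)) (step m eps N j) l); auto; fold K l in Hsm; lra.
      + apply Rle_trans with (C2 * W * l ^ 2); [|lra].
        apply (B2 t eps y dy (mesh m eps N (S j)) (step m eps N j) (step m eps N (S j)) (l ^ 2));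
          auto; try lra.
        * rewrite E0, E2. unfold end_layer. lra.
        * rewrite Rabs_minus_sym.
          apply Rle_trans with (1 := step_variation m eps n j Hm ltac:(lra) Hj). fold N.
          unfold Rdiv. lra.
        * generalize (Hst2 j ltac:(lia)). lra.
        * generalize (Hst2 (S j) Hj). lra. }
  assert (Si := Hst i Hi). assert (M0 := Hmesh i ltac:(lia)). assert (M1 := Hmesh (S i) ltac:(lia)).
  assert (Eh : mesh m eps N (S i) - mesh m eps N i = step m eps N i) by (rewrite mesh_S; ring).
  assert (Hint : Rabs (y x - interpolant (mesh m eps N i) (mesh m eps N (S i))
      (y (mesh m eps N i)) (y (mesh m eps N (S i))) x)
      <= (2 * C0 * K ^ 2 + C0 * (c + c / m)) * l ^ 2).
  { assert (Q3 : 0 <= 2 * C0 * K ^ 2 * l ^ 2) by (apply Rmult_le_pos; lra).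
    assert (Q4 : 0 <= C0 * (c + c / m) * l ^ 2) by (apply Rmult_le_pos; lra).
    assert (Hdich := step_dichotomy m eps n i Hm ltac:(lra) Hi). fold N in Hdich.
    destruct Hdich as [Hsm|HQi].
    - eapply Rle_trans.
      + apply (interpolation_layers f fx fy fxx fxy fyx fyy (sqrt m / eps) C0 eps y dy); auto; try lra.
        apply rate_nonneg; lra.
      + rewrite Eh. fold K l in Hsm.
        apply Rle_trans with (2 * C0 * (K * l) ^ 2); [|rewrite Rpow_mult_distr; lra].
        apply Rmult_le_compat_l; [lra|]. apply pow_incr. split; [apply Rdiv_le_0_compat; lra|].
        apply Rmult_le_reg_r with eps; [lra|].
        replace (step m eps N i / eps * eps) with (step m eps N i) by (field; lra). lra.
    - eapply Rle_trans.
      + apply (interpolation_outside_layers f fx fy fxx fxy fyx fyy m C0 eps y dy); auto; lra.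
      + rewrite Eh. unfold end_layer.
        apply Rle_trans with (C0 * (c * l ^ 2 + c * l ^ 2 / m)).
        * apply Rmult_le_compat_l; [lra|]. apply Rplus_le_compat.
          -- generalize (Hst2 i Hi). lra.
          -- apply Rmult_le_compat_r; [left; now apply Rinv_0_lt_compat|]. lra.
        * unfold Rdiv in *. lra. }
  replace (y x - interpolant (mesh m eps N i) (mesh m eps N (S i)) (u i) (u (S i)) x) with
    ((y x - interpolant (mesh m eps N i) (mesh m eps N (S i)) (y (mesh m eps N i)) (y (mesh m eps N (S i))) x)
     + (interpolant (mesh m eps N i) (mesh m eps N (S i)) (y (mesh m eps N i)) (y (mesh m eps N (S i))) x
        - interpolant (mesh m eps N i) (mesh m eps N (S i)) (u i) (u (S i)) x)) by ring.
  eapply Rle_trans.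
  - apply Rabs_le_plus; [exact Hint|].
    apply (interpolant_stable _ _ _ _ _ _ (gamma / m * ((C1 + C2) * l ^ 2))); try lra.
    + apply Hnode; lia.
    + apply Hnode; lia.
  - lra.
Qed.

Lemma T_ext (f g : R -> R -> R) (m gamma t eps : R) (N i : nat) (u : nat -> R) :
  (forall j, (j <= N)%nat -> f (mesh m eps N j) (u j) = g (mesh m eps N j) (u j)) ->
  (i <= N)%nat ->
  T f m gamma t eps N u i = T g m gamma t eps N u i.
Proof.
  intros H Hi. unfold T. cbv zeta.
  destruct (Nat.eqb_spec i 0); [easy|]. destruct (Nat.eqb_spec i N); [easy|]. simpl orb. cbv iota.
  now rewrite !H by lia.
Qed.

Theorem theorem6p1 :
  forall (k : nat) (f : R -> R -> R) (m gamma t : R),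
    (2 <= k)%nat ->
    Ck_strip k f ->
    0 < m ->
    (forall x y : R, 0 <= x <= 1 -> m <= Derive (fun s => f x s) y) ->
    (forall x y : R, 0 <= x <= 1 -> Derive (fun s => f x s) y <= gamma) ->
    0 <= t <= 1 ->
    exists C : R, 0 < C /\
      forall (eps : R) (N : nat),
        0 < eps < 1 ->
        (0 < N)%nat -> Nat.divide 4 N ->
        forall (y : R -> R) (ybar : nat -> R) (P : R -> R),
          bvp_solution f eps y ->
          discrete_solution f m gamma t eps N ybar ->
          is_global_solution m eps N ybar P ->
          forall x : R, 0 <= x <= 1 ->
            Rabs (y x - P x) <= C * ln (INR N) ^ 2 / INR N ^ 2.
Proof.
  intros k f m gamma t Hk HCk Hm Hlo Hhi Ht.
  destruct (C2_strip_clamp k f Hk HCk) as [fx [fy [fxx [fxy [fyx [fyy Hf]]]]]].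
  assert (Hb : forall x s, m <= fy x s <= gamma).
  (* Clamping makes the bounds on the [y]-derivative, assumed on the strip, valid for every real
     abscissa. *)
  { intros x s.
    replace (fy x s) with (Derive (fun s => f (clamp x) s) s).
    - split; [apply Hlo|apply Hhi]; apply clamp_in.
    - apply is_derive_unique, (C1_derive_y _ _ _ (C2_f _ _ _ _ _ _ _ Hf)). }
  assert (Hg : 0 < gamma) by (generalize (Hb 0 0); lra).
  destruct (global_error (fun x => f (clamp x)) fx fy fxx fxy fyx fyy m gamma t Hm Hg Ht Hf Hb)
    as [C [HC Herr]].
  exists C. split; [easy|].
  intros eps N He HN [n Hn] y ybar P Hy Hu HP x Hx.
  assert (EN : N = (4 * n)%nat) by lia. clear Hn. subst N.
  assert (Hn : (0 < n)%nat) by lia.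
  destruct (mesh_cell m eps x n Hm ltac:(lra) Hn Hx) as [i [Hi Hxi]].
  (* The discrete problem samples [f] only at mesh points, which lie in [[0,1]], so clamping does
     not change it. *)
  assert (Hu' : discrete_solution (fun x => f (clamp x)) m gamma t eps (4 * n) ybar).
  { intros j Hj. rewrite <- (Hu j Hj). symmetry. apply T_ext; [|easy].
    intros l Hl. rewrite clamp_id; [easy|]. apply mesh_in; auto; lra. }
  assert (H := Herr eps n (fun x => y (clamp x)) (Derive y) ybar He Hn
    (bvp_solution_clamp f eps y ltac:(lra) Hy) Hu' i x Hi Hxi).
  cbv beta in H. rewrite clamp_id in H by easy.
  (* Cells are numbered by their right end in [is_global_solution] and by their left end in
     [global_error]. *)
  rewrite (HP (S i) x); [|lia|].
  - replace (S i - 1)%nat with i by lia.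
    replace (C * ln (INR (4 * n)) ^ 2 / INR (4 * n) ^ 2)
      with (C * (ln (INR (4 * n)) / INR (4 * n)) ^ 2); [exact H|].
    field. apply not_0_INR. lia.
  - now replace (S i - 1)%nat with i by lia.
Qed.
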